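(* Let $d\geq 1$ and $K\geq 1+\frac{3}{d}$ be integers, and let $a(\cdot)$ be a nonincreasing nonnegative function. Let ${\bf W}_1,\dots,{\bf W}_K$ be $K$ independent standard $d$-dimensional Wiener processes, all starting from $0$, and let ${\bf S}_1,\dots,{\bf S}_K$ be $K$ independent simple symmetric random walks on $\mathbb{Z}^d$, all starting from $0$. Put $$D_K^{\mathbb{R}^d}(t)=\max_{i\neq j,\ i,j\leq K}\|{\bf W}_i(t)-{\bf W}_j(t)\|,\qquad D_K^{\mathbb{Z}^d}(n)=\max_{i\neq j,\ i,j\leq K}\|{\bf S}_i(n)-{\bf S}_j(n)\|.$$ Then $$\sqrt{t}\,a(t)\in \mathrm{LLC}(D_K^{\mathbb{R}^d}(t))\quad\text{if and only if}\quad \sum_{n=1}^\infty (a(2^n))^{Kd-d-2}<\infty,$$ and $$\sqrt{n}\,a(n)\in \mathrm{LLC}(D_K^{\mathbb{Z}^d}(n))\quad\text{if and only if}\quad \sum_{n=1}^\infty (a(2^n))^{Kd-d-2}<\infty.$$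
   Context: $\|\cdot\|$ denotes the Euclidean norm in $d$ dimensions. A standard $d$-dimensional Wiener process is ${\bf W}(t)=(W_1(t),\dots,W_d(t))$ with $W_1,\dots,W_d$ independent standard one-dimensional Wiener processes. The simple symmetric random walk on $\mathbb{Z}^d$ is ${\bf S}(n)={\bf X}(1)+\dots+{\bf X}(n)$, ${\bf S}(0)=0$, where the ${\bf X}(k)$ are i.i.d. with $P({\bf X}(1)=e_i)=P({\bf X}(1)=-e_i)=\frac1{2d}$, $i=1,\dots,d$, and $e_1,\dots,e_d$ are the orthogonal unit vectors of $\mathbb{Z}^d$. LLC (lower-lower class): a function $g(t)$ belongs to $\mathrm{LLC}(Y(t))$ of a random process $\{Y(t),\,t\geq 0\}$ if for almost all $\omega$ there exists $t_0=t_0(\omega)$ such that $Y(t)>g(t)$ for all $t>t_0$; for processes indexed by integers $n$ the definition is the same with $n$ in place of $t$. *)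

(* Defs.v *)
From mathcomp Require Import all_boot all_order all_algebra.
From mathcomp Require Import all_classical all_reals all_analysis.

Set Implicit Arguments.
Unset Strict Implicit.
Unset Printing Implicit Defensive.

Import Order.TTheory GRing.Theory Num.Theory.
Import numFieldNormedType.Exports.

Local Open Scope classical_set_scope.
Local Open Scope ring_scope.

(* The library norm `|x| on row vectors is the sup norm, hence this one. *)
Definition enorm (R : realType) (d : nat) (x : 'rV[R]_d) : R :=
  Num.sqrt (\sum_(j < d) x ord0 j ^+ 2).

(* All terms are nonnegative, so the default value 0 only matters when K < 2. *)
Definition max_dist (R : realType) (d K : nat) (x : 'I_K -> 'rV[R]_d) : R :=
  \big[Num.max/0]_(p : 'I_K * 'I_K | p.1 != p.2) enorm (x p.1 - x p.2).

(* Mutual independence of a possibly infinite family of classes of events: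
   the product rule over every finite subfamily. *)
Definition mutually_independent (disp : measure_display)
    (T : measurableType disp) (R : realType) (P : probability T R)
    (I : eqType) (F : I -> set (set T)) : Prop :=
  forall (J : seq I) (A : I -> set T), uniq J ->
    (forall i, i \in J -> F i (A i)) ->
    P (\bigcap_(i in [set` J]) A i) = (\prod_(i <- J) P (A i))%E.

(* The sigma-algebra generated by (X t), t in D, where G is the
   sigma-algebra on the state space. *)
Definition process_sigma (T U I : Type) (D : set I) (G : set (set U))
    (X : I -> T -> U) : set (set T) :=
  <<s \bigcup_(t in D) preimage_set_system setT (X t) G >>.

Section processes.
Context (disp : measure_display) (T : measurableType disp) (R : realType).
Variable P : probability T R.

(* Processes in continuous time are indexed by R, but constrained only at
   nonnegative times. The second parameter of normal_prob is the standard
   deviation. *)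
Definition wiener (W : R -> T -> R) : Prop :=
  [/\ forall t, 0 <= t -> measurable_fun setT (W t),
      {ae P, forall w, W 0 w = 0},
      forall (n : nat) (t : nat -> R), 0 <= t 0%N ->
        {homo t : i j / (i <= j)%N >-> i <= j} ->
        mutually_independent P (fun k : 'I_n =>
          preimage_set_system setT (W (t k.+1) \- W (t k)) measurable),
      forall s t, 0 <= s -> s < t -> forall B : set R, measurable B ->
        P ((W t \- W s) @^-1` B) = normal_prob 0 (Num.sqrt (t - s)) B
    & {ae P, forall w, {within `[0, +oo[, continuous (fun t => W t w)}}].

Definition wiener_vec (d : nat) (W : R -> T -> 'rV[R]_d) : Prop :=
  (forall j : 'I_d, wiener (fun t w => W t w ord0 j)) /\
  mutually_independent P (fun j : 'I_d =>
    process_sigma [set t : R | 0 <= t] measurable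
      (fun t w => W t w ord0 j)).

(* The sigma-algebra of each W i is generated by its coordinates. *)
Definition independent_wiener_vecs (K d : nat)
    (W : 'I_K -> R -> T -> 'rV[R]_d) : Prop :=
  (forall i, wiener_vec (W i)) /\
  mutually_independent P (fun i : 'I_K =>
    process_sigma [set tj : R * 'I_d | 0 <= tj.1] measurable
      (fun tj w => W i tj.1 w ord0 tj.2)).

(* Z^d carries the discrete sigma-algebra [set: set 'rV[int]_d]; the step
   X(k) of the usual numbering, k >= 1, is here X k.-1. *)
Definition simple_random_walk (d : nat) (S : nat -> T -> 'rV[int]_d) : Prop :=
  exists X : nat -> T -> 'rV[int]_d,
  [/\ forall k (B : set 'rV[int]_d), measurable (X k @^-1` B),
      mutually_independent P (fun k : nat =>
        preimage_set_system setT (X k) setT),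
      forall k (i : 'I_d),
        P (X k @^-1` [set delta_mx ord0 i]) = ((2 * d%:R)^-1)%:E /\
        P (X k @^-1` [set - delta_mx ord0 i]) = ((2 * d%:R)^-1)%:E
    & forall n w, S n w = \sum_(k < n) X k w].

Definition independent_random_walks (K d : nat)
    (S : 'I_K -> nat -> T -> 'rV[int]_d) : Prop :=
  (forall i, simple_random_walk (S i)) /\
  mutually_independent P (fun i : 'I_K =>
    process_sigma [set: nat] setT (S i)).

Definition LLC (odisp : Order.disp_t) (I : porderType odisp)
    (Y : I -> T -> R) (g : I -> R) : Prop :=
  {ae P, forall w, exists t0 : I, forall t : I, (t0 < t)%O -> g t < Y t w}.

End processes.

Definition D_wiener (T : Type) (R : realType) (K d : nat)
    (W : 'I_K -> R -> T -> 'rV[R]_d) (t : R) (w : T) : R :=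
  max_dist (fun i => W i t w).

Definition D_walk (T : Type) (R : realType) (K d : nat)
    (S : 'I_K -> nat -> T -> 'rV[int]_d) (n : nat) (w : T) : R :=
  max_dist (fun i => map_mx (intr : int -> R) (S i n w)).

(* Main.v *)
Require Import Defs.
From mathcomp Require Import all_boot all_order all_algebra.
From mathcomp Require Import all_classical all_reals all_analysis.
From mathcomp Require Import measurable_realfun.
From mathcomp Require Import zify ring lra.
Import Order.TTheory GRing.Theory Num.Theory.
Import numFieldNormedType.Exports.
Local Open Scope classical_set_scope.
Local Open Scope ring_scope.

(* Up to a common translation the walkers form a walk in dimension
   m = (K - 1) d >= 3, so the result is a Dvoretzky-Erdos test. The random
   walks, and the Wiener processes sampled with any mesh (rescaled to unit
   steps), have independent increments and a displacement over n steps lies in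
   a given box of side rho >= 1 with probability at most C (rho / sqrt n)^d.
   Conditioning on one walker, P(all within rho at time n) is of order
   (rho / sqrt n)^m; the lower bound is a power mean over the cells of side rho.
   Upper bound: walkers within rho of each other stay within 3 rho during about
   rho^2 steps with probability 1/2, so comparing with the expected occupation
   time, P(within rho at some time in [n, 2n]) <= C (rho / sqrt n)^(m - 2), and
   Borel-Cantelli over dyadic blocks applies. Lower bound: if the series
   diverges, the second moment method for the occupation time weighted by
   rho^-2 bounds from below the probability of clustered encounters after any given
   time; so they occur infinitely often with positive probability, which already
   contradicts LLC, and no zero-one law is needed. *)

Set Implicit Arguments.
Unset Strict Implicit.
Unset Printing Implicit Defensive.

(** * Independence *)

(** From [walk_system] on there are [K.+1] walkers, so that m = K d, and both processes are handled
    through that record. Its box bound is available for rho >= 1, that is, at scales of at least one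
    step, and this threshold shapes the integral test. In the Borel-Cantelli half a radius below it
    is raised to 1 ([gauge]); in the second moment half such a block is dropped
    ([series_large_radius]). Either change costs at most a convergent series in powers of 2^(-n/2).
    The hypothesis on the number of walkers is exactly m >= 3, the dimension from which the expected
    time spent within rho after a given time is O(rho^2) ([sum_green_le]); this is why rho^-2 is the
    right weight in the second moment. In continuous time integer instants suffice to produce
    encounters, while their absence at all times is obtained from the meshes 2^-L and the continuity
    of paths, with one spare factor 2 in the radius. *)

Lemma bigcap_setI_seq (T : Type) (J : eqType) (s : seq J) (A : J -> set T) b :
  \bigcap_(i in [set` b :: s]) A i = A b `&` \bigcap_(i in [set` s]) A i.
Proof.
apply/seteqP; split=> w.
  move=> h; split; first by apply: h; rewrite /= inE eqxx.
  by move=> i /= si; apply: h; rewrite /= inE si orbT.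
by move=> [wb h] i /=; rewrite inE => /predU1P[->//|]; exact: h.
Qed.

Lemma bigcap_seq_measurable d (U : measurableType d) (J : eqType) (s : seq J)
    (A : J -> set U) :
  (forall i, i \in s -> measurable (A i)) ->
  measurable (\bigcap_(i in [set` s]) A i).
Proof.
elim: s => [|b s IH] h.
  by rewrite (_ : [set` [::]] = set0) ?bigcap_set0//; apply/seteqP; split.
rewrite bigcap_setI_seq; apply: measurableI; first exact/h/mem_head.
by apply: IH => i si; apply: h; rewrite inE si orbT.
Qed.

Section independence.
Context (disp : measure_display) (T : measurableType disp) (R : realType).
Variable P : probability T R.
Local Open Scope ereal_scope.

(** Dynkin's pi-lambda argument: the measurable sets satisfying the product rule with the fixed
    event [Q] form a lambda-system. *)
Lemma independent_gen_sigma (G : set (set T)) (Q : set T) :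
  setI_closed G -> G `<=` measurable -> measurable Q ->
  (forall X, G X -> P (X `&` Q) = P X * P Q) ->
  forall X, <<s G >> X -> P (X `&` Q) = P X * P Q.
Proof.
move=> GI Gm mQ GQ.
suff : <<s G >> `<=` [set X | measurable X /\ P (X `&` Q) = P X * P Q].
  by move=> h X /h[].
apply: lambda_system_subset => //; last 1 first.
  by move=> X GX; split; [exact: Gm|exact: GQ].
apply/dynkin_lambda_system; split.
- by split => //; rewrite setTI probability_setT mul1e.
- move=> X [mX XQ]; split; first exact: measurableC.
  have mXQ : measurable (X `&` Q) by exact: measurableI.
  rewrite setIC -setDE measureD ?ltey_eq ?fin_num_measure//.
  rewrite setIC probability_setC// muleBl ?fin_num_measure//.
    by rewrite mul1e; congr (_ - _).
- move=> F tF HF.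
  have mF n : measurable (F n) by have [] := HF n.
  split; first exact: bigcup_measurable.
  rewrite setI_bigcupl !measure_bigcup//; last 2 first.
    by move=> i _; exact: measurableI.
    by apply: trivIset_setIr.
  rewrite muleC -(fineK (fin_num_measure P _ mQ)) -nneseriesZl//.
  apply: eq_eseriesr => i _.
  have [_ /= ->] := HF i.
  by rewrite fineK ?fin_num_measure// muleC.
Qed.

Section group.
Variables (I L : eqType) (lab : I -> L) (G : I -> set (set T)).
Hypothesis sG : forall i, sigma_algebra setT (G i).
Hypothesis mG : forall i, G i `<=` measurable.

(** Finite intersections of events whose label is [b]: a pi-system that generates the sigma-algebra
    of the whole group. *)
Let pi_sys (b : L) : set (set T) := [set A | exists s (B : I -> set T),
  [/\ uniq s, forall i, i \in s -> lab i = b /\ G i (B i)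
    & A = \bigcap_(i in [set` s]) B i]].

Let GT i : G i setT.
Proof. by have [G0 GC _] := sG i; rewrite -(setD0 setT); exact: GC. Qed.

Let GI i : setI_closed (G i).
Proof.
have [G0 GC GU] := sG i => A B GA GB.
rewrite -(setCK (A `&` B)) setCI -setTD; apply: (GC).
by rewrite -bigcup2E; apply: GU => -[|[|n]] //=; rewrite -setTD; exact: GC.
Qed.

Let pi_setI b : setI_closed (pi_sys b).
Proof.
move=> _ _ [s1 [B1 [u1 h1 ->]]] [s2 [B2 [u2 h2 ->]]].
exists (undup (s1 ++ s2)), (fun i => (if i \in s1 then B1 i else setT) `&`
  (if i \in s2 then B2 i else setT)); split; first exact: undup_uniq.
  move=> i; rewrite mem_undup mem_cat => si; split.
    by case/orP: si => [/h1[]|/h2[]].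
  apply: GI.
    by case: ifPn => [/h1[_]//|_]; exact: GT.
  by case: ifPn => [/h2[_]//|_]; exact: GT.
apply/seteqP; split=> w.
  move=> [w1 w2] i /=; rewrite mem_undup mem_cat => si; split.
    by case: ifPn => // i1; exact: w1.
  by case: ifPn => // i1; exact: w2.
move=> h; split=> i /= si; have /= := h i; rewrite mem_undup mem_cat si ?orbT.
  by move=> /(_ isT)[].
by move=> /(_ isT)[].
Qed.

Let pi_meas b : pi_sys b `<=` measurable.
Proof.
move=> _ [s [B [us hs ->]]]; apply: bigcap_seq_measurable => i /hs[_].
exact: mG.
Qed.

Let sub_pi b : <<s \bigcup_(i in [set i | lab i = b]) G i >> `<=` <<s pi_sys b>>.
Proof.
apply: sub_smallest2r; last first.
  move=> A [i /= ib GA].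
  exists [:: i], (fun=> A); split => //; first by move=> j; rewrite inE => /eqP ->.
  by apply/seteqP; split => w; [move=> ? ? | apply; rewrite /= inE].
exact: smallest_sigma_algebra.
Qed.

Let sigma_meas b : <<s \bigcup_(i in [set i | lab i = b]) G i >> `<=` measurable.
Proof.
apply: smallest_sub; first exact: sigma_algebra_measurable.
by move=> A [i _]; exact: mG.
Qed.

(** For finite intersections the product rule is inherited from [G], since distinct labels involve
    disjoint sets of indices; the pi-systems are then replaced by the sigma-algebras they generate,
    one label at a time. *)
Lemma independent_group : mutually_independent P G ->
  mutually_independent P
    (fun b => <<s \bigcup_(i in [set i | lab i = b]) G i >>).
Proof.
move=> indG.
(* The labels in [J1] already carry events of the full sigma-algebra, those in [J2] still carry
   events of the pi-system; the induction is on [J1]. *)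
suff H J1 : forall J2 A, uniq (J1 ++ J2) ->
    (forall b, b \in J1 -> <<s \bigcup_(i in [set i | lab i = b]) G i >> (A b)) ->
    (forall b, b \in J2 -> pi_sys b (A b)) ->
    P (\bigcap_(i in [set` J1 ++ J2]) A i) = \prod_(i <- J1 ++ J2) P (A i).
  by move=> J A uJ hJ; have := H J [::] A; rewrite cats0 => h; exact: h.
elim: J1 => [|b J1 IH] J2 A /=.
  move=> uJ _ hJ.
  have /choice[s] : forall b, exists s : seq I, b \in J2 -> exists B,
    [/\ uniq s, forall i, i \in s -> lab i = b /\ G i (B i)
    & A b = \bigcap_(i in [set` s]) B i].
    by move=> b; have [/hJ[s sP]|] := boolP (b \in J2); [exists s|exists [::]].
  move=> hs.
  have /choice[B hB] : forall b, exists B : I -> set T, b \in J2 ->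
    [/\ uniq (s b), forall i, i \in s b -> lab i = b /\ G i (B i)
    & A b = \bigcap_(i in [set` s b]) B i].
    by move=> b; have [/hs[B sP]|] := boolP (b \in J2); [exists B|exists (fun=> setT)].
  have key J : uniq J -> {subset J <= J2} ->
      uniq (flatten (map s J)) /\ forall i, i \in flatten (map s J) -> lab i \in J.
    elim: J => //= b J IHJ /andP[bJ uJJ] sJ.
    have [||u1 l1] := IHJ => //.
      by move=> x xJ; apply: sJ; rewrite inE xJ orbT.
    have [u2 l2 _] := hB b (sJ _ (mem_head _ _)).
    split.
      rewrite cat_uniq u1 u2 /= andbT; apply/hasPn => x /l1 lx.
      by apply/negP => /l2[lb _]; rewrite lb (negbTE bJ) in lx.
    by move=> i; rewrite mem_cat inE => /orP[/l2[->]|/l1->]; rewrite ?eqxx ?orbT.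
  have [uf lf] := key J2 uJ (fun _ => id).
  transitivity (P (\bigcap_(i in [set` flatten (map s J2)]) B (lab i) i)).
    congr (P _); apply/seteqP; split => w h.
      move=> i /= /flatten_mapP[b bJ2 ib].
      have [_ l2 Ab] := hB b bJ2; have [-> _] := l2 _ ib.
      by have := h b bJ2; rewrite Ab; apply.
    move=> b /= bJ2; have [_ l2 ->] := hB b bJ2 => i /= ib.
    have [lb _] := l2 _ ib; rewrite -lb; apply: h.
    by apply/flatten_mapP; exists b.
  rewrite indG//; last first.
    move=> i /flatten_mapP[b bJ2 ib].
    by have [_ l2 Ab] := hB b bJ2; have [->] := l2 _ ib.
  rewrite big_flatten /= big_map; apply: eq_big_seq => b bJ2.
  have [u2 l2 ->] := hB b bJ2; rewrite indG//; last by move=> i /l2[].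
  by apply: eq_big_seq => i /l2[->].
move=> /andP[bJ uJ] h1 h2.
have mJ c : c \in J1 ++ J2 -> measurable (A c).
  rewrite mem_cat => /orP[cJ|cJ]; last exact: pi_meas (h2 _ cJ).
  by apply: (sigma_meas (b:=c)); apply: h1; rewrite inE cJ orbT.
have h1' c : c \in J1 -> <<s \bigcup_(i in [set i | lab i = c]) G i >> (A c).
  by move=> cJ; apply: h1; rewrite inE cJ orbT.
have eQ := IH J2 A uJ h1' h2.
rewrite bigcap_setI_seq big_cons -eQ.
(* The fixed event is the intersection over all other labels; the product rule on the pi-system is
   the induction hypothesis with [b] moved to the second list. *)
apply: (@independent_gen_sigma (pi_sys b)) => //.
- exact: bigcap_seq_measurable.
- move=> X pX; rewrite eQ.
  have := IH (b :: J2) (fun c => if c == b then X else A c).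
  have pJ : perm_eq (J1 ++ b :: J2) (b :: (J1 ++ J2)).
    by rewrite -cat1s perm_catCA.
  have nb c : c \in J1 ++ J2 -> (c == b) = false.
    by move=> cJ; apply/negbTE/eqP => cb; rewrite -cb cJ in bJ.
  rewrite (perm_uniq pJ) /= bJ uJ => /(_ isT).
  rewrite (_ : [set` J1 ++ b :: J2] = [set` b :: (J1 ++ J2)]); last first.
    by apply/seteqP; split => x /=; rewrite (perm_mem pJ).
  rewrite bigcap_setI_seq eqxx (perm_big _ pJ) /= big_cons eqxx.
  move=> h; rewrite (_ : \bigcap_(i in _) A i =
    \bigcap_(i in [set` J1 ++ J2]) if i == b then X else A i); last first.
    by apply: eq_bigcapr => c /= /nb ->.
  rewrite h; first by congr (_ * _); apply: eq_big_seq => c /nb ->.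
    by move=> c cJ; rewrite nb ?mem_cat ?cJ//; exact: h1'.
  move=> c; rewrite inE => /predU1P[->|cJ]; first by rewrite eqxx.
  by rewrite nb ?mem_cat ?cJ ?orbT//; exact: h2.
- by apply: sub_pi; apply: h1; rewrite mem_head.
Qed.

End group.

(** A converse to grouping: independence between the groups together with independence inside each
    group yields independence of the whole family. The events sharing a label are first intersected
    into one event of [H b]. *)
Lemma independent_ungroup (I L : eqType) (lab : I -> L)
    (G : I -> set (set T)) (H : L -> set (set T)) :
  (forall i, G i `<=` H (lab i)) -> (forall b, H b setT) ->
  (forall b, setI_closed (H b)) ->
  mutually_independent P H ->
  (forall b (J : seq I) A, uniq J ->
    (forall i, i \in J -> lab i = b /\ G i (A i)) ->
    P (\bigcap_(i in [set` J]) A i) = \prod_(i <- J) P (A i)) ->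
  mutually_independent P G.
Proof.
move=> GH HT HI indH indG J A uJ hJ.
pose J' := undup (map lab J).
pose s b := [seq i <- J | lab i == b].
have H' b : H b (\bigcap_(i in [set` s b]) A i).
  have : {subset s b <= J} by move=> i; rewrite mem_filter => /andP[].
  have : forall i, i \in s b -> lab i = b.
    by move=> i; rewrite mem_filter => /andP[/eqP].
  elim: (s b) => [_ _|i t IH lt st].
    by rewrite (_ : [set` [::]] = set0) ?bigcap_set0//; apply/seteqP; split.
  rewrite bigcap_setI_seq; apply: HI.
    by rewrite -(lt i) ?mem_head//; apply/GH/hJ/st/mem_head.
  by apply: IH => j jt; [apply: lt|apply: st]; rewrite inE jt orbT.
transitivity (P (\bigcap_(b in [set` J']) \bigcap_(i in [set` s b]) A i)).
  congr (P _); apply/seteqP; split => w h.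
    by move=> b _ i /=; rewrite mem_filter => /andP[_]; exact: h.
  move=> i /= iJ; apply: (h (lab i)) => /=.
    by rewrite mem_undup; apply: map_f.
  by rewrite mem_filter eqxx.
rewrite indH ?undup_uniq//.
transitivity (\prod_(b <- J') \prod_(i <- J | lab i == b) P (A i)).
  apply: eq_bigr => b _; rewrite (indG b) ?filter_uniq//; first by rewrite big_filter.
  by move=> i; rewrite mem_filter => /andP[/eqP -> /hJ].
rewrite (exchange_big_dep xpredT)//=; apply: eq_big_seq => i iJ.
under eq_bigl do rewrite eq_sym.
by rewrite -big_filter filter_pred1_uniq ?undup_uniq ?big_seq1// mem_undup map_f.
Qed.

End independence.

(** * Real-valued probabilities, countable conditioning and the second moment inequality *)

Section real_valued_probability.
Context (disp : measure_display) (T : measurableType disp) (R : realType).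
Variable P : probability T R.

Definition pr (A : set T) : R := fine (P A).

Lemma prE A : measurable A -> P A = (pr A)%:E.
Proof. by move=> mA; rewrite fineK// fin_num_measure. Qed.

Lemma pr_ge0 A : 0 <= pr A.
Proof. exact: fine_ge0. Qed.

Lemma pr_mono A B : measurable A -> measurable B -> A `<=` B -> pr A <= pr B.
Proof. by move=> mA mB AB; rewrite -lee_fin -!prE// le_measure// inE. Qed.

Lemma pr_setT : pr setT = 1.
Proof. by rewrite /pr probability_setT. Qed.

Lemma pr_set0 : pr set0 = 0.
Proof. by rewrite /pr measure0. Qed.

Lemma pr_le1 A : measurable A -> pr A <= 1.
Proof. by move=> mA; rewrite -pr_setT; apply: pr_mono. Qed.

Lemma pr_setC A : measurable A -> pr (~` A) = 1 - pr A.
Proof. by move=> mA; rewrite /pr probability_setC// prE. Qed.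

Lemma prU A B : measurable A -> measurable B -> A `&` B = set0 ->
  pr (A `|` B) = pr A + pr B.
Proof. by move=> mA mB AB; rewrite /pr measureU// fineD ?fin_num_measure. Qed.

Lemma pr_setID A B : measurable A -> measurable B ->
  pr A = pr (A `&` B) + pr (A `\` B).
Proof.
move=> mA mB; rewrite -[in LHS](setUIDK A B); apply: prU.
- exact: measurableI.
- exact: measurableD.
- by apply/seteqP; split => // w [[_ wB] [_ /(_ wB)]].
Qed.

Lemma prU_le A B : measurable A -> measurable B ->
  pr (A `|` B) <= pr A + pr B.
Proof.
move=> mA mB; rewrite -lee_fin EFinD -!prE//; last exact: measurableU.
exact: measureU2.
Qed.

Lemma pr_prod (I : Type) (r : seq I) (A : I -> set T) :
  (forall i, measurable (A i)) ->
  (\prod_(i <- r) P (A i))%E = (\prod_(i <- r) pr (A i))%:E.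
Proof.
move=> mA; elim: r => [|i r IH]; first by rewrite !big_nil.
by rewrite !big_cons EFinM IH prE.
Qed.

Lemma bigcup_seq_cons (U : Type) (I : eqType) (r : seq I) (A : I -> set U) i :
  \bigcup_(j in [set` i :: r]) A j = A i `|` \bigcup_(j in [set` r]) A j.
Proof.
apply/seteqP; split => w.
  by move=> [j /=]; rewrite inE => /predU1P[->|jr] Aj; [left|right; exists j].
move=> [Ai|[j jr Aj]]; [exists i|exists j] => //=; first exact: mem_head.
by rewrite inE (jr : j \in r) orbT.
Qed.

Lemma bigcup_seq_measurable (I : eqType) (r : seq I) (A : I -> set T) :
  (forall i, measurable (A i)) -> measurable (\bigcup_(i in [set` r]) A i).
Proof.
move=> mA; elim: r => [|i r IH]; last by rewrite bigcup_seq_cons; exact: measurableU.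
by rewrite (_ : [set` [::]] = set0) ?bigcup_set0//; apply/seteqP; split.
Qed.

Lemma pr_sum_disjoint (I : eqType) (r : seq I) (A : I -> set T) :
  uniq r -> (forall i, measurable (A i)) ->
  (forall i j, i != j -> A i `&` A j = set0) ->
  \sum_(i <- r) pr (A i) = pr (\bigcup_(i in [set` r]) A i).
Proof.
move=> ur mA dA; elim: r ur => [_|i r IH /= /andP[ir ur]].
  rewrite big_nil (_ : [set` [::]] = set0) ?bigcup_set0 ?pr_set0//.
  by apply/seteqP; split.
rewrite big_cons IH// bigcup_seq_cons prU//; first exact: bigcup_seq_measurable.
rewrite setI_bigcupr; apply/seteqP; split => // w [j jr].
rewrite dA//; apply/eqP => ij; move: ir.
by rewrite ij (jr : j \in r).
Qed.

Lemma pr_bigcup_le (I : eqType) (r : seq I) (A : I -> set T) :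
  (forall i, measurable (A i)) ->
  pr (\bigcup_(i in [set` r]) A i) <= \sum_(i <- r) pr (A i).
Proof.
move=> mA; elim: r => [|i r IH].
  rewrite big_nil (_ : [set` [::]] = set0) ?bigcup_set0 ?pr_set0//.
  by apply/seteqP; split.
rewrite big_cons bigcup_seq_cons (le_trans (prU_le _ _))//.
  exact: bigcup_seq_measurable.
by rewrite lerD2l.
Qed.

Lemma measurable_all (I : countType) (Q : I -> T -> Prop) :
  (forall i, measurable [set w | Q i w]) -> measurable [set w | forall i, Q i w].
Proof.
move=> mQ; rewrite (_ : mkset _ = ~` \bigcup_i ~` [set w | Q i w]).
  apply: measurableC; apply: countable_bigcupT_measurable => // i.
  exact: measurableC.
rewrite setC_bigcup; under eq_bigcapr do rewrite setCK.
by apply/seteqP; split => w h i; [move=> _; exact: h|exact: h].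
Qed.

Lemma measurable_ex (I : countType) (Q : I -> T -> Prop) :
  (forall i, measurable [set w | Q i w]) -> measurable [set w | exists i, Q i w].
Proof.
move=> mQ; rewrite (_ : mkset _ = \bigcup_i [set w | Q i w]).
  exact: countable_bigcupT_measurable.
by apply/seteqP; split => w [i]; exists i.
Qed.

Lemma measurable_andl (b : Prop) (Q : T -> Prop) :
  measurable [set w | Q w] -> measurable [set w | b /\ Q w].
Proof.
move=> mQ; have [hb|hb] := pselect b.
  rewrite (_ : mkset _ = [set w | Q w])//; apply/seteqP.
  by split => w; [case|split].
by rewrite (_ : mkset _ = set0)//; apply/seteqP; split => w [].
Qed.

(** This replaces conditional expectation: conditioning on a variable [h] with countably many values
    amounts to proving the bound on each of its level sets. *)
Lemma pr_le_countable_partition (Q : countType) (h : T -> Q) (A B : set T) (C : R) :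
  measurable A -> measurable B -> (forall q, measurable (h @^-1` [set q])) ->
  (forall q, pr (A `&` h @^-1` [set q]) <= C * pr (B `&` h @^-1` [set q])) ->
  pr A <= C * pr B.
Proof.
move=> mA mB mh hAB.
(* The level sets are numbered by [pickle], to sum over natural numbers; a number that codes no
   value gives the empty set. *)
pose D n := [set w | pickle (h w) = n].
have DP n : (exists q, D n = h @^-1` [set q]) \/ D n = set0.
  have [q|nq] := pselect (exists q : Q, pickle q = n).
    case: q => q qn; left; exists q; apply/seteqP; split => w; rewrite /D /=.
      by rewrite -qn => /(pcan_inj pickleK).
    by move=> ->.
  by right; apply/seteqP; split => // w wn; apply: nq; exists (h w).
have mD n : measurable (D n) by have [[q ->]//|->] := DP n.
have dec A' : measurable A' -> P A' = (\sum_(n <oo) P (A' `&` D n))%E.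
  move=> mA'; rewrite -measure_semi_bigcup//;
    last by apply: bigcup_measurable => n _; exact: measurableI.
  - congr (P _); apply/seteqP; split => w; first by move=> wA; exists (pickle (h w)).
    by move=> [n _ []].
  - by move=> n; exact: measurableI.
  - by move=> i j _ _ [w [[_ <-] [_ <-]]].
rewrite -lee_fin EFinM -!prE// !dec// -nneseriesZl//.
apply: lee_nneseries => // n _.
have [[q ->]|->] := DP n; last by rewrite !setI0 !measure0 mule0.
by rewrite !prE ?lee_fin//; exact: measurableI.
Qed.

Lemma integral_indic_sum (I : Type) (r : seq I) (c : I -> R) (A : I -> set T) :
  (forall i, 0 <= c i) -> (forall i, measurable (A i)) ->
  (\int[P]_x (\sum_(i <- r) c i * \1_(A i) x)%:E)%E = (\sum_(i <- r) c i * pr (A i))%:E.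
Proof.
move=> c0 mA.
under eq_integral do rewrite -sumEFin.
rewrite ge0_integral_sum//=; last 2 first.
  by move=> i; apply/measurable_EFinP; apply: measurable_funM.
  by move=> i x _; rewrite lee_fin mulr_ge0.
rewrite -sumEFin; apply: eq_bigr => i _.
under eq_integral do rewrite EFinM.
rewrite ge0_integralZl//=.
- by rewrite integral_indic// setIT EFinM -prE.
- by apply/measurable_EFinP.
- exact: c0.
Qed.

(** A pointwise inequality between weighted sums of indicators is integrated term by term. *)
Lemma pr_linear_le (I J : Type) (r : seq I) (s : seq J) (c : I -> R) (e : J -> R)
    (A : I -> set T) (B : J -> set T) :
  (forall i, 0 <= c i) -> (forall i, 0 <= e i) ->
  (forall i, measurable (A i)) -> (forall i, measurable (B i)) ->
  (forall x, \sum_(i <- r) c i * \1_(A i) x <= \sum_(j <- s) e j * \1_(B j) x) ->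
  \sum_(i <- r) c i * pr (A i) <= \sum_(j <- s) e j * pr (B j).
Proof.
move=> c0 e0 mA mB h; rewrite -lee_fin -!integral_indic_sum//.
have ms (K : Type) (t : seq K) (b : K -> R) (D : K -> set T) :
    (forall i, measurable (D i)) ->
    measurable_fun setT (fun x => (\sum_(i <- t) b i * \1_(D i) x)%:E).
  move=> mD; apply/measurable_EFinP; apply: measurable_sum => i.
  exact: measurable_funM.
by apply: ge0_le_integral => //=; (try exact: ms);
  move=> x _; rewrite lee_fin ?h// sumr_ge0// => i _; rewrite mulr_ge0.
Qed.

(* Cauchy-Schwarz for the weighted number X of events that occur: X
   vanishes outside their union. *)
Lemma second_moment (I : eqType) (r : seq I) (c : I -> R) (A : I -> set T) :
  (forall i, 0 <= c i) -> (forall i, measurable (A i)) ->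
  (\sum_(i <- r) c i * pr (A i)) ^+ 2 <=
  pr (\bigcup_(i in [set` r]) A i) *
  \sum_(i <- r) \sum_(j <- r) c i * c j * pr (A i `&` A j).
Proof.
move=> c0 mA; set s := \sum_(i <- r) c i * pr (A i); set U := \bigcup_(_ in _) _.
set S := \sum_(i <- r) \sum_(j <- r) _.
have mU : measurable U by exact: bigcup_seq_measurable.
have s0 : 0 <= s by apply: sumr_ge0 => i _; rewrite mulr_ge0 ?pr_ge0.
have S0 : 0 <= S.
  by apply: sumr_ge0 => i _; apply: sumr_ge0 => j _; rewrite !mulr_ge0 ?pr_ge0.
(* Integral of 2 t X <= X^2 + t^2 1_U. On U this is (X - t)^2 >= 0; off U both sides vanish. The
   index [None] below carries the term t^2 1_U. *)
have key t : 0 <= t -> 2 * t * s <= S + t ^+ 2 * pr U.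
  move=> t0.
  have -> : 2 * t * s = \sum_(i <- r) (2 * t * c i) * pr (A i).
    by rewrite mulr_sumr; apply: eq_bigr => i _; ring.
  have -> : S + t ^+ 2 * pr U = \sum_(o <- None :: map Some [seq (i, j) | i <- r, j <- r])
      (if o is Some p then c p.1 * c p.2 else t ^+ 2) *
      pr (if o is Some p then A p.1 `&` A p.2 else U).
    by rewrite big_cons big_map big_allpairs /= addrC.
  apply: pr_linear_le.
  - by move=> i; rewrite !mulr_ge0.
  - by move=> [[i j]|] /=; rewrite ?exprn_ge0 ?mulr_ge0.
  - by [].
  - by move=> [[i j]|]//; exact: measurableI.
  move=> x; rewrite big_cons big_map big_allpairs /=.
  set X := \sum_(i <- r) c i * \1_(A i) x.
  have -> : \sum_(i <- r) 2 * t * c i * \1_(A i) x = 2 * t * X.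
    by rewrite mulr_sumr; apply: eq_bigr => i _; ring.
  have -> : \sum_(i <- r) \sum_(j <- r) c i * c j * \1_(A i `&` A j) x = X ^+ 2.
    rewrite expr2 mulr_suml; apply: eq_bigr => i _.
    by rewrite mulr_sumr; apply: eq_bigr => j _; rewrite indicI /=; ring.
  have [xU|xU] := pselect (U x).
    rewrite indicE mem_set// mulr1 -subr_ge0.
    by rewrite (_ : _ - _ = (X - t) ^+ 2) ?sqr_ge0//; ring.
  rewrite indicE memNset// mulr0 add0r (_ : X = 0) ?mulr0 ?expr0n//.
  rewrite /X big_seq big1// => i ir; rewrite indicE memNset ?mulr0// => xA.
  by apply: xU; exists i.
have [U0|U0] := eqVneq (pr U) 0.
  suff -> : s = 0 by rewrite expr0n mulr_ge0 ?pr_ge0.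
  rewrite /s big_seq big1// => i ir.
  suff -> : pr (A i) = 0 by rewrite mulr0.
  by apply/eqP; rewrite eq_le pr_ge0 andbT -U0 pr_mono// => w wA; exists i.
have Up : 0 < pr U by rewrite lt_neqAle eq_sym U0 pr_ge0.
(* This value of t optimizes the quadratic inequality. *)
have := key (s / pr U) (divr_ge0 s0 (ltW Up)).
rewrite -(ler_pM2r Up) (_ : 2 * (s / pr U) * s * pr U = 2 * s ^+ 2); last by field.
rewrite (_ : (S + _) * _ = pr U * S + s ^+ 2); last by field.
by move=> ?; lra.
Qed.

End real_valued_probability.

(** * Measurability of level sets and of cells *)

Section level_sets.
Context (disp : measure_display) (T : measurableType disp) (R : realType).
Implicit Types f : T -> R.

Lemma measurable_le_const f x :
  measurable_fun setT f -> measurable [set w | f w <= x].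
Proof.
move=> mf; rewrite -[X in measurable X]setTI.
rewrite (_ : mkset _ = f @^-1` `]-oo, x]); first by apply: mf.
by apply/seteqP; split => w; rewrite /= in_itv.
Qed.

Lemma measurable_gt_const f x :
  measurable_fun setT f -> measurable [set w | x < f w].
Proof.
move=> mf; rewrite -[X in measurable X]setTI.
rewrite (_ : mkset _ = f @^-1` `]x, +oo[); first by apply: mf.
by apply/seteqP; split => w; rewrite /= in_itv /= andbT.
Qed.

Lemma measurable_floor_eq f (z : int) :
  measurable_fun setT f -> measurable [set w | Num.floor (f w) = z].
Proof.
move=> mf; rewrite -[X in measurable X]setTI.
rewrite (_ : mkset _ = f @^-1` `[z%:~R, (z + 1)%:~R[); first by apply: mf.
apply/seteqP; split => w; rewrite /= in_itv /=.
  by move=> <-; rewrite Num.Theory.floor_itv.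
by move=> h; apply: Num.Theory.floor_def.
Qed.

End level_sets.

(** Jensen's inequality by tangents: x^(n+1) lies above its tangent at the mean y, and the linear
    terms sum to zero. *)
Lemma power_mean (R : realFieldType) (I : Type) (r : seq I) (p : I -> R) n :
  (forall i, 0 <= p i) ->
  (\sum_(i <- r) p i) ^+ n.+1 <= (size r)%:R ^+ n * \sum_(i <- r) p i ^+ n.+1.
Proof.
move=> p0; case: r => [|i0 r']; first by rewrite !big_nil expr0n mulr0.
set r := i0 :: r'; set N : R := (size r)%:R.
have N0 : 0 < N by rewrite ltr0n.
set y := (\sum_(i <- r) p i) / N.
have y0 : 0 <= y by apply: divr_ge0; [exact: sumr_ge0|exact: ltW].
have tangent x : 0 <= x -> y ^+ n.+1 + n.+1%:R * y ^+ n * (x - y) <= x ^+ n.+1.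
  move=> x0; elim: n => [|n IH]; first by rewrite !expr1 expr0; lra.
  have : 0 <= n.+1%:R * y ^+ n * (x - y) ^+ 2.
    by apply: mulr_ge0; [apply: mulr_ge0; [exact: ler0n|exact: exprn_ge0]|exact: sqr_ge0].
  rewrite [x ^+ n.+2]exprS; have := ler_wpM2l x0 IH.
  by rewrite ![_ ^+ n.+2]exprS ![_ ^+ n.+1]exprS -[n.+2]addn1 natrD; nra.
have sy : \sum_(i <- r) p i = N * y by rewrite /y mulrCA divff ?mulr1// gt_eqF.
have : \sum_(i <- r) (y ^+ n.+1 + n.+1%:R * y ^+ n * (p i - y)) <=
    \sum_(i <- r) p i ^+ n.+1.
  by apply: ler_sum => i _; exact: tangent.
rewrite big_split /= -mulr_sumr sumrB sy !big_const_seq !count_predT !iter_addr_0.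
rewrite -[y *+ _]mulr_natl -/N subrr mulr0 addr0 -mulr_natl -/N => h.
rewrite exprMn [N ^+ n.+1]exprSr -mulrA ler_wpM2l// exprn_ge0// ltW.
Qed.

(** * Walkers with independent increments *)

Definition travel (R : realType) (T I J : Type) (xi : nat -> I -> J -> T -> R)
    k n (i : I) (c : J) (w : T) : R :=
  \sum_(l < n) xi (k + l)%N i c w.

Section travel.
Context (R : realType) (T I J : Type) (xi : nat -> I -> J -> T -> R).

Lemma travel0 k i c w : travel xi k 0 i c w = 0.
Proof. by rewrite /travel big_ord0. Qed.

Lemma travelD k n m i c w :
  travel xi k (n + m) i c w = travel xi k n i c w + travel xi (k + n) m i c w.
Proof.
rewrite /travel big_split_ord /=; congr (_ + _).
by apply: eq_bigr => l _; rewrite addnA.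
Qed.

End travel.

Lemma size_index_enum (I : finType) : size (index_enum I) = #|I|.
Proof. by rewrite -sum1_size -sum1_card; exact: eq_bigl. Qed.

Lemma expr_regroup (F : fieldType) (x y z t : F) n :
  x ^+ n * (t / y ^+ n * z ^+ n) = t * (x / y * z) ^+ n.
Proof. by rewrite !exprMn exprVn; ring. Qed.

Section system.
Context (disp : measure_display) (T : measurableType disp) (R : realType).
Variable P : probability T R.
Variables (K d : nat).
Local Notation pr := (pr P).

(* The step xi l i c is the c-th coordinate of the l-th increment of walker i,
   and G (l, i) contains the events that depend on this increment only. *)
Record walk_system (C0 lam : R) (xi : nat -> 'I_K.+1 -> 'I_d -> T -> R)
    (G : nat * 'I_K.+1 -> set (set T)) : Prop := WalkSystem {
  ws_sigma : forall x, sigma_algebra setT (G x);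
  ws_measurable : forall x, G x `<=` measurable;
  ws_independent : mutually_independent P G;
  ws_step : forall l i c (B : set R), measurable B -> G (l, i) (xi l i c @^-1` B);
  ws_box : forall k n i (x : 'I_d -> R) (rho : R), (0 < n)%N -> 1 <= rho ->
    pr [set w | forall c, `|travel xi k n i c w - x c| <= rho] <=
    C0 * (rho / Num.sqrt n%:R) ^+ d;
  ws_tail : forall k n i c, (0 < n)%N ->
    pr [set w | lam * Num.sqrt n%:R < `|travel xi k n i c w|] <=
    (2 * (K.+1 * d)%:R)^-1;
  ws_law : forall n i i' (B : 'I_d -> set R), (forall c, measurable (B c)) ->
    pr [set w | forall c, B c (travel xi 0 n i c w)] =
    pr [set w | forall c, B c (travel xi 0 n i' c w)] }.

Variables (C0 lam : R).
Hypothesis lam_ge1 : 1 <= lam.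
Hypothesis d_gt0 : (0 < d)%N.
Variables (xi : nat -> 'I_K.+1 -> 'I_d -> T -> R).
Variables (G : nat * 'I_K.+1 -> set (set T)).
Hypothesis WS : walk_system C0 lam xi G.

Let lam_gt0 : 0 < lam.
Proof. exact: lt_le_trans lam_ge1. Qed.

Local Notation travel := (travel xi).

Definition past k : set (set T) :=
  \bigcup_(x in [set x : nat * 'I_K.+1 | (x.1 < k)%N]) G x.
Definition during k n i : set (set T) :=
  \bigcup_(x in [set x : nat * 'I_K.+1 | (k <= x.1 < k + n)%N /\ x.2 = i]) G x.

Let sub_measurable (H : set (nat * 'I_K.+1)) :
  <<s \bigcup_(x in H) G x >> `<=` measurable.
Proof.
apply: smallest_sub; first exact: sigma_algebra_measurable.
by move=> A [x _]; exact: (ws_measurable WS).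
Qed.

Lemma past_measurable k : <<s past k >> `<=` measurable.
Proof. exact: sub_measurable. Qed.

Lemma during_measurable k n i : <<s during k n i >> `<=` measurable.
Proof. exact: sub_measurable. Qed.

Lemma past_mono k n : (k <= n)%N -> <<s past k >> `<=` <<s past n >>.
Proof.
move=> kn; apply: sub_smallest2r; first exact: smallest_sigma_algebra.
by move=> A [x /= xk GA]; exists x => //=; exact: leq_trans kn.
Qed.

Lemma past_during_independent k n A (B : 'I_K.+1 -> set T) :
  <<s past k >> A -> (forall i, <<s during k n i >> (B i)) ->
  pr (A `&` [set w | forall i, B i w]) = pr A * \prod_i pr (B i).
Proof.
move=> pA dB.
(* The increments are grouped as [None] for the past, [Some (Some i)] for walker i inside the
   window, and [Some None] for all later times. *)
pose lab (x : nat * 'I_K.+1) : option (option 'I_K.+1) :=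
  if (x.1 < k)%N then None else
  if (x.1 < k + n)%N then Some (Some x.2) else Some None.
have ind := @independent_group _ _ _ P _ _ lab _ (ws_sigma WS)
  (@ws_measurable _ _ _ _ WS) (ws_independent WS).
pose J : seq (option (option 'I_K.+1)) :=
  None :: [seq Some (Some i) | i <- enum 'I_K.+1].
pose F (o : option (option 'I_K.+1)) :=
  if o is Some (Some i) then B i else if o is None then A else set0.
have mB i : measurable (B i) by exact: during_measurable (dB i).
have mA : measurable A by exact: past_measurable pA.
have uJ : uniq J.
  rewrite /= map_inj_uniq ?enum_uniq ?andbT; last by move=> i j [].
  by apply/negP => /mapP[].
have hJ b : b \in J ->
    <<s \bigcup_(i in [set i | lab i = b]) G i >> (F b).
  rewrite inE => /predU1P[->|/mapP[i _ ->]] /=.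
    apply: sub_smallest2r pA; first exact: smallest_sigma_algebra.
    by move=> D [x /= xk GD]; exists x => //=; rewrite /lab xk.
  apply: sub_smallest2r (dB i); first exact: smallest_sigma_algebra.
  move=> D [x /= [/andP[kx xn] xi'] GD]; exists x => //=.
  by rewrite /lab ltnNge kx xn xi'.
have := ind J F uJ hJ.
rewrite bigcap_setI_seq big_cons big_map /= -big_enum /=.
rewrite (_ : \bigcap_(i in _) _ = [set w | forall i, B i w]); last first.
  apply/seteqP; split => w h.
    by move=> i; apply: (h (Some (Some i))) => /=;
      apply: (map_f (fun i => Some (Some i))); rewrite mem_enum.
  by move=> _ /= /mapP[i _ ->]; exact: h.
rewrite pr_prod// !prE//; last first.
  by apply: measurableI => //; exact: measurable_all.
by rewrite -EFinM => -[].
Qed.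

Lemma travel_during k n i c B : measurable B ->
  <<s during k n i >> (travel k n i c @^-1` B).
Proof.
move=> mB; rewrite -[X in <<s _ >> X]setTI.
suff : measurable_fun setT
    (travel k n i c : g_sigma_algebraType (during k n i) -> R).
  by move=> /(_ measurableT B mB).
apply: measurable_sum => l _ B' mB'; rewrite setTI.
apply: sub_gen_smallest; exists ((k + l)%N, i); last exact: (ws_step WS).
by split => //=; rewrite leq_addr ltn_add2l ltn_ord.
Qed.

Lemma measurable_travel_past k n m i c : (k + n <= m)%N ->
  measurable_fun setT (travel k n i c : g_sigma_algebraType (past m) -> R).
Proof.
move=> knm; apply: measurable_sum => l _ B' mB'; rewrite setTI.
apply: sub_gen_smallest; exists ((k + l)%N, i); last exact: (ws_step WS).
by rewrite /=; apply: leq_trans knm; rewrite ltn_add2l.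
Qed.

Lemma measurable_travel k n i c : measurable_fun setT (travel k n i c).
Proof.
move=> _ B mB; rewrite setTI; apply: (@during_measurable k n i).
exact: travel_during.
Qed.

(** Closeness is measured coordinate by coordinate, so that it can be expressed by boxes; this
    differs from the Euclidean diameter by a factor at most d. *)
Definition clustered n (rho : R) : set T := [set w | forall i i' c,
  `|travel 0 n i c w - travel 0 n i' c w| <= rho].

Lemma clustered_past n (rho : R) : <<s past n >> (clustered n rho).
Proof.
suff : measurable (clustered n rho : set (g_sigma_algebraType (past n))) by [].
do 3 (apply: measurable_all => ?).
by apply/measurable_le_const/measurableT_comp => //;
  apply: measurable_funB; exact: measurable_travel_past.
Qed.

Lemma clustered_measurable n (rho : R) : measurable (clustered n rho).
Proof. by apply: (@past_measurable n); exact: clustered_past. Qed.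

(* Given the past and the displacement of walker 0, the other K walkers must
   end up in boxes determined by the cells of side rho containing all these
   quantities. *)
Lemma pr_clustered_after k n (rho : R) A :
  <<s past k >> A -> (0 < n)%N -> 1 <= rho ->
  pr (A `&` clustered (k + n) rho) <=
  (C0 * 3 ^+ d) ^+ K * (rho / Num.sqrt n%:R) ^+ (K * d) * pr A.
Proof.
move=> pA n0 rho1; set y := rho / _.
have rho0 : 0 < rho by exact: lt_le_trans rho1.
have mA : measurable A by exact: past_measurable pA.
(* The conditioning variable: the cells of all positions at time k and the cell of the displacement
   of walker 0 during the window. *)
pose h w := ([ffun p : 'I_K.+1 * 'I_d => Num.floor (travel 0 k p.1 p.2 w / rho)],
  [ffun c : 'I_d => Num.floor (travel k n ord0 c w / rho)]).
pose A1 (q : {ffun 'I_K.+1 * 'I_d -> int}) :=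
  [set w | forall p, Num.floor (travel 0 k p.1 p.2 w / rho) = q p].
pose B0 (q : {ffun 'I_d -> int}) :=
  [set w | forall c, Num.floor (travel k n ord0 c w / rho) = q c].
have hE q : h @^-1` [set q] = A1 q.1 `&` B0 q.2.
  apply/seteqP; split => w /=.
    by move=> <-; split => p /=; rewrite ffunE.
  case: q => q1 q2 /= [h1 h2]; rewrite /h; congr (_, _).
    by apply/ffunP => p; rewrite ffunE h1.
  by apply/ffunP => p; rewrite ffunE h2.
have pA1 q : <<s past k >> (A1 q).
  suff : measurable (A1 q : set (g_sigma_algebraType (past k))) by [].
  apply: measurable_all => p; apply/measurable_floor_eq/measurable_funM => //.
  exact: measurable_travel_past.
have floorB (f : R) z : (Num.floor (f / rho) = z) -> z%:~R * rho <= f < (z%:~R + 1) * rho.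
  by move=> <-; rewrite -ler_pdivlMr// -ltr_pdivrMr// -intrD1 Num.Theory.floor_itv.
have dfloor i c (z : int) :
    <<s during k n i >> [set w | Num.floor (travel k n i c w / rho) = z].
  apply: (@measurable_floor_eq _ (g_sigma_algebraType (during k n i)) _
    (fun w => travel k n i c w / rho) z).
  apply: measurable_funM => // _ B mB; rewrite setTI.
  exact: travel_during.
have dB0 q : <<s during k n ord0 >> (B0 q).
  suff : measurable (B0 q : set (g_sigma_algebraType (during k n ord0))) by [].
  by apply: measurable_all => c; exact: dfloor.
have mA1 q : measurable (A1 q) by exact: past_measurable (pA1 q).
have mB0 q : measurable (B0 q) by exact: during_measurable (dB0 q).
have CE : (C0 * 3 ^+ d) ^+ K * y ^+ (K * d) = (C0 * (3 * y) ^+ d) ^+ K.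
  rewrite [(K * d)%N]mulnC exprM -exprMn.
  by congr (_ ^+ _); rewrite [(3 * y) ^+ d]exprMn mulrA.
rewrite CE; apply: (@pr_le_countable_partition _ _ _ _ _ h) => //.
  by apply: measurableI => //; exact: clustered_measurable.
  by move=> q; rewrite hE; exact: measurableI.
move=> [q1 q2]; rewrite hE /=.
(* The predicted displacement of walker i if it were to rejoin walker 0. Clustering costs an error
   rho and each of the three roundings at most rho, one of them with the opposite sign, so the total
   error lies between -2 rho and 3 rho. *)
pose x i c : R := (q2 c)%:~R * rho + (q1 (ord0, c))%:~R * rho - (q1 (i, c))%:~R * rho.
pose Bx i := [set w | forall c, `|travel k n i c w - x i c| <= 3 * rho].
pose B (i : 'I_K.+1) := if i == ord0 then B0 q2 else Bx i.
have dBx i : <<s during k n i >> (Bx i).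
  suff : measurable (Bx i : set (g_sigma_algebraType (during k n i))) by [].
  apply: measurable_all => c; apply/measurable_le_const/measurableT_comp => //.
  by apply: measurable_funB => // _ D mD; rewrite setTI; exact: travel_during.
have dB i : <<s during k n i >> (B i) by rewrite /B; case: eqP => [->|_].
have mB i : measurable (B i) by exact: during_measurable (dB i).
have pAA1 : <<s past k >> (A `&` A1 q1).
  by apply: (@measurableI _ (g_sigma_algebraType (past k))); [exact: pA|exact: pA1].
have -> : pr (A `&` (A1 q1 `&` B0 q2)) = pr (A `&` A1 q1) * pr (B0 q2).
  pose B' (i : 'I_K.+1) := if i == ord0 then B0 q2 else setT.
  have := @past_during_independent k n _ B' pAA1.
  rewrite big_ord_recl /B' /= big1 ?mulr1 => [<-|]; last by rewrite pr_setT.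
    rewrite setIA; congr (pr (_ `&` _)); apply/seteqP; split => w.
      by move=> h' i; case: eqP.
    by move=> /(_ ord0); rewrite eqxx.
  move=> i; case: eqP => [->//|_].
  exact: (@measurableT _ (g_sigma_algebraType (during k n i))).
apply: (@le_trans _ _ (pr ((A `&` A1 q1) `&` [set w | forall i, B i w]))).
  apply: pr_mono.
  - by repeat apply: measurableI => //; exact: clustered_measurable.
  - by apply: measurableI; [exact: measurableI|exact: measurable_all].
  move=> w [[wA wc] [w1 w2]]; split => // i; rewrite /B; case: eqP => // _ c.
  have := wc i ord0 c; rewrite !travelD add0n.
  have := floorB _ _ (w1 (i, c)); have := floorB _ _ (w1 (ord0, c)).
  have := floorB _ _ (w2 c); rewrite /x /= !mulrDl !mul1r.
  rewrite !ler_norml => /andP[? ?] /andP[? ?] /andP[? ?] /andP[? ?].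
  by apply/andP; split; lra.
(* The factor of walker 0 matches the one in the conditioning event; each of the other K walkers
   contributes one box probability at scale 3 rho. *)
rewrite (past_during_independent pAA1 dB) big_ord_recl /B /= mulrA mulrC ler_wpM2r//.
  by rewrite mulr_ge0 ?pr_ge0.
rewrite -[X in _ ^+ X]card_ord -prodr_const.
apply: ler_prod => i _; rewrite pr_ge0 /=.
have := ws_box WS k (lift ord0 i) (x (lift ord0 i)) n0 (rho := 3 * rho).
rewrite /y mulrA; apply.
by lra.
Qed.

(* By independence, all the walkers are in the same cell q with probability
   p_q ^ K.+1, and the p_q add up to at least 1/2. *)
Lemma pr_clustered_ge n (rho : R) : (0 < n)%N -> 1 <= rho -> rho <= Num.sqrt n%:R ->
  2^-1 ^+ K.+1 / (3 * lam) ^+ (K * d) * (rho / Num.sqrt n%:R) ^+ (K * d) <=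
  pr (clustered n rho).
Proof.
move=> n0 rho1; set s := Num.sqrt n%:R => rhos.
have rho0 : 0 < rho by exact: lt_le_trans rho1.
have s0 : 0 < s by exact: lt_le_trans rhos.
have [H HE] : exists H, H = lam * s by exists (lam * s).
have H0 : 0 < H by rewrite HE mulr_gt0.
have Hr : 1 <= H / rho.
  by rewrite ler_pdivlMr// mul1r HE; apply: (le_trans rhos); rewrite ler_peMl// ltW.
(* Cells of side rho per coordinate, enough to cover [-H, H]. The bound M <= 3 H / rho is what turns
   M^(K d) into the factor (3 lam)^(K d) of the statement. *)
pose M := (Num.truncn (2 * H / rho)).+1.
have MH : 2 * H / rho < M%:R by exact: truncnS_gt.
have M3 : M%:R <= 3 * H / rho.
  have : (Num.truncn (2 * H / rho))%:R <= 2 * H / rho.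
    by rewrite Num.Theory.truncn_le; apply: divr_ge0; lra.
  rewrite /M -(natr1 (Num.truncn _)) -(mulrA 2) -(mulrA 3).
  by move: (H / rho) Hr => v Hv; move: (Num.truncn _)%:R => u; lra.
pose cell (i : 'I_K.+1) (q : {ffun 'I_d -> 'I_M}) := [set w | forall c,
  Num.floor ((travel 0 n i c w + H) / rho) = (q c : nat)%:Z].
have dcell i q : <<s during 0 n i >> (cell i q).
  suff : measurable (cell i q : set (g_sigma_algebraType (during 0 n i))) by [].
  apply: measurable_all => c; apply/measurable_floor_eq/measurable_funM => //.
  apply: measurable_funD => // _ B mB; rewrite setTI; exact: travel_during.
have mcell i q : measurable (cell i q) by exact: during_measurable (dcell i q).
pose D q := [set w | forall i, cell i q w].
have mD q : measurable (D q) by apply: measurable_all => i; exact: mcell.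
have prD q : pr (D q) = pr (cell ord0 q) ^+ K.+1.
  have := @past_during_independent 0 n setT (fun i => cell i q).
  rewrite setTI pr_setT mul1r => ->//; last exact: (@measurableT _ (g_sigma_algebraType _)).
  rewrite -[X in _ ^+ X]card_ord -prodr_const; apply: eq_bigr => i _.
  pose B c := [set x : R | Num.floor ((x + H) / rho) = (q c : nat)%:Z].
  apply: (ws_law WS n i ord0 (B := B)) => c.
  apply: (@measurable_floor_eq _ (measurableTypeR R) R (fun x => (x + H) / rho)).
  by apply: measurable_funM => //; exact: measurable_funD.
have dis i q q' : q != q' -> cell i q `&` cell i q' = set0.
  move=> qq'; apply/seteqP; split => // w [w1 w2]; move/eqP: qq'; apply.
  by apply/ffunP => c; apply/val_inj; have := w1 c; rewrite w2 => -[].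
have Dclustered : \bigcup_(q in [set` index_enum {ffun 'I_d -> 'I_M}]) D q `<=` clustered n rho.
  move=> w [q _ Dq] i i' c.
  have := Num.Theory.floor_itv ((travel 0 n i c w + H) / rho).
  have := Num.Theory.floor_itv ((travel 0 n i' c w + H) / rho).
  rewrite !Dq !intrD1 !ler_pdivlMr// !ltr_pdivrMr// !mulrDl !mul1r.
  by move=> /andP[? ?] /andP[? ?]; rewrite ler_norml; apply/andP; split; lra.
pose bad c := [set w | lam * s < `|travel 0 n ord0 c w|].
have mbad c : measurable (bad c).
  by apply/measurable_gt_const/measurableT_comp => //; exact: measurable_travel.
(* By the tail bound and a union over the d coordinates, walker 0 leaves [-H, H]^d with probability
   at most 1/2, and the cells cover this box. *)
have half : 2^-1 <= \sum_q pr (cell ord0 q).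
  rewrite pr_sum_disjoint ?index_enum_uniq//; last by move=> *; exact: dis.
  have le_bad : pr (\bigcup_(c in [set` index_enum 'I_d]) bad c) <= 2^-1.
    apply: (le_trans (pr_bigcup_le _ _ mbad)).
    apply: (@le_trans _ _ (\sum_(c < d) (2 * (K.+1 * d)%:R)^-1)).
      by apply: ler_sum => c _; exact: (ws_tail WS).
    rewrite sumr_const card_ord -[leLHS]mulr_natr (natrM _ K.+1 d).
    have -> : (2 * (K.+1%:R * d%:R))^-1 * d%:R = 2^-1 * K.+1%:R^-1 :> R.
      by rewrite !invfM -!mulrA mulVf ?mulr1// pnatr_eq0 -lt0n.
    by rewrite ler_piMr ?invr_ge0// invf_le1 ?ltr0n// ler1n.
  have mU := bigcup_seq_measurable (index_enum 'I_d) mbad.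
  apply: (@le_trans _ _ (pr (~` \bigcup_(c in [set` index_enum 'I_d]) bad c))).
    by rewrite pr_setC// lerBrDr -lerBrDl (le_trans le_bad)// [X in X - _]splitr div1r addrK.
  apply: pr_mono; [exact: measurableC|exact: bigcup_seq_measurable|].
  move=> w wb.
  have hb c : 0 <= (travel 0 n ord0 c w + H) / rho < M%:R.
    have /negP : ~ bad c w by move=> ?; apply: wb; exists c => //=; rewrite mem_index_enum.
    rewrite -HE -leNgt ler_norml => /andP[? ?].
    apply/andP; split; first by apply: divr_ge0; lra.
    by apply: le_lt_trans MH; rewrite ler_pM2r ?invr_gt0//; lra.
  have fM c : (Num.truncn ((travel 0 n ord0 c w + H) / rho) < M)%N.
    have /andP[x0 xM] := hb c; rewrite -(ltr_nat R).
    by apply: le_lt_trans xM; rewrite Num.Theory.truncn_le.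
  exists [ffun c => Ordinal (fM c)]; first by rewrite /= mem_index_enum.
  by move=> c; rewrite ffunE /=; have /andP[x0 _] := hb c;
    rewrite Num.Theory.truncn_floor x0 gez0_abs// Num.Theory.floor_ge0.
(* There are M^d cells and the exponent is K + 1, so the loss is (M^d)^K. *)
have := power_mean (index_enum {ffun 'I_d -> 'I_M}) K
  (fun q => pr_ge0 P (cell ord0 q)).
have -> : (size (index_enum {ffun 'I_d -> 'I_M})) = (M ^ d)%N.
  by rewrite size_index_enum card_ffun !card_ord.
under [in X in _ <= X -> _]eq_bigr do rewrite -prD.
rewrite [X in _ <= _ * X -> _]pr_sum_disjoint ?index_enum_uniq//; last first.
  move=> q q' qq'; apply/seteqP; split => // w [/(_ ord0) w1 /(_ ord0) w2].
  by have := dis ord0 _ _ qq'; rewrite -subset0; apply; split; [exact: w1|exact: w2].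
move=> pm.
have Mp : 0 < (M%:R : R) ^+ (K * d) by rewrite exprn_gt0// ltr0n.
rewrite -(ler_pM2l Mp).
apply: (@le_trans _ _ (2^-1 ^+ K.+1)).
  rewrite expr_regroup ler_piMr ?exprn_ge0 ?invr_ge0// exprn_ile1//.
    by rewrite mulr_ge0 ?divr_ge0 ?ler0n// ltW ?mulr_gt0.
  have := ler_wpM2r (ltW (divr_gt0 rho0 s0)) M3.
  rewrite (_ : 3 * H / rho * (rho / s) = 3 * lam); last first.
    by rewrite HE; field; rewrite !gt_eqF.
  by move=> h; rewrite mulrAC ler_pdivrMr ?mul1r// mulr_gt0.
have := lerXn2r K.+1 _ _ half; rewrite !nnegrE => /(_ _ _)/le_trans; apply.
- by rewrite invr_ge0.
- by apply: sumr_ge0 => q _; exact: pr_ge0.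
apply: (le_trans pm); rewrite natrX -exprM mulnC ler_wpM2l ?exprn_ge0//.
apply: pr_mono => //; [exact: bigcup_seq_measurable|exact: clustered_measurable].
Qed.

End system.

Lemma ler_sum_nat_sub (R : numDomainType) (f : nat -> R) a b c e :
  (forall i, 0 <= f i) -> (a <= b)%N -> (b <= c)%N -> (c <= e)%N ->
  \sum_(b <= i < c) f i <= \sum_(a <= i < e) f i.
Proof.
move=> f0 ab bc ce.
rewrite (big_cat_nat (leq_trans ab bc) ce) (big_cat_nat ab bc) /=.
rewrite -[leLHS]addr0 lerD ?sumr_ge0//.
by rewrite -[leLHS]add0r lerD ?sumr_ge0.
Qed.

(** * Upper bound for the probability of an encounter in a dyadic range of times *)

Section hitting.
Context (disp : measure_display) (T : measurableType disp) (R : realType).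
Variable P : probability T R.
Variables (K d : nat) (C0 lam : R).
Local Notation pr := (pr P).
Hypothesis C0_ge0 : 0 <= C0.
Hypothesis lam_ge1 : 1 <= lam.
Hypothesis d_gt0 : (0 < d)%N.
Variables (xi : nat -> 'I_K.+1 -> 'I_d -> T -> R).
Variables (G : nat * 'I_K.+1 -> set (set T)).
Hypothesis WS : walk_system P C0 lam xi G.

Local Notation travel := (travel xi).
Local Notation clustered := (clustered xi).
Local Notation past k := (past G k).
Local Notation m := (K * d)%N.

Let lam_gt0 : 0 < lam.
Proof. exact: lt_le_trans lam_ge1. Qed.

Let mclustered n (rho : R) : measurable (clustered n rho).
Proof. apply: (clustered_measurable WS). Qed.

Definition Cbox := (C0 * 3 ^+ d) ^+ K.

Let Cbox_ge0 : 0 <= Cbox.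
Proof. by rewrite exprn_ge0// mulr_ge0// exprn_ge0. Qed.

Lemma pr_clustered_le n (rho : R) : (0 < n)%N -> 1 <= rho ->
  pr (clustered n rho) <= Cbox * (rho / Num.sqrt n%:R) ^+ m.
Proof.
move=> n0 rho1; rewrite -[clustered n rho]setTI -{1}[n]add0n.
rewrite (le_trans (pr_clustered_after WS _ n0 rho1))//.
  exact: (@measurableT _ (g_sigma_algebraType (past 0))).
by rewrite pr_setT mulr1.
Qed.

(** Given [A], each of the (K + 1) d coordinates moves by more than lam sqrt n with probability at
    most 1 / (2 (K + 1) d), which is the level fixed in [ws_tail]. A union bound thus leaves at
    least half of [pr A], and two displacements of size rho differ by at most 2 rho. *)
Lemma pr_stay k n (rho : R) A : <<s past k >> A -> lam * Num.sqrt n%:R <= rho ->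
  pr A <= 2 * pr (A `&`
    [set w | forall i i' c, `|travel k n i c w - travel k n i' c w| <= 2 * rho]).
Proof.
move=> pA ln; set S := [set w | _].
have mA : measurable A by exact: (past_measurable WS) pA.
have mt := measurable_travel WS.
have mS : measurable S.
  do 3 (apply: measurable_all => ?).
  by apply/measurable_le_const/measurableT_comp => //; exact: measurable_funB.
pose bad (p : 'I_K.+1 * 'I_d) := [set w | lam * Num.sqrt n%:R < `|travel k n p.1 p.2 w|].
have mbad p : measurable (bad p).
  by apply/measurable_gt_const/measurableT_comp.
have mAbad p : measurable (A `&` bad p) by exact: measurableI.
have bad_le p : pr (A `&` bad p) <= (2 * (K.+1 * d)%:R)^-1 * pr A.
  pose B i := if i == p.1 then bad p else setT.
  have := @past_during_independent _ _ _ _ _ _ _ _ _ _ WS k n A B pA.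
  rewrite (bigD1 p.1)//= /B eqxx big1 ?mulr1; last first.
    by move=> i /negbTE ->; rewrite pr_setT.
  have -> : [set w | forall i, (if i == p.1 then bad p else setT) w] = bad p.
    apply/seteqP; split => w; first by move=> /(_ p.1); rewrite eqxx.
    by move=> ? i; case: eqP.
  move=> ->; last first.
    move=> i; case: eqP => [->|_]; last exact: (@measurableT _ (g_sigma_algebraType _)).
    apply: (@measurable_gt_const _ (g_sigma_algebraType (during G k n p.1)) R
       (fun w => `|travel k n p.1 p.2 w|)).
    apply: measurableT_comp => // _ D mD; rewrite setTI.
    exact: (travel_during WS).
  rewrite mulrC ler_wpM2r ?pr_ge0//.
  (* [ws_tail] covers n > 0; for n = 0 the displacement is 0 and the strict inequality makes the bad
     event empty. *)
  have [n0|n0] := posnP n; last exact: (ws_tail WS).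
  rewrite (_ : bad p = set0) ?pr_set0 ?invr_ge0 ?mulr_ge0//.
  apply/seteqP; split => // w; rewrite /bad /= n0 sqrtr0 mulr0 travel0 normr0.
  by rewrite ltxx.
have sub : A `\` S `<=` \bigcup_(p in [set` index_enum ('I_K.+1 * 'I_d)%type]) (A `&` bad p).
  move=> w [wA wS]; have [[p wp]|nbad] := pselect (exists p, bad p w).
    by exists p => //=; rewrite mem_index_enum.
  exfalso; apply: wS => i i' c.
  have hb j : `|travel k n j c w| <= rho.
    rewrite leNgt; apply/negP => h; apply: nbad; exists (j, c).
    exact: le_lt_trans ln h.
  by rewrite (le_trans (ler_normB _ _))// mulr_natl mulr2n lerD.
have := pr_mono P _ _ sub.
move=> /(_ (measurableD mA mS) (bigcup_seq_measurable _ mAbad)) le1.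
have le2 := le_trans le1 (pr_bigcup_le P _ mAbad).
have : \sum_(p : 'I_K.+1 * 'I_d) pr (A `&` bad p) <= 2^-1 * pr A.
  apply: (@le_trans _ _ (\sum_(p : 'I_K.+1 * 'I_d) (2 * (K.+1 * d)%:R)^-1 * pr A)).
    by apply: ler_sum => p _.
  rewrite sumr_const card_prod !card_ord -[leLHS]mulr_natr mulrAC.
  by rewrite invfM mulfVK// pnatr_eq0 muln_eq0 -lt0n d_gt0.
rewrite (pr_setID P mA mS); move: le2.
set u := \sum_(p <- _) _; have -> : u = \sum_(p : 'I_K.+1 * 'I_d) pr (A `&` bad p) by [].
rewrite mulrDr; set x := pr (A `&` S); set y := pr (A `\` S); set v := \sum_p _.
by move=> ? ?; lra.
Qed.

(** The 6 is the 2 of [pr_stay] times a time range of length at most 3 n; lam^2 comes from the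
    length (rho / lam)^2 of the stay, and 3^m from the enlarged radius 3 rho. The summand 1 covers
    the trivial case rho >= sqrt n. *)
Definition Chit := 6 * lam ^+ 2 * Cbox * 3 ^+ m + 1.

Lemma Chit_gt0 : 0 < Chit.
Proof.
by rewrite ltr_wpDl// !mulr_ge0// ?exprn_ge0// ltW.
Qed.

(* Once clustered, the walkers remain within 3 rho of each other for about
   rho ^ 2 steps with probability at least 1/2; compare with the expected time
   spent within 3 rho of each other. *)
Lemma pr_hit_le n (rho : R) : (2 <= m)%N -> (0 < n)%N -> 1 <= rho ->
  pr [set w | exists k, (n <= k <= 2 * n)%N /\ clustered k rho w] <=
  Chit * (rho / Num.sqrt n%:R) ^+ (m - 2).
Proof.
move=> m2 n0 rho1; set Hit := [set w | _].
have mHit : measurable Hit.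
  by apply: measurable_ex => k; exact/measurable_andl/mclustered.
set s := Num.sqrt n%:R.
have s0 : 0 < s by rewrite sqrtr_gt0 ltr0n.
have rho0 : 0 < rho by exact: lt_le_trans rho1.
have ss : s ^+ 2 = n%:R by rewrite sqr_sqrtr// ler0n.
have [y0 Ch0] : 0 < rho / s /\ 0 <= Chit - 1.
  by split; [exact: divr_gt0|rewrite addrK !mulr_ge0// ?exprn_ge0// ltW].
have [srho|rhos] := leP s rho.
  rewrite (le_trans (pr_le1 _ mHit))// -[leLHS]mulr1 ler_pM//.
    by rewrite -subr_ge0.
  by rewrite exprn_ege1// ler_pdivlMr// mul1r.
(* The first encounter at or after time n occurs at time k; these events are disjoint and belong to
   the past of k. *)
pose F k := [set w | (n <= k)%N /\
  (clustered k rho w /\ forall l, (n <= l < k)%N -> ~ clustered l rho w)].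
have pF k : <<s past k >> (F k).
  suff : measurable (F k : set (g_sigma_algebraType (past k))) by [].
  apply: measurable_andl; apply: measurableI; first exact: (clustered_past WS).
  apply: measurable_all => l; have [nlk|nlk] := boolP (n <= l < k)%N; last first.
    by rewrite (_ : mkset _ = setT)//; apply/seteqP; split.
  rewrite (_ : mkset _ = ~` clustered l rho); last first.
    by apply/seteqP; split => w; [exact|move=> ? _].
  apply: measurableC; case/andP: nlk => _ /ltnW lk.
  suff : <<s past k >> (clustered l rho) by [].
  by apply: (past_mono lk); exact: (clustered_past WS).
have mF k : measurable (F k) by exact: (past_measurable WS) (pF k).
have dF k l : k != l -> F k `&` F l = set0.
  wlog : k l / (k < l)%N => [wl kl|kl _].
    have [kl'|lk] := ltnP k l; first exact: wl.
    by rewrite setIC; apply: wl; rewrite 1?eq_sym// ltn_neqAle eq_sym kl.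
  apply/seteqP; split => // w [[nk [ck _]] [_ [_ nl]]].
  by apply: (nl k) => //; rewrite nk.
have HitF : pr Hit <= \sum_(n <= k < (2 * n).+1) pr (F k).
  rewrite pr_sum_disjoint ?iota_uniq//; apply: pr_mono => //.
    exact: bigcup_seq_measurable.
  move=> w [k [/andP[nk kn] ck]].
  have ex : exists l, (n <= l)%N && `[< clustered l rho w >] by exists k; rewrite nk; apply/asboolP.
  case: (ex_minnP ex) => l /andP[nl /asboolP cl] lmin; exists l.
    rewrite /= mem_index_iota nl ltnS (leq_trans _ kn)// lmin// nk.
    exact/asboolP.
  split => //; split => // j /andP[nj jl] cj.
  have : (l <= j)%N by apply: lmin; rewrite nj; apply/asboolP.
  by rewrite leqNgt jl.
(* At most z steps keep the typical displacement lam sqrt j below rho. With J = floor z + 1 all j <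
   J qualify, and J >= z. *)
pose z := (rho / lam) ^+ 2.
have z0 : 0 <= z by exact: sqr_ge0.
pose J := (Num.truncn z).+1.
have zJ : z <= J%:R by exact/ltW/truncnS_gt.
have Jlam j : (j < J)%N -> lam * Num.sqrt j%:R <= rho.
  rewrite ltnS => jJ; rewrite mulrC -ler_pdivlMr//.
  rewrite -[leRHS](ger0_norm (divr_ge0 (ltW rho0) (ltW lam_gt0))) -sqrtr_sqr.
  apply: ler_wsqrtr; apply: (@le_trans _ _ (Num.truncn z)%:R); first by rewrite ler_nat.
  by rewrite Num.Theory.truncn_le.
(* This keeps the J times following an encounter at k <= 2 n inside the range up to 3 n. *)
have Jn : (J <= n.+1)%N.
  rewrite ltnS -(ler_nat R); apply: (@le_trans _ _ z); first by rewrite Num.Theory.truncn_le.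
  rewrite -ss /z ler_sqr ?nnegrE ?divr_ge0 ?ltW// (le_lt_trans _ rhos)//.
  by rewrite ler_pdivrMr// ler_peMr// ltW.
have lower k : (n <= k < (2 * n).+1)%N ->
    J%:R * pr (F k) <= 2 * \sum_(n <= l < (3 * n).+1) pr (F k `&` clustered l (3 * rho)).
  move=> /andP[nk kn].
  apply: (@le_trans _ _ (2 * \sum_(k <= l < J + k) pr (F k `&` clustered l (3 * rho)))).
    have -> : \sum_(k <= l < J + k) pr (F k `&` clustered l (3 * rho)) =
        \sum_(0 <= j < J) pr (F k `&` clustered (j + k) (3 * rho)).
      by rewrite -{1}[k]add0n big_addn addnK.
    rewrite mulr_sumr mulr_natl.
    rewrite -[J in leLHS]subn0 -sumr_const_nat; apply: ler_sum_nat => j /andP[_ jJ].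
    apply: le_trans (pr_stay (pF k) (Jlam _ jJ)) _; rewrite ler_pM2l//.
    apply: pr_mono.
    - apply: measurableI => //; do 3 (apply: measurable_all => ?).
      apply/measurable_le_const/measurableT_comp => //.
      by apply: measurable_funB; exact: (measurable_travel WS).
    - exact: measurableI.
    move=> w [Fw dw]; split => // i i' c.
    have [_ [ck _]] := Fw; have := ck i i' c; have := dw i i' c.
    rewrite [(j + k)%N]addnC !travelD add0n !ler_norml => /andP[? ?] /andP[? ?].
    by apply/andP; split; lra.
  rewrite ler_pM2l// ler_sum_nat_sub//; first by move=> l; exact: pr_ge0.
    by rewrite leq_addl.
  by rewrite (mulSn 2) -addSn leq_add.
(* For a fixed l the events [F k] are disjoint, so summing over the time of first encounter costs
   nothing. Exchanging the two sums then gives [main]. *)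
have upper l : (n <= l)%N ->
    \sum_(n <= k < (2 * n).+1) pr (F k `&` clustered l (3 * rho)) <=
    Cbox * (3 * (rho / s)) ^+ m.
  move=> nl; have l0 : (0 < l)%N by exact: leq_trans nl.
  rewrite pr_sum_disjoint ?iota_uniq//; last 2 first.
    by move=> k; exact: measurableI.
    by move=> i j /dF ij; rewrite setIACA ij set0I.
  apply: (@le_trans _ _ (pr (clustered l (3 * rho)))).
    apply: pr_mono => //; first by apply: bigcup_seq_measurable => k; exact: measurableI.
    by move=> w [k _ []].
  apply: le_trans (pr_clustered_le l0 _) _; first by lra.
  rewrite ler_wpM2l//; apply: lerXn2r; rewrite ?nnegrE.
    by rewrite divr_ge0 ?sqrtr_ge0// mulr_ge0// ltW.
    by rewrite mulr_ge0// ltW.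
  rewrite -mulrA ler_pM2l// ler_pM2l// lef_pV2 ?posrE ?sqrtr_gt0 ?ltr0n//.
  by rewrite ler_wsqrtr// ler_nat.
have main : z * pr Hit <= 2 * (3 * n%:R * (Cbox * (3 * (rho / s)) ^+ m)).
  apply: le_trans (ler_wpM2l z0 HitF) _.
  apply: (@le_trans _ _ (\sum_(n <= k < (2 * n).+1) J%:R * pr (F k))).
    by rewrite mulr_sumr; apply: ler_sum => k _; rewrite ler_wpM2r ?pr_ge0.
  apply: (le_trans (ler_sum_nat lower)).
  rewrite -mulr_sumr ler_pM2l// exchange_big_nat /=.
  apply: (@le_trans _ _ (\sum_(n <= l < (3 * n).+1) Cbox * (3 * (rho / s)) ^+ m)).
    by apply: ler_sum_nat => l /andP[nl _]; exact: upper.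
  rewrite sumr_const_nat -[leLHS]mulr_natl ler_wpM2r//.
    by rewrite mulr_ge0// exprn_ge0// mulr_ge0// ltW.
  by rewrite -natrM ler_nat leq_subLR -[X in (X < _)%N]add0n ltn_add2r.
have {main} : (rho / s) ^+ 2 * pr Hit <= (Chit - 1) * (rho / s) ^+ m.
  rewrite /Chit addrK.
  have -> : (rho / s) ^+ 2 * pr Hit = lam ^+ 2 / s ^+ 2 * (z * pr Hit).
    by rewrite /z; field; rewrite !gt_eqF.
  have -> : 6 * lam ^+ 2 * Cbox * 3 ^+ m * (rho / s) ^+ m =
      lam ^+ 2 / s ^+ 2 * (2 * (3 * n%:R * (Cbox * (3 * (rho / s)) ^+ m))).
    by rewrite -ss [(3 * _) ^+ m]exprMn; field; rewrite gt_eqF.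
  by rewrite ler_wpM2l// divr_ge0// ?exprn_ge0// ltW.
have -> : (rho / s) ^+ m = (rho / s) ^+ 2 * (rho / s) ^+ (m - 2).
  by rewrite -exprD subnKC.
rewrite mulrCA ler_pM2l ?exprn_gt0// => /le_trans; apply.
by rewrite ler_wpM2r ?exprn_ge0 ?ltW// gtrBl.
Qed.

End hitting.

(** 1/x - 1/y = 1/(x y (x + y)), and y <= 2 x bounds the denominator by 6 x^3. It makes sums of
    inverse cubes telescope. *)
Lemma invr_cube_le (R : realFieldType) (x y : R) : 1 <= x -> 0 < y ->
  y ^+ 2 = x ^+ 2 + 1 -> x ^- 3 <= 6 * (x^-1 - y^-1).
Proof.
move=> x1 y0 h; have x0 : 0 < x by exact: lt_le_trans x1.
have xy : x <= y by rewrite -ler_sqr ?nnegrE ?ltW// h; lra.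
have y2 : y <= 2 * x by rewrite -ler_sqr ?nnegrE ?mulr_ge0 ?ltW// h; nra.
have e : (y - x) * (x + y) = 1.
  by rewrite -[RHS](addrK (x ^+ 2)) [1 + _]addrC -h; ring.
have s0 : 0 < x + y by rewrite addr_gt0.
have -> : x^-1 - y^-1 = (x * y * (x + y))^-1.
  rewrite -[LHS]mulr1 -[X in _ * X](divff (lt0r_neq0 s0)).
  have -> : (x^-1 - y^-1) * ((x + y) / (x + y)) = ((y - x) * (x + y)) / (x * y * (x + y)).
    by field; rewrite !gt_eqF.
  by rewrite e mul1r.
have p3 : 0 < x ^+ 3 by rewrite exprn_gt0.
have pq : 0 < x * y * (x + y) by rewrite !mulr_gt0.
rewrite ler_pdivlMr// mulrC ler_pdivrMr//.
have a1 : x * y <= x * (2 * x) by rewrite ler_pM2l.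
have a2 : x + y <= 3 * x by lra.
have := ler_pM (ltW (mulr_gt0 x0 y0)) (ltW s0) a1 a2.
by move=> h2; apply: (le_trans h2); rewrite le_eqVlt; apply/orP; left; apply/eqP; ring.
Qed.

(** A Green function bound in dimension 3, telescoping along x = sqrt (r^2 + j). The offset r^2
    keeps the summand of order 1 while j <= r^2, so that one formula covers both the stay near the
    encounter and the later decay. *)
Lemma sum_green_le (R : realType) (r : R) n : 1 <= r ->
  \sum_(0 <= j < n) (r / Num.sqrt (r ^+ 2 + j%:R)) ^+ 3 <= 6 * r ^+ 2.
Proof.
move=> r1; have r0 : 0 < r by exact: lt_le_trans r1.
pose z j := Num.sqrt (r ^+ 2 + j%:R).
have z1 j : 1 <= z j.
  rewrite -sqrtr1 ler_wsqrtr// -[leLHS]addr0 lerD// exprn_ege1//.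
have z0 j : 0 < z j by exact: lt_le_trans (z1 j).
have zz j : z j ^+ 2 = r ^+ 2 + j%:R by rewrite sqr_sqrtr// addr_ge0// sqr_ge0.
have step j : (r / z j) ^+ 3 <= 6 * r ^+ 3 * ((z j)^-1 - (z j.+1)^-1).
  rewrite exprMn exprVn mulrC [6 * _]mulrC -mulrA [leRHS]mulrC mulrC.
  rewrite [leRHS]mulrC ler_pM2l ?exprn_gt0//; apply: invr_cube_le => //.
  by rewrite !zz -natr1 addrA.
apply: (le_trans (ler_sum _ (fun j _ => step j))); rewrite -mulr_sumr.
rewrite (telescope_sumr_eq (fun k => - (z k)^-1))//; last by move=> k _; rewrite opprK addrC.
have -> : z 0%N = r by rewrite /z addr0 sqrtr_sqr ger0_norm// ltW.
rewrite opprK; apply: (@le_trans _ _ (6 * r ^+ 3 * r^-1)).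
  rewrite ler_pM2l; last by rewrite mulr_gt0// exprn_gt0.
  by rewrite gerDr oppr_le0 invr_ge0 ltW.
by rewrite le_eqVlt; apply/orP; left; apply/eqP; field; rewrite gt_eqF.
Qed.

Lemma ler_sum_seq_sub (R : numDomainType) (I : eqType) (r s : seq I) (f : I -> R) :
  (forall i, 0 <= f i) -> uniq r -> {subset r <= s} ->
  \sum_(i <- r) f i <= \sum_(i <- s) f i.
Proof.
move=> f0; elim: r s => [|i r IH] s; first by rewrite big_nil sumr_ge0.
move=> /= /andP[ir ur] rs; have si : i \in s by apply: rs; exact: mem_head.
rewrite big_cons (perm_big _ (perm_to_rem si)) big_cons lerD2l IH// => x xr.
have := rs x; rewrite inE xr orbT => /(_ isT).
rewrite (perm_mem (perm_to_rem si)) inE => /predU1P[xi|//].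
by rewrite -xi xr in ir.
Qed.

Lemma sum_eq1 (R : numDomainType) (I : eqType) (s : seq I) i : uniq s ->
  \sum_(j <- s) (j == i)%:R <= 1 :> R.
Proof.
move=> us; rewrite -natr_sum.
rewrite (eq_bigr (fun j => if j == i then 1%N else 0%N)); last by move=> j _; case: eqP.
by rewrite -big_mkcond sum1_count count_uniq_mem// lern1 leq_b1.
Qed.

(** * Second moment method over dyadic blocks *)

Section blocks.
Context (disp : measure_display) (T : measurableType disp) (R : realType).
Variable P : probability T R.
Variables (K d : nat) (C0 lam : R).
Local Notation pr := (pr P).
Hypothesis C0_ge0 : 0 <= C0.
Hypothesis lam_ge1 : 1 <= lam.
Hypothesis d_gt0 : (0 < d)%N.
Variables (xi : nat -> 'I_K.+1 -> 'I_d -> T -> R).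
Variables (G : nat * 'I_K.+1 -> set (set T)).
Hypothesis WS : walk_system P C0 lam xi G.

Local Notation clustered := (clustered xi).
Local Notation past k := (past G k).
Local Notation m := (K * d)%N.
Local Notation Cbox := (Cbox K d C0).

Hypothesis m_ge3 : (3 <= m)%N.

Let lam_gt0 : 0 < lam.
Proof. exact: lt_le_trans lam_ge1. Qed.

Let mclustered n (rho : R) : measurable (clustered n rho).
Proof. by apply: (clustered_measurable WS). Qed.

Let Cbox_ge0 : 0 <= Cbox.
Proof. by rewrite exprn_ge0// mulr_ge0// exprn_ge0. Qed.

(** For j <= r^2 the trivial bound [pr A] is used. For j > r^2 the ratio r / sqrt j is below 1, so m
    >= 3 allows the exponent m to be lowered to 3. In both cases the ratio is at most comparable to
    the summand of [sum_green_le], with a factor 2^3 = 8, whence 48 = 8 * 6. *)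
Lemma pr_clustered_green k n A (r : R) : <<s past k >> A -> 1 <= r ->
  \sum_(0 <= j < n) pr (A `&` clustered (k + j) r) <= 48 * (1 + Cbox) * r ^+ 2 * pr A.
Proof.
move=> pA r1; have r0 : 0 < r by exact: lt_le_trans r1.
have mA : measurable A by exact: (past_measurable WS) pA.
have C1 : 0 < 1 + Cbox by rewrite ltr_wpDr.
apply: (@le_trans _ _ (\sum_(0 <= j < n)
    8 * (1 + Cbox) * pr A * (r / Num.sqrt (r ^+ 2 + j%:R)) ^+ 3)).
  apply: ler_sum => j _.
  set u := r / Num.sqrt (r ^+ 2 + j%:R).
  have rj0 : 0 < r ^+ 2 + j%:R by rewrite ltr_wpDr// exprn_gt0.
  have u0 : 0 < u by rewrite divr_gt0// sqrtr_gt0.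
  have [jr|rj] := leP j%:R (r ^+ 2).
    apply: (@le_trans _ _ (pr A)).
      by apply: pr_mono => //; exact: measurableI.
    rewrite mulrAC ler_peMl ?pr_ge0//.
    have u2 : 2^-1 <= u.
      rewrite /u ler_pdivlMr ?sqrtr_gt0// ler_pdivrMl//.
      rewrite -[leRHS](ger0_norm (mulr_ge0 _ (ltW r0)))// -sqrtr_sqr ler_wsqrtr//.
      by rewrite exprMn; lra.
    have : 2^-1 ^+ 3 <= u ^+ 3.
      by apply: lerXn2r; rewrite ?nnegrE ?invr_ge0// ltW.
    rewrite [2^-1 ^+ 3](_ : _ = 8^-1); last by field.
    move=> h8; have C8 : 8 * (1 + Cbox) * 8^-1 = 1 + Cbox by field.
    apply: (@le_trans _ _ (8 * (1 + Cbox) * 8^-1)); first by rewrite C8 lerDl.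
    by rewrite ler_pM2l// mulr_gt0.
  have j0 : (0 < j)%N by rewrite -(ltr_nat R); apply: le_lt_trans rj; exact: sqr_ge0.
  apply: le_trans (pr_clustered_after WS pA j0 r1) _.
  rewrite -/(Cbox) [leRHS]mulrAC ler_wpM2r ?pr_ge0//.
  have sj0 : 0 < Num.sqrt (j%:R : R) by rewrite sqrtr_gt0 ltr0n.
  have rsj : r <= Num.sqrt j%:R.
    rewrite -[leLHS](ger0_norm (ltW r0)) -sqrtr_sqr ler_wsqrtr//; exact: ltW.
  have y1 : r / Num.sqrt j%:R <= 1 by rewrite ler_pdivrMr// mul1r.
  have y0 : 0 < r / Num.sqrt j%:R by rewrite divr_gt0.
  have yu : r / Num.sqrt j%:R <= 2 * u.
    rewrite /u mulrCA ler_pM2l// -[leLHS]mul1r ler_pdivrMr//.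
    rewrite mulrAC ler_pdivlMr ?sqrtr_gt0// mul1r.
    rewrite -[leRHS](ger0_norm (mulr_ge0 _ (ltW sj0)))// -sqrtr_sqr ler_wsqrtr//.
    by rewrite exprMn sqr_sqrtr ?ler0n//; move: rj; set x := j%:R; lra.
  apply: (@le_trans _ _ (Cbox * (2 * u) ^+ 3)).
    rewrite ler_wpM2l//; apply: (@le_trans _ _ ((r / Num.sqrt j%:R) ^+ 3)).
      by rewrite ler_wiXn2l// ltW.
    by apply: lerXn2r; rewrite ?nnegrE// ltW// mulr_gt0.
  rewrite exprMn mulrA ler_wpM2r ?exprn_ge0 ?ltW//.
  rewrite [2 ^+ 3](_ : _ = 8); last by ring.
  lra.
rewrite -mulr_sumr; apply: (le_trans (ler_wpM2l _ (sum_green_le n r1))).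
  by rewrite mulr_ge0 ?pr_ge0// ltW// mulr_gt0.
rewrite le_eqVlt; apply/orP; left; apply/eqP; ring.
Qed.

Local Notation block q := (index_iota (2 ^ q) (2 ^ q.+1)).
Local Notation side q := (Num.sqrt (2 ^ q)%:R : R).

Let side_gt0 q : 0 < side q.
Proof. by rewrite sqrtr_gt0 ltr0n expn_gt0. Qed.

Let side_sqr q : side q ^+ 2 = (2 ^ q)%:R.
Proof. by rewrite sqr_sqrtr// ler0n. Qed.

Let sizeS q : (2 ^ q.+1 - 2 ^ q = 2 ^ q)%N.
Proof. by rewrite expnS mul2n -addnn addnK. Qed.

Let sideS q : side q.+1 <= 2 * side q.
Proof.
rewrite -ler_sqr ?nnegrE ?mulr_ge0 ?(ltW (side_gt0 _))// exprMn !side_sqr expnS natrM.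
by rewrite -subr_ge0 [X in 0 <= X](_ : _ = 2 * (2 ^ q)%:R) ?mulr_ge0//; ring.
Qed.

(** Because of the weight r^-2, a block contributes O(1) whatever its radius; this serves for the
    block containing k and the next one. *)
Lemma pr_clustered_block_near k q A (r : R) : <<s past k >> A -> 1 <= r ->
  \sum_(l <- block q | (k <= l)%N) r ^- 2 * pr (A `&` clustered l r) <=
  48 * (1 + Cbox) * pr A.
Proof.
move=> pA r1; have r0 : 0 < r by exact: lt_le_trans r1.
rewrite -mulr_sumr ler_pdivrMl ?exprn_gt0// mulrCA mulrA.
apply: le_trans (pr_clustered_green (2 ^ q.+1) pA r1).
rewrite -big_filter.
apply: (@le_trans _ _ (\sum_(k <= l < k + 2 ^ q.+1) pr (A `&` clustered l r))).
  apply: ler_sum_seq_sub; [by move=> l; exact: pr_ge0|by rewrite filter_uniq ?iota_uniq|].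
  move=> l; rewrite mem_filter !mem_index_iota => /andP[-> /andP[_ lq]] /=.
  by apply: leq_trans lq _; exact: leq_addl.
rewrite -{1}[k]add0n big_addn addKn; under eq_bigr do rewrite addnC.
by [].
Qed.

(** All times of the block are at distance at least 2^(q-1) from k, so each term is of order (r /
    side q)^m; the 2^q terms and the weight r^-2 cancel two of the m factors. *)
Lemma pr_clustered_block_far k q A (r : R) : <<s past k >> A -> (k <= 2 ^ q.-1)%N ->
  (0 < q)%N -> 1 <= r ->
  \sum_(l <- block q | (k <= l)%N) r ^- 2 * pr (A `&` clustered l r) <=
  Cbox * 2 ^+ m * (r / side q) ^+ (m - 2) * pr A.
Proof.
move=> pA kq q0 r1; have r0 : 0 < r by exact: lt_le_trans r1.
have y0 : 0 < r / side q by rewrite divr_gt0.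
have kl l : (2 ^ q <= l)%N -> (2 ^ q.-1 <= l - k)%N.
  by move: kq; rewrite -{2}(prednK q0) expnS; lia.
apply: (@le_trans _ _ (\sum_(2 ^ q <= l < 2 ^ q.+1)
    r ^- 2 * (Cbox * (2 * (r / side q)) ^+ m * pr A))).
  rewrite big_mkcond; apply: ler_sum_nat => l /andP[ql _].
  have le0 : 0 <= r ^- 2 * (Cbox * (2 * (r / side q)) ^+ m * pr A).
    apply: mulr_ge0; first by rewrite invr_ge0 exprn_ge0// ltW.
    apply: mulr_ge0; last exact: pr_ge0.
    by apply: mulr_ge0 => //; apply: exprn_ge0; rewrite mulr_ge0// ltW.
  case: ifP => // klt; rewrite ler_wpM2l ?invr_ge0 ?exprn_ge0 ?(ltW r0)//.
  have lk0 : (0 < l - k)%N by apply: leq_trans (kl _ ql); rewrite expn_gt0.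
  rewrite -(subnKC klt); apply: le_trans (pr_clustered_after WS pA lk0 r1) _.
  rewrite ler_wpM2r ?pr_ge0// ler_wpM2l//.
  have sl : 0 < Num.sqrt ((l - k)%:R : R) by rewrite sqrtr_gt0 ltr0n.
  apply: lerXn2r; rewrite ?nnegrE ?divr_ge0 ?mulr_ge0 ?(ltW r0) ?(ltW y0) ?(ltW sl)//.
  rewrite mulrCA ler_pM2l// ler_pdivlMr// mulrC ler_pdivrMr//.
  apply: (@le_trans _ _ (2 * side q.-1)); first by rewrite -{1}(prednK q0).
  by rewrite ler_pM2l// ler_wsqrtr// ler_nat kl.
rewrite sumr_const_nat sizeS -[leLHS]mulr_natl -{1}side_sqr.
have -> : (2 * (r / side q)) ^+ m = 2 ^+ m * ((r / side q) ^+ 2 * (r / side q) ^+ (m - 2)).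
  by rewrite exprMn -exprD subnKC// ltnW.
rewrite le_eqVlt; apply/orP; left; apply/eqP; field.
by rewrite !gt_eqF.
Qed.

(** The numerator is the constant of [pr_clustered_ge], with 2^-m because sqrt k is at most 2
    [side q] on block q. In the denominator 96 = 2 * 48 accounts for the two near blocks, and the
    outer 2 for the symmetry of the double sum. *)
Definition Cdown : R :=
  2^-1 ^+ K.+1 / (3 * lam) ^+ m / 2 ^+ m /
  (2 * (96 * (1 + Cbox) + Cbox * 2 ^+ m)).

Lemma Cdown_gt0 : 0 < Cdown.
Proof.
have C1 : 0 < 1 + Cbox by rewrite ltr_wpDr.
apply: divr_gt0; last first.
  by rewrite mulr_gt0// ltr_wpDr ?mulr_gt0// mulr_ge0// exprn_ge0.
by rewrite !divr_gt0 ?exprn_gt0// ?invr_gt0// mulr_gt0.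
Qed.

(* Second moment method for the weighted occupation time
   [sum_q (r q)^-2 * #{k in block q | clustered k (r q)}]. *)
Lemma pr_hit_blocks_ge (Q : seq nat) (r : nat -> R) :
  uniq Q -> (forall q, q \in Q -> 1 <= r q <= side q) ->
  1 <= \sum_(q <- Q) (r q / side q) ^+ (m - 2) ->
  Cdown <= pr [set w | exists q k, [/\ q \in Q, (2 ^ q <= k < 2 ^ q.+1)%N
    & clustered k (r q) w]].
Proof.
move=> uQ rQ; set s := \sum_(q <- Q) _ => s1.
set U := [set w | _].
pose I := [seq (q, k) | q <- Q, k <- block q].
pose c (p : nat * nat) := (r p.1) ^- 2.
pose A (p : nat * nat) := clustered p.2 (r p.1).
have c0 p : 0 <= c p by rewrite invr_ge0 sqr_ge0.
have mA p : measurable (A p) by exact: mclustered.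
have := second_moment P I c0 mA.
have UE : \bigcup_(i in [set` I]) A i = U.
  apply/seteqP; split => w.
    move=> [_ /= /allpairsPdep[q [k [qQ kq ->]]] cl]; exists q, k; split => //.
    by rewrite mem_index_iota in kq.
  move=> [q [k [qQ kq cl]]]; exists (q, k) => //=.
  by apply/allpairsPdep; exists q, k; rewrite mem_index_iota.
rewrite UE; set e := \sum_(i <- I) c i * pr (A i); set S := \sum_(i <- I) _.
(* Bound for the weighted number of later encounters given one: two near blocks, plus the far
   blocks, whose estimates add up to a multiple of s. *)
pose B := 48 * (1 + Cbox) * 2 + Cbox * 2 ^+ m * s.
have C1 : 0 < 1 + Cbox by rewrite ltr_wpDr.
have inner p : p \in I -> \sum_(p' <- I | (p.2 <= p'.2)%N) c p' * pr (A p `&` A p') <=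
    B * pr (A p).
  move=> /allpairsPdep[q [k [qQ]]]; rewrite mem_index_iota => /andP[qk kq] -> /=.
  have pA : <<s past k >> (A (q, k)) by exact: (clustered_past WS).
  rewrite big_mkcond big_allpairs_dep /=.
  under eq_bigr do rewrite -big_mkcond.
  apply: (@le_trans _ _ (\sum_(q' <- Q) (48 * (1 + Cbox) * ((q' == q)%:R + (q' == q.+1)%:R)
      + Cbox * 2 ^+ m * (r q' / side q') ^+ (m - 2)) * pr (A (q, k)))).
    rewrite big_seq [leRHS]big_seq; apply: ler_sum => q' q'Q.
    have /andP[r1 rs] := rQ _ q'Q.
    have f0 : 0 <= Cbox * 2 ^+ m * (r q' / side q') ^+ (m - 2).
      have rq0 : 0 <= r q' by exact: le_trans r1.
      apply: mulr_ge0; first by apply: mulr_ge0 => //; exact: exprn_ge0.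
      by apply: exprn_ge0; apply: divr_ge0 => //; exact: ltW.
    have [eq'|nq'] := boolP ((q' == q) || (q' == q.+1)).
      apply: (le_trans (pr_clustered_block_near q' pA r1)).
      rewrite ler_wpM2r ?pr_ge0// ler_wpDr// ler_peMr ?mulr_ge0 ?(ltW C1)//.
      by case/orP: eq' => /eqP ->; rewrite eqxx ?lerDl ?lerDr.
    (* An earlier block has no time l >= k, so its sum is empty. A block beyond q + 1 satisfies k <
       2^(q+1) <= 2^(q'-1), as the far estimate requires. *)
    have [q'q|q'q] := leqP q' q.
      rewrite big1_seq.
        apply: mulr_ge0; last exact: pr_ge0.
        by apply: addr_ge0 => //; rewrite mulr_ge0 ?addr_ge0 ?mulr_ge0 ?(ltW C1).
      move=> l /andP[kl]; rewrite mem_index_iota => /andP[_ lq].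
      move: nq'; rewrite negb_or => /andP[nq _].
      have : (q' < q)%N by rewrite ltn_neqAle nq.
      by rewrite -(leq_exp2l _ _ (ltnSn 1)) leqNgt (leq_ltn_trans qk (leq_ltn_trans kl lq)).
    have q'2 : (q.+2 <= q')%N.
      by move: nq'; rewrite negb_or (ltn_neqAle q.+1) (eq_sym q.+1) => /andP[_ ->].
    apply: (@le_trans _ _ (Cbox * 2 ^+ m * (r q' / side q') ^+ (m - 2) * pr (A (q, k)))).
      have kq' : (k <= 2 ^ q'.-1)%N.
        apply: (leq_trans (ltnW kq)); rewrite leq_exp2l//.
        by rewrite -(leq_add2r 1) !addn1 prednK// (leq_trans _ q'2).
      exact: (pr_clustered_block_far pA kq' (leq_trans (ltn0Sn _) q'2) r1).
    by rewrite ler_wpM2r ?pr_ge0// lerDr mulr_ge0 ?addr_ge0// mulr_ge0// ltW.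
  rewrite -mulr_suml ler_wpM2r ?pr_ge0// big_split /= -!mulr_sumr lerD2r.
  rewrite ler_pM2l ?mulr_gt0// big_split /= [leRHS](_ : 2 = 1 + 1)// lerD// sum_eq1//.
(* By symmetry it suffices to sum over pairs in order of time, which is where conditioning on the
   past applies; pairs at equal times are counted twice. *)
have S_le : S <= 2 * (B * e).
  apply: (@le_trans _ _ (2 * \sum_(p <- I) \sum_(p' <- I | (p.2 <= p'.2)%N)
      c p * c p' * pr (A p `&` A p'))).
    pose t p p' := c p * c p' * pr (A p `&` A p').
    have t0 p p' : 0 <= t p p' by rewrite mulr_ge0 ?pr_ge0// mulr_ge0.
    have tC p p' : t p p' = t p' p by rewrite /t [c p * _]mulrC setIC.
    rewrite mulr_natl mulr2n.
    have -> : \sum_(p <- I) \sum_(p' <- I | (p.2 <= p'.2)%N) t p p' =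
        \sum_(p <- I) \sum_(p' <- I | (p'.2 <= p.2)%N) t p p'.
      rewrite (exchange_big_dep xpredT)//=; apply: eq_bigr => p' _.
      by apply: eq_bigr => p _; exact: tC.
    rewrite -[X in _ <= X + _](_ : \sum_(p <- I) \sum_(p' <- I | (p.2 <= p'.2)%N) t p p' = _).
      rewrite -big_split /=; apply: ler_sum => p _.
      rewrite [X in _ <= X + _]big_mkcond [X in _ <= _ + X]big_mkcond.
      rewrite -big_split /=; apply: ler_sum => p' _.
      by case: (leqP p.2 p'.2) => [_|/ltnW ->]; rewrite ?add0r// lerDl; case: ifP.
    rewrite (exchange_big_dep xpredT)//=; apply: eq_bigr => p' _.
    by apply: eq_bigr => p _; exact: tC.
  rewrite ler_pM2l// mulr_sumr big_seq [leRHS]big_seq; apply: ler_sum => p pI.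
  under eq_bigr do rewrite -mulrA.
  by rewrite -mulr_sumr mulrCA ler_wpM2l//; exact: inner.
have e_ge : 2^-1 ^+ K.+1 / (3 * lam) ^+ m / 2 ^+ m * s <= e.
  rewrite /e big_allpairs_dep /= mulr_sumr big_seq [leRHS]big_seq.
  apply: ler_sum => q qQ; have /andP[r1 rs] := rQ _ qQ.
  have r0 : 0 < r q by exact: lt_le_trans r1.
  have y0 : 0 < r q / side q by rewrite divr_gt0.
  pose cl := 2^-1 ^+ K.+1 / (3 * lam) ^+ m.
  have cl0 : 0 <= cl.
    by rewrite divr_ge0 ?exprn_ge0 ?invr_ge0// mulr_ge0// ltW.
  apply: (@le_trans _ _ (\sum_(2 ^ q <= k < 2 ^ q.+1)
      r q ^- 2 * (cl * (2^-1 * (r q / side q)) ^+ m))).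
    rewrite sumr_const_nat sizeS -[leRHS]mulr_natl -{2}side_sqr [(2^-1 * _) ^+ m]exprMn -/cl.
    have -> : (r q / side q) ^+ m = (r q / side q) ^+ 2 * (r q / side q) ^+ (m - 2).
      by rewrite -exprD subnKC// ltnW.
    rewrite le_eqVlt; apply/orP; left; apply/eqP; rewrite exprVn.
    move: cl {cl0} => cl; by field; rewrite !gt_eqF// ?exprn_gt0.
  apply: ler_sum_nat => k /andP[qk kq]; rewrite ler_wpM2l ?invr_ge0 ?sqr_ge0//.
  have k0 : (0 < k)%N by apply: leq_trans qk; rewrite expn_gt0.
  have sk : side q <= Num.sqrt k%:R by rewrite ler_wsqrtr// ler_nat.
  apply: le_trans (pr_clustered_ge lam_ge1 d_gt0 WS k0 r1 (le_trans rs sk)).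
  rewrite ler_wpM2l//; apply: lerXn2r;
    rewrite ?nnegrE ?divr_ge0 ?mulr_ge0 ?(ltW r0) ?sqrtr_ge0 ?invr_ge0 ?(ltW y0)//.
  rewrite mulrCA ler_pM2l// -invfM lef_pV2 ?posrE ?mulr_gt0// ?sqrtr_gt0 ?ltr0n//.
  by apply: le_trans (sideS q); rewrite ler_wsqrtr// ler_nat ltnW.
have s0 : 0 < s by exact: lt_le_trans s1.
have c1 : 0 < 2^-1 ^+ K.+1 / (3 * lam) ^+ m / 2 ^+ m :> R.
  by rewrite !divr_gt0 ?exprn_gt0// ?invr_gt0// mulr_gt0.
have e0 : 0 < e by apply: lt_le_trans e_ge; rewrite mulr_gt0.
move=> h.
have {h S_le} le1 : e <= pr U * (2 * B).
  rewrite -(ler_pM2l e0) -expr2; apply: (le_trans h).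
  apply: le_trans (ler_wpM2l (pr_ge0 P U) S_le) _.
  by rewrite [leRHS]mulrCA ler_wpM2l ?pr_ge0// mulrA mulrC.
(* Here 1 <= s is used: the near contribution, which does not grow with s, is absorbed into a
   multiple of s. As e is also at least a multiple of s, the factor s cancels. *)
have BB : B <= (96 * (1 + Cbox) + Cbox * 2 ^+ m) * s.
  rewrite /B [leRHS]mulrDl lerD2r [leLHS](_ : _ = 96 * (1 + Cbox)); last by ring.
  by rewrite ler_peMr// mulr_ge0// ltW.
have D0 : 0 < 96 * (1 + Cbox) + Cbox * 2 ^+ m.
  by rewrite ltr_wpDr ?mulr_gt0// mulr_ge0// exprn_ge0.
rewrite /Cdown ler_pdivrMr ?mulr_gt0// -(ler_pM2r s0).
apply: (le_trans e_ge); apply: (le_trans le1).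
by rewrite -mulrA ler_wpM2l ?pr_ge0// -mulrA ler_pM2l.
Qed.

End blocks.

(** * The law of the simple random walk *)

Section laws.
Variables (R : realType) (d : nat).
Hypothesis d_gt0 : (0 < d)%N.

(* law n g is the expectation of g at the position of the simple random walk
   on Z^d after n steps, started at 0. *)
Fixpoint law n (g : 'rV[int]_d -> R) : R :=
  if n is n'.+1 then
    (2 * d%:R)^-1 * \sum_c (law n' (fun x => g (x + delta_mx ord0 c)) +
                            law n' (fun x => g (x - delta_mx ord0 c)))
  else g 0.

Fixpoint law1 n (g : int -> R) : R :=
  if n is n'.+1 then
    2^-1 * (law1 n' (fun x => g (x + 1)) + law1 n' (fun x => g (x - 1)))
  else g 0.

(** Expectation of [F] at the vector of counts when n steps choose their coordinate independently
    and uniformly. *)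
Fixpoint multinomial n (F : ('I_d -> nat) -> R) : R :=
  if n is n'.+1 then
    d%:R^-1 * \sum_c multinomial n' (fun N => F (fun c' => N c' + (c' == c))%N)
  else F (fun=> 0%N).

(** Expectation for the binomial law with n trials and success probability 1/d, the law of a single
    count. *)
Fixpoint binom n (g : nat -> R) : R :=
  if n is n'.+1 then
    d%:R^-1 * binom n' (fun k => g k.+1) + (1 - d%:R^-1) * binom n' g
  else g 0%N.

Let dR_gt0 : 0 < d%:R :> R. Proof. by rewrite ltr0n. Qed.

Let p_le1 : d%:R^-1 <= 1 :> R.
Proof. by rewrite invf_le1// ler1n. Qed.

Lemma law_le n g g' : (forall x, g x <= g' x) -> law n g <= law n g'.
Proof.
elim: n g g' => [|n IH] g g' gg' /=; first exact: gg'.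
rewrite ler_pM2l ?invr_gt0 ?mulr_gt0//.
by apply: ler_sum => c _; rewrite lerD// IH.
Qed.

Lemma law_ext n g g' : (forall x, g x = g' x) -> law n g = law n g'.
Proof. by move=> /funext ->. Qed.

Lemma lawZ n a g : law n (fun x => a * g x) = a * law n g.
Proof.
elim: n g => [//|n IH] g /=; under eq_bigr do rewrite !IH -mulrDr.
by rewrite -mulr_sumr mulrCA.
Qed.

(** The shift [y] makes the induction close: a step along coordinate c replaces y by y + 1 or y - 1,
    and the two squares add up to 2 y^2 + 2. For y = 0 this is the variance n / d. *)
Lemma law_coord_sqr n c (y : R) :
  law n (fun x => ((x ord0 c)%:~R + y) ^+ 2) = y ^+ 2 + n%:R / d%:R.
Proof.
elim: n y => [|n IH] y /=; first by rewrite mxE add0r mul0r addr0.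
have -> : \sum_i (law n (fun x => ((((x + delta_mx ord0 i) ord0 c)%:~R : R) + y) ^+ 2) +
      law n (fun x => ((((x - delta_mx ord0 i) ord0 c)%:~R : R) + y) ^+ 2)) =
    \sum_(i < d) (2 * (y ^+ 2 + n%:R / d%:R) + 2 * (i == c)%:R).
  apply: eq_bigr => i _.
  rewrite (@law_ext _ _ (fun x => ((x ord0 c)%:~R + (y + (i == c)%:R)) ^+ 2)); last first.
    by move=> x; rewrite !mxE eqxx /= intrD addrAC -addrA eq_sym; case: eqP.
  rewrite (@law_ext n (fun x => (((x - delta_mx ord0 i) ord0 c)%:~R + y) ^+ 2)
      (fun x => ((x ord0 c)%:~R + (y - (i == c)%:R)) ^+ 2)); last first.
    move=> x; rewrite !mxE eqxx /= intrB -addrA eq_sym [- _ + _]addrC.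
    by case: eqP.
  by rewrite !IH; case: eqP => _ /=; rewrite ?mulr1n ?mulr0n; ring.
rewrite big_split /= sumr_const card_ord -mulr_sumr (bigD1 c)//= eqxx big1 ?addr0; last first.
  by move=> i /negbTE ->.
rewrite -(mulr_natl (2 * _)) /= mulr1n -(natr1 n).
by field; rewrite gt_eqF.
Qed.

Lemma law1_le n g g' : (forall x, g x <= g' x) -> law1 n g <= law1 n g'.
Proof.
elim: n g g' => [|n IH] g g' gg' /=; first exact: gg'.
by rewrite ler_pM2l ?invr_gt0// lerD// IH.
Qed.

Lemma law1_sum n I (r : seq I) g :
  law1 n (fun x => \sum_(i <- r) g i x) = \sum_(i <- r) law1 n (g i).
Proof. by elim: n g => [//|n IH] g /=; rewrite !IH -big_split /= mulr_sumr. Qed.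

Lemma law1E n g : law1 n g =
  (2 ^+ n)^-1 * \sum_(0 <= j < n.+1) 'C(n, j)%:R * g (j%:Z + j%:Z - n%:Z).
Proof.
elim: n g => [|n IH] g /=.
  by rewrite expr0 invr1 mul1r big_nat1 bin0 mul1r.
rewrite !IH -mulrDr mulrA -invfM -exprS; congr (_ * _).
rewrite big_nat_recl//= bin0 mul1r.
have -> : \sum_(0 <= j < n.+1) 'C(n.+1, j.+1)%:R * g (j.+1%:Z + j.+1%:Z - n.+1%:Z) =
    \sum_(0 <= j < n.+1) 'C(n, j)%:R * g (j%:Z + j%:Z - n%:Z + 1) +
    \sum_(0 <= j < n.+1) 'C(n, j.+1)%:R * g (j.+1%:Z + j.+1%:Z - n%:Z - 1).
  rewrite -big_split /=; apply: eq_bigr => j _.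
  rewrite binS natrD mulrDl addrC; congr (_ * g _ + _ * g _); lia.
rewrite addrCA; congr (_ + _).
rewrite [in RHS]big_nat_recr//= bin_small// mul0r addr0.
rewrite [X in _ = _ + X]addr0 [in LHS]big_nat_recl//= bin0 mul1r; congr (g _ + _); lia.
Qed.

Lemma bin_half_max n j : ('C(n, j) <= 'C(n, n./2))%N.
Proof.
have up k i : (k <= i)%N -> (i.*2 <= n)%N -> ('C(n, k) <= 'C(n, i))%N.
  elim: i => [|i IH]; first by rewrite leqn0 => /eqP ->.
  rewrite leq_eqVlt => /predU1P[->//|]; rewrite ltnS => ki i2.
  apply: (leq_trans (IH ki _)); first by lia.
  rewrite -(leq_pmul2l (ltn0Sn i)) mul_bin_left leq_pmul2r ?bin_gt0; lia.
have [jn|nj] := leqP j n; last by rewrite bin_small.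
have [jn2|jn2] := leqP j n./2; first by apply: up => //; rewrite -[leqRHS]odd_double_half leq_addl.
rewrite -bin_sub//; apply: up; have := odd_double_half n; lia.
Qed.

(** Induction by (k+1) C(2k+2, k+1) = 2 (2k+1) C(2k, k) and (2k+1)(2k+3) <= (2k+2)^2. It replaces
    Stirling's formula. *)
Lemma central_bin k : ('C(k.*2, k) ^ 2 * k.*2.+1 <= 16 ^ k)%N.
Proof.
elim: k => [//|k IH].
have e : (k.+1 * 'C(k.+1.*2, k.+1) = 2 * k.*2.+1 * 'C(k.*2, k))%N.
  apply/eqP; rewrite -(eqn_pmul2l (ltn0Sn k)); apply/eqP.
  have e1 := mul_bin_diag k.+1.*2 k.
  have e2 := mul_bin_left k.*2.+1 k.
  have e3 := mul_bin_diag k.*2.+1 k.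
  have e4 := mul_bin_down k.*2.+1 k.
  rewrite doubleS /= in e1 e2 e4 *.
  have e5 : (k.*2.+1 - k = k.+1)%N by lia.
  rewrite e5 in e2 e4; nia.
have : (k.+1 ^ 2 * ('C(k.+1.*2, k.+1) ^ 2 * k.+1.*2.+1) <= k.+1 ^ 2 * 16 ^ k.+1)%N.
  rewrite mulnA -expnMn e [(16 ^ k.+1)%N]expnS doubleS.
  have : (4 * (k.*2.+1 * k.*2.+3) <= 16 * k.+1 ^ 2)%N by nia.
  move=> h; have := leq_mul h IH.
  rewrite (_ : (_ * (16 ^ k) = k.+1 ^ 2 * (16 * 16 ^ k))%N); last by lia.
  apply: leq_trans; rewrite leq_eqVlt; apply/orP; left; apply/eqP.
  by move: (k.*2) ('C(_, _)) => x b; ring.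
by rewrite leq_pmul2l.
Qed.

Lemma bin_le n j : ('C(n, j)%:R : R) <= 2 ^+ n / Num.sqrt n.+1%:R.
Proof.
have sq (x y z : nat) : (x ^ 2 * y <= z ^ 2)%N -> (0 < y)%N ->
    (x%:R : R) <= z%:R / Num.sqrt y%:R.
  move=> xyz y0; have sy : 0 < Num.sqrt (y%:R : R) by rewrite sqrtr_gt0 ltr0n.
  rewrite ler_pdivlMr// -ler_sqr ?nnegrE ?mulr_ge0 ?(ltW sy)//.
  by rewrite exprMn sqr_sqrtr ?ler0n// -!natrX -natrM ler_nat.
apply: (@le_trans _ _ 'C(n, n./2)%:R); first by rewrite ler_nat bin_half_max.
rewrite -natrX; apply: sq => //.
rewrite -expnM muln2; have := odd_double_half n; set k := n./2.
case: (odd n) => /= <-; last first.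
  rewrite add0n (leq_trans (central_bin k))// -[16%N]/(2 ^ 4)%N -expnM.
  by rewrite leq_exp2l//; lia.
(* The odd case reduces to the even one: the central coefficient of 2k + 2 is twice a middle
   coefficient of 2k + 1. *)
have e : ('C(k.+1.*2, k.+1) = 2 * 'C(1 + k.*2, k))%N.
  rewrite doubleS binS add1n -(bin_sub (_ : k.+1 <= k.*2.+1)%N); last by lia.
  by rewrite (_ : (k.*2.+1 - k.+1 = k)%N) ?addnn ?mul2n//; lia.
have := central_bin k.+1; rewrite e expnMn.
rewrite -[16%N]/(2 ^ 4)%N -expnM doubleS.
move: ('C(_, _)) => b; rewrite (_ : (4 * k.+1 = 2 + (1 + k.*2).*2)%N); last by lia.
rewrite expnD -mulnA leq_pmul2l// => /(leq_trans _); apply.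
by rewrite leq_mul2l; apply/orP; right; lia.
Qed.

(** At most one number j of upward steps satisfies 2 j - n = z, so only one binomial coefficient
    remains. *)
Lemma law1_point n (z : int) : law1 n (fun x => (x == z)%:R) <= (Num.sqrt n.+1%:R)^-1.
Proof.
rewrite law1E ler_pdivrMl ?exprn_gt0//.
apply: (@le_trans _ _ (\sum_(0 <= j < n.+1) 2 ^+ n / Num.sqrt n.+1%:R *
    (j%:Z + j%:Z - n%:Z == z)%:R)).
  by apply: ler_sum => j _; rewrite ler_wpM2r// bin_le.
rewrite -mulr_sumr ler_piMr ?divr_ge0 ?exprn_ge0 ?sqrtr_ge0//.
pose a (j : nat) := j%:Z + j%:Z - n%:Z == z.
rewrite -natr_sum (_ : (\sum_(0 <= j < n.+1) a j = count a (index_iota 0 n.+1))%N); last first.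
  by rewrite -sum1_count [RHS]big_mkcond /=; apply: eq_bigr => j _; case: (a j).
rewrite lern1 -size_filter.
set r := [seq x <- _ | _]; have ur : uniq r by rewrite filter_uniq ?iota_uniq.
have hr x y : x \in r -> y \in r -> x = y.
  by rewrite !mem_filter => /andP[/eqP ? _] /andP[/eqP ? _]; lia.
move: ur hr; case: r => [//|x [//|y r]] /= /andP[xr _] hr.
have xy : x = y by apply: hr; rewrite !inE eqxx ?orbT.
by rewrite xy mem_head in xr.
Qed.

(** The interval contains at most 2 rho + 1 integers, and this is at most 3 rho since rho >= 1. *)
Lemma law1_interval n (y rho : R) : 1 <= rho ->
  law1 n (fun x => (`|x%:~R - y| <= rho)%R%:R) <= 3 * rho / Num.sqrt n.+1%:R.
Proof.
move=> rho1; pose M := Num.truncn (2 * rho).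
have M_le : (M%:R : R) <= 2 * rho by rewrite Num.Theory.truncn_le; lra.
have M_gt : 2 * rho < (M.+1%:R : R) by exact: truncnS_gt.
pose z0 := Num.ceil (y - rho).
apply: (@le_trans _ _ (law1 n (fun x => \sum_(i < M.+1) (x == z0 + i%:Z)%:R))).
  apply: law1_le => x; have [|_] := boolP (`|_| <= _); last by rewrite sumr_ge0.
  rewrite ler_norml => /andP[x1 x2].
  have zx : z0 <= x by rewrite /z0 Num.Theory.ceil_le_int; lra.
  have xM : (`|x - z0|%N < M.+1)%N.
    rewrite -(ltr_nat R) [X in X < _]pmulrn gez0_abs ?subr_ge0//.
    apply: le_lt_trans M_gt; rewrite intrB.
    by have := Num.Theory.ceil_ge (y - rho); rewrite -/z0; lra.
  rewrite (bigD1 (Ordinal xM))//= gez0_abs ?subr_ge0// [z0 + (x - z0)]addrC subrK eqxx.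
  by rewrite lerDl sumr_ge0.
rewrite law1_sum; apply: (le_trans (ler_sum _ (fun i _ => law1_point n _))).
rewrite sumr_const card_ord -[leLHS]mulr_natl ler_wpM2r ?invr_ge0 ?sqrtr_ge0//.
by rewrite -natr1; lra.
Qed.

Lemma multinomial_le n F F' : (forall N, F N <= F' N) ->
  multinomial n F <= multinomial n F'.
Proof.
elim: n F F' => [|n IH] F F' FF' /=; first exact: FF'.
by rewrite ler_pM2l ?invr_gt0//; apply: ler_sum => c _; rewrite IH.
Qed.

Lemma multinomialZ n a F : multinomial n (fun N => a * F N) = a * multinomial n F.
Proof.
elim: n F => [//|n IH] F /=; under eq_bigr do rewrite IH.
by rewrite -mulr_sumr mulrCA.
Qed.

Lemma multinomial_sum n I (r : seq I) F :
  multinomial n (fun N => \sum_(i <- r) F i N) = \sum_(i <- r) multinomial n (F i).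
Proof.
elim: n F => [//|n IH] F /=; under eq_bigr do rewrite IH.
by rewrite exchange_big /= mulr_sumr.
Qed.

(* Sampling the directions first: the coordinates are then independent
   one-dimensional walks. *)
Lemma law_prod n (g : 'I_d -> int -> R) :
  law n (fun x => \prod_c g c (x ord0 c)) =
  multinomial n (fun N => \prod_c law1 (N c) (g c)).
Proof.
elim: n g => [|n IH] g /=; first by apply: eq_bigr => c _; rewrite mxE.
pose up c c' x := g c' (x + (c' == c)%:R); pose dn c c' x := g c' (x - (c' == c)%:R).
have -> : \sum_c (law n (fun x => \prod_c' g c' ((x + delta_mx ord0 c) ord0 c')) +
    law n (fun x => \prod_c' g c' ((x - delta_mx ord0 c) ord0 c'))) =
    \sum_c (multinomial n (fun N => \prod_c' law1 (N c') (up c c')) +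
      multinomial n (fun N => \prod_c' law1 (N c') (dn c c'))).
  by apply: eq_bigr => c _; rewrite -!IH; congr (_ + _); apply: law_ext => x;
    apply: eq_bigr => c' _; rewrite !mxE eqxx.
have step c : multinomial n (fun N => \prod_c' law1 (N c' + (c' == c)) (g c')) =
    2^-1 * (multinomial n (fun N => \prod_c' law1 (N c') (up c c')) +
      multinomial n (fun N => \prod_c' law1 (N c') (dn c c'))).
  have := multinomial_sum n [:: true; false] (fun b N =>
    2^-1 * \prod_c' law1 (N c') (if b then up c c' else dn c c')).
  rewrite !big_cons big_nil addr0 !multinomialZ -mulrDr => <-.
  congr multinomial; apply/funext => N; rewrite !big_cons big_nil addr0.
  have D1 (f : 'I_d -> R) : \prod_c' f c' = f c * \prod_(c' | c' != c) f c'.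
    by rewrite (bigD1 c).
  rewrite !D1 eqxx addn1 /=.
  have e (f : 'I_d -> int -> R) : (forall c', c' != c -> f c' = g c') ->
      \prod_(c' | c' != c) law1 (N c') (f c') = \prod_(c' | c' != c) law1 (N c' + (c' == c)) (g c').
    by move=> fg; apply: eq_bigr => c' cc'; rewrite fg// (negbTE cc') addn0.
  rewrite !e; last 2 first.
    by move=> c' /negbTE cc'; apply/funext => x; rewrite /dn cc' subr0.
    by move=> c' /negbTE cc'; apply/funext => x; rewrite /up cc' addr0.
  by rewrite /up /dn eqxx !mulrA -mulrDl -mulrDr.
under [in RHS]eq_bigr do rewrite step.
by rewrite -mulr_sumr invfM mulrA [_^-1 * _^-1]mulrC.
Qed.

Lemma multinomial_coord n c (f : nat -> R) :
  multinomial n (fun N => f (N c)) = binom n f.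
Proof.
elim: n f => [//|n IH] f /=; rewrite (bigD1 c)//= eqxx.
under [fun N : 'I_d -> nat => f (N c + true)%N]eq_fun do rewrite addn1.
rewrite (IH (fun k => f k.+1)).
have -> : \sum_(i | i != c) multinomial n (fun N => f (N c + (c == i))%N) =
    \sum_(i < d | i != c) binom n f.
  by apply: eq_bigr => i ic; rewrite eq_sym (negbTE ic) -IH; congr multinomial;
    apply/funext => N; rewrite addn0.
rewrite sumr_const (_ : #|_| = d.-1); last by have := cardC1 c; rewrite card_ord.
rewrite mulrDr; congr (_ + _); rewrite -[binom n f *+ _]mulr_natl mulrA; congr (_ * _).
by rewrite -subn1 natrB// mulrBr mulVf ?mulr1// gt_eqF.
Qed.

Lemma binom_le n f f' : (forall k, f k <= f' k) -> binom n f <= binom n f'.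
Proof.
elim: n f f' => [|n IH] f f' ff' /=; first exact: ff'.
apply: lerD; apply: ler_wpM2l; rewrite ?invr_ge0 ?subr_ge0//; exact: IH.
Qed.

Lemma binomD n f f' : binom n (fun k => f k + f' k) = binom n f + binom n f'.
Proof. by elim: n f f' => [//|n IH] f f' /=; rewrite !IH; ring. Qed.

Lemma binomZ n a f : binom n (fun k => a * f k) = a * binom n f.
Proof. by elim: n f => [//|n IH] f /=; rewrite !IH; ring. Qed.

Lemma binom_cst n a : binom n (fun=> a) = a.
Proof. by elim: n => [//|n IH] /=; rewrite !IH; ring. Qed.

(** Size biasing of the binomial law: a factor k is traded for (n + 1) / d and a shift of the
    argument. *)
Lemma binom_size_bias n h :
  binom n.+1 (fun k => k%:R * h k) = n.+1%:R / d%:R * binom n (fun k => h k.+1).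
Proof.
elim: n h => [|n IH] h; first by rewrite /=; ring.
have -> : binom n.+2 (fun k => k%:R * h k) =
    d%:R^-1 * binom n.+1 (fun k => k.+1%:R * h k.+1) +
    (1 - d%:R^-1) * binom n.+1 (fun k => k%:R * h k) by [].
rewrite (IH h).
have -> : binom n.+1 (fun k => k.+1%:R * h k.+1) =
    binom n.+1 (fun k => k%:R * h k.+1) + binom n.+1 (fun k => h k.+1).
  by rewrite -binomD; congr binom; apply/funext => k; rewrite -natr1 mulrDl mul1r.
rewrite (IH (fun k => h k.+1)) /= -[n.+2%:R]natr1; ring.
Qed.

(** Inverse moments by repeated size biasing. Rising products rather than powers occur because each
    trade shifts the argument by one, and then cancels exactly one factor. *)
Lemma binom_inv_rising n i :
  binom n (fun k => \prod_(j < i) (k.+1 + j)%:R^-1) <= (n.+1%:R / d%:R) ^- i.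
Proof.
elim: i n => [|i IH] n.
  by rewrite expr0 invr1 -[leRHS](binom_cst n); apply: binom_le => k; rewrite big_ord0.
pose h k : R := \prod_(j < i.+1) (k + j)%:R^-1.
have n0 : 0 < n.+1%:R / d%:R :> R by rewrite divr_gt0.
have -> : binom n (fun k => \prod_(j < i.+1) (k.+1 + j)%:R^-1) =
    (n.+1%:R / d%:R)^-1 * binom n.+1 (fun k => k%:R * h k).
  by rewrite binom_size_bias mulKf// gt_eqF.
rewrite exprS [leRHS]invfM ler_pM2l ?invr_gt0//.
apply: (@le_trans _ _ (binom n.+1 (fun k => \prod_(j < i) (k.+1 + j)%:R^-1))).
  apply: binom_le => k; rewrite /h big_ord_recl addn0.
  have [->|k0] := posnP k; first by rewrite mul0r prodr_ge0// => j _; rewrite invr_ge0.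
  rewrite mulrA divff ?mul1r ?pnatr_eq0 -?lt0n//.
  by apply: ler_prod => j _; rewrite lift0 addnS -addSn lexx andbT invr_ge0.
apply: (le_trans (IH _)); rewrite lef_pV2 ?posrE ?exprn_gt0 ?divr_gt0//.
apply: lerXn2r; rewrite ?nnegrE ?divr_ge0//.
by rewrite ler_pM2r ?invr_gt0// ler_nat.
Qed.

(** Each factor satisfies k + 1 + j <= (j + 1)(k + 1), hence the factorial. *)
Lemma binom_inv_pow n i :
  binom n (fun k => k.+1%:R ^- i) <= i`!%:R * (n.+1%:R / d%:R) ^- i.
Proof.
apply: le_trans (ler_wpM2l (ler0n _ _) (binom_inv_rising n i)).
rewrite -binomZ; apply: binom_le => k.
rewrite -[X in X * _](_ : \prod_(j < i) j.+1%:R = i`!%:R); last first.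
  by rewrite -natr_prod; congr (_%:R); rewrite fact_prod big_add1 big_mkord.
rewrite -big_split /= -exprVn -[X in _ ^+ X]card_ord -prodr_const.
apply: ler_prod => j _; rewrite invr_ge0 ler0n /= ler_pdivlMr ?ltr0n ?addSn//.
rewrite ler_pdivrMl ?ltr0n// -natrM ler_nat; lia.
Qed.

(** 3^d comes from the interval bound in each coordinate, d from the sum over coordinates, and the
    last factor from the two terms of the AM-GM step. *)
Definition Cwalk : R := 3 ^+ d * d%:R * (d`!%:R * d%:R ^+ d + 1).

(* [prod_c u_c <= sum_c u_c^d], and [u^d] is bounded through its square by AM-GM. *)
Lemma law_box n (y : 'I_d -> R) rho : (0 < n)%N -> 1 <= rho ->
  law n (fun x => \prod_c (`|(x ord0 c)%:~R - y c| <= rho)%R%:R) <=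
  Cwalk * (rho / Num.sqrt n%:R) ^+ d.
Proof.
move=> n0 rho1; rewrite (law_prod n (fun c x => (`|x%:~R - y c| <= rho)%R%:R)).
have rho0 : 0 < rho by exact: lt_le_trans rho1.
pose u (k : nat) : R := (Num.sqrt k.+1%:R)^-1.
have u0 k : 0 < u k by rewrite invr_gt0 sqrtr_gt0 ltr0n.
set s := Num.sqrt n%:R.
have s0 : 0 < s by rewrite sqrtr_gt0 ltr0n.
apply: (@le_trans _ _ (multinomial n (fun N => (3 * rho) ^+ d *
    \sum_c u (N c) ^+ d))).
  apply: multinomial_le => N.
  apply: (@le_trans _ _ (\prod_(c < d) (3 * rho * u (N c)))).
    apply: ler_prod => c _; rewrite law1_interval// andbT.
    rewrite -[leLHS](_ : law1 (N c) (fun=> 0) = 0).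
      by apply: law1_le => x.
    by elim: (N c) => [//|k IH] /=; rewrite IH addr0 mulr0.
  rewrite big_split /= prodr_const card_ord ler_pM2l ?exprn_gt0 ?mulr_gt0//.
  pose c0 : 'I_d := Ordinal d_gt0.
  pose cm := [arg max_(c > c0) u (N c)]%O.
  have cmP c : u (N c) <= u (N cm).
    by rewrite /cm; case: arg_maxP => // i _; exact.
  apply: (@le_trans _ _ (\prod_(c < d) u (N cm))).
    by apply: ler_prod => c _; rewrite cmP ltW.
  rewrite prodr_const card_ord (bigD1 cm)//= lerDl sumr_ge0// => c _.
  by rewrite exprn_ge0// ltW.
rewrite multinomialZ multinomial_sum.
under eq_bigr do rewrite (multinomial_coord n _ (fun k => u k ^+ d)).
rewrite sumr_const card_ord.
have key : binom n (fun k => u k ^+ d) <= (d`!%:R * d%:R ^+ d + 1) / s ^+ d.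
  (* For odd d, u^d is a half-integer power of k + 1, whereas [binom_inv_pow] treats integer powers;
     v <= s^d v^2 + s^-d passes to the square, and both terms have the expected size s^-d. *)
  apply: (@le_trans _ _ (binom n (fun k => s ^+ d * k.+1%:R ^- d + s ^- d))).
    apply: binom_le => k.
    have -> : k.+1%:R ^- d = (u k ^+ d) ^+ 2.
      by rewrite -exprM mulnC exprM /u exprVn sqr_sqrtr ?ler0n// exprVn.
    have sd0 : 0 < s ^+ d by rewrite exprn_gt0.
    have ud0 : 0 < u k ^+ d by rewrite exprn_gt0.
    rewrite -(ler_pM2l sd0) mulrDr divff ?gt_eqF//.
    move: (s ^+ d) (u k ^+ d) sd0 ud0 => a b a0 b0.
    have : 0 <= (a * b - 1) ^+ 2 + a * b by rewrite addr_ge0 ?sqr_ge0 ?mulr_ge0 ?ltW.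
    move=> h; rewrite -subr_ge0; apply: le_trans h _; rewrite le_eqVlt; apply/orP; left; apply/eqP; ring.
  rewrite binomD binom_cst binomZ mulrDl mul1r lerD2r.
  apply: (le_trans (ler_wpM2l (exprn_ge0 _ (ltW s0)) (binom_inv_pow n d))).
  rewrite mulrCA -mulrA ler_wpM2l// exprMn exprVn invfM invrK.
  rewrite mulrA mulrC ler_pM2l ?exprn_gt0//.
  rewrite -[leRHS]mul1r -ler_pdivrMr ?invr_gt0 ?exprn_gt0// invrK.
  rewrite mulrAC ler_pdivrMr ?exprn_gt0// mul1r -exprMn -expr2.
  rewrite sqr_sqrtr ?ler0n//; apply: lerXn2r; rewrite ?nnegrE ?ler0n//.
  by rewrite ler_nat.
rewrite -[X in _ * X]mulr_natl.
apply: (le_trans (ler_wpM2l _ (ler_wpM2l (ler0n _ d) key))).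
  by rewrite exprn_ge0// mulr_ge0// ltW.
rewrite /Cwalk !exprMn exprVn le_eqVlt; apply/orP; left; apply/eqP; field.
by rewrite gt_eqF// exprn_gt0.
Qed.

End laws.

(** * Probabilities of walk events in terms of the recursive law *)

Section srw.
Context (disp : measure_display) (T : measurableType disp) (R : realType).
Variable P : probability T R.
Variable d : nat.
Hypothesis d_gt0 : (0 < d)%N.
Variable X : nat -> T -> 'rV[int]_d.
Hypothesis mX : forall k (B : set 'rV[int]_d), measurable (X k @^-1` B).
Hypothesis indX : mutually_independent P
  (fun k : nat => preimage_set_system setT (X k) setT).
Hypothesis stepX : forall k (i : 'I_d),
  P (X k @^-1` [set delta_mx ord0 i]) = ((2 * d%:R)^-1)%:E /\
  P (X k @^-1` [set - delta_mx ord0 i]) = ((2 * d%:R)^-1)%:E.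
Local Notation pr := (pr P).

Let unit_step (p : 'I_d * bool) : 'rV[int]_d :=
  if p.2 then delta_mx ord0 p.1 else - delta_mx ord0 p.1.

Let unit_step_inj : injective unit_step.
Proof.
move=> [c b] [c' b'] /rowP/(_ c); rewrite /unit_step /=.
by case: b; case: b'; rewrite !mxE eqxx /=; case: eqP => [->|_].
Qed.

Let pr_step k p : pr (X k @^-1` [set unit_step p]) = (2 * d%:R)^-1.
Proof.
by have [h1 h2] := stepX k p.1; rewrite /pr /unit_step; case: p.2; rewrite ?h1 ?h2.
Qed.

Let walk k n w : 'rV[int]_d := \sum_(l < n) X (k + l)%N w.

Let walk_sigma k n (B : set 'rV[int]_d) :
  <<s \bigcup_(l in [set l | (l < k + n)%N]) preimage_set_system setT (X l) setT >>
  (walk k n @^-1` B).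
Proof.
set H := \bigcup_(_ in _) _.
suff : measurable (walk k n @^-1` B : set (g_sigma_algebraType H)) by [].
have : forall m, (m <= n)%N -> forall B : set 'rV[int]_d,
    measurable (walk k m @^-1` B : set (g_sigma_algebraType H)).
  elim=> [_ B'|m IH mn B'].
    have -> : walk k 0 @^-1` B' = [set w | B' 0] :> set T.
      by apply/seteqP; split => w; rewrite /walk /preimage /= big_ord0.
    have [B0|B0] := pselect (B' 0).
      rewrite (_ : mkset _ = setT); first exact: measurableT.
      by apply/seteqP; split.
    rewrite (_ : mkset _ = set0); first exact: measurable0.
    by apply/seteqP; split.
  (* The state space is countable and discrete, so the event splits over the values of the partial
     sum and of the last step. *)
  have -> : walk k m.+1 @^-1` B' = [set w | exists p : 'rV[int]_d * 'rV[int]_d,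
      B' (p.1 + p.2) /\ (walk k m w = p.1 /\ X (k + m) w = p.2)] :> set T.
    apply/seteqP; split => w; rewrite /preimage /= /walk big_ord_recr /=.
      by move=> h; exists (walk k m w, X (k + m) w).
    by move=> [[x y] /= [h [e1 e2]]]; rewrite e1 e2.
  apply: (@measurable_ex _ (g_sigma_algebraType H)) => p.
  apply: (@measurable_andl _ (g_sigma_algebraType H)).
  apply: (@measurableI _ (g_sigma_algebraType H)).
    exact: (IH (ltnW mn) [set p.1]).
  apply: sub_gen_smallest; exists (k + m)%N; first by rewrite /= ltn_add2l.
  by exists [set p.2] => //; rewrite setTI.
exact.
Qed.

Let walk_step_indep k n (B B' : set 'rV[int]_d) :
  pr (walk k n @^-1` B `&` X (k + n) @^-1` B') =
  pr (walk k n @^-1` B) * pr (X (k + n) @^-1` B').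
Proof.
have mG i : preimage_set_system setT (X i) setT `<=` measurable.
  by move=> _ [D _ <-]; rewrite setTI; exact: mX.
have sG i : sigma_algebra setT (preimage_set_system setT (X i) setT).
  by apply: sigma_algebra_preimage; split.
have ind := @independent_group _ _ _ P _ _ (fun l => l < k + n)%N _
  sG mG indX.
pose A b := if b then walk k n @^-1` B else X (k + n) @^-1` B'.
have := ind [:: true; false] A isT.
have s1 := @walk_sigma k n B.
have s2 : <<s \bigcup_(i in [set i | (i < k + n)%N = false])
    preimage_set_system setT (X i) setT >> (X (k + n) @^-1` B').
  apply: sub_gen_smallest; exists (k + n)%N; first by rewrite /= ltnn.
  by exists B' => //; rewrite setTI.
rewrite !bigcap_setI_seq (_ : [set` [::]] = set0); last by apply/seteqP; split.
rewrite bigcap_set0 setIT !big_cons big_nil mule1 => h.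
have mw : measurable (walk k n @^-1` B).
  move: s1; apply: smallest_sub; first exact: sigma_algebra_measurable.
  by move=> D [i _]; exact: mG.
rewrite /pr -fineM ?fin_num_measure//; congr fine; apply: h.
by move=> [] _ //; exact: s2.
Qed.

Lemma pr_walk k n (B : set 'rV[int]_d) : pr (walk k n @^-1` B) = law n (\1_B).
Proof.
have mw m B' : measurable (walk k m @^-1` B').
  move: (@walk_sigma k m B'); apply: smallest_sub; first exact: sigma_algebra_measurable.
  by move=> D [i _ [D' _ <-]]; rewrite setTI; exact: mX.
elim: n B => [|n IH] B /=.
  rewrite indicE; have -> : walk k 0 @^-1` B = [set w | B 0].
    by apply/seteqP; split => w; rewrite /walk /preimage /= big_ord0.
  have [B0|B0] := pselect (B 0).
    rewrite mem_set// (_ : mkset _ = setT) ?pr_setT//.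
    by apply/seteqP; split.
  rewrite memNset// (_ : mkset _ = set0) ?pr_set0//.
  by apply/seteqP; split.
pose D p := X (k + n) @^-1` [set unit_step p].
have mD p : measurable (D p) by exact: mX.
have dD p q : p != q -> D p `&` D q = set0.
  move=> pq; apply/seteqP; split => // w [/= h1 h2].
  by move/eqP: pq; apply; apply: unit_step_inj; rewrite -h1 -h2.
(* The 2 d unit steps exhaust the total mass, so all other values of the step have probability zero
   and can be discarded. *)
have U1 : pr (\bigcup_(p in [set` index_enum ('I_d * bool)%type]) D p) = 1.
  rewrite -pr_sum_disjoint ?index_enum_uniq//.
  under eq_bigr do rewrite pr_step.
  rewrite sumr_const card_prod card_ord card_bool -[LHS]mulr_natr natrM mulrC [2 * _]mulrC.
  by rewrite divff// mulf_neq0 ?pnatr_eq0 -?lt0n.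
set U := \bigcup_(_ in _) _ in U1.
have mU : measurable U by exact: bigcup_seq_measurable.
rewrite (pr_setID P (mw _ _) mU) [X in _ + X](_ : _ = 0) ?addr0; last first.
  apply/eqP; rewrite eq_le pr_ge0 andbT.
  have <- : pr (~` U) = 0 by rewrite pr_setC// U1 subrr.
  by apply: pr_mono; [exact: measurableD|exact: measurableC|move=> w []].
rewrite setI_bigcupr -pr_sum_disjoint ?index_enum_uniq//; last 2 first.
  by move=> p; exact: measurableI.
  by move=> p q /dD pq; rewrite setIACA pq setI0.
have step p : pr (walk k n.+1 @^-1` B `&` D p) =
    (2 * d%:R)^-1 * law n (fun x => \1_B (x + unit_step p)).
  have -> : walk k n.+1 @^-1` B `&` D p =
      walk k n @^-1` [set x | B (x + unit_step p)] `&` D p.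
    apply/seteqP; split => w; rewrite /D /preimage /= /walk big_ord_recr /=.
      by move=> [h wp]; rewrite wp in h.
    by move=> [h wp]; rewrite wp.
  rewrite walk_step_indep pr_step mulrC IH; congr (_ * _).
rewrite (eq_bigr _ (fun p _ => step p)).
rewrite -mulr_sumr; congr (_ * _).
rewrite (eq_bigr (fun p => law n (fun x => \1_B (x + unit_step (p.1, p.2)))))//.
rewrite -(pair_bigA _ (fun c b => law n (fun x => \1_B (x + unit_step (c, b))))) /=.
by apply: eq_bigr => c _; rewrite big_bool.
Qed.

Lemma pr_walk_box k n (y : 'I_d -> R) rho : (0 < n)%N -> 1 <= rho ->
  pr [set w | forall c, `|(walk k n w ord0 c)%:~R - y c| <= rho] <=
  Cwalk R d * (rho / Num.sqrt n%:R) ^+ d.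
Proof.
move=> n0 rho1; apply: le_trans (law_box d_gt0 y n0 rho1).
rewrite (pr_walk k n [set x | forall c, `|(x ord0 c)%:~R - y c| <= rho]).
apply: (law_le d_gt0) => x; rewrite indicE.
have [/set_mem/= h|] := boolP (_ \in _); last by rewrite prodr_ge0.
by rewrite big1// => c _; rewrite h.
Qed.

(** Chebyshev's inequality, the variance n / d being at most n. *)
Lemma pr_walk_tail k n c (lam : R) : (0 < n)%N -> 0 < lam ->
  pr [set w | lam * Num.sqrt n%:R < `|(walk k n w ord0 c)%:~R|] <= lam ^- 2.
Proof.
move=> n0 lam0; have s0 : 0 < Num.sqrt n%:R :> R by rewrite sqrtr_gt0 ltr0n.
set s := Num.sqrt n%:R; have ls : 0 < lam * s by rewrite mulr_gt0.
rewrite (pr_walk k n [set x | lam * s < `|(x ord0 c)%:~R|]).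
apply: (@le_trans _ _ (law n (fun x => (lam * s) ^- 2 * ((x ord0 c)%:~R + 0) ^+ 2))).
  apply: (law_le d_gt0) => x; rewrite indicE.
  have [/set_mem/= h|] := boolP (_ \in _); last first.
    by rewrite mulr_ge0 ?sqr_ge0// invr_ge0 sqr_ge0.
  rewrite ler_pdivlMl ?exprn_gt0// mulr1 addr0 -[leRHS]real_normK ?num_real//.
  by apply: lerXn2r; rewrite ?nnegrE ?(ltW ls) ?normr_ge0// ltW.
rewrite lawZ// law_coord_sqr// expr0n add0r exprMn sqr_sqrtr ?ler0n// invfM.
have d0 : 0 < d%:R :> R by rewrite ltr0n.
rewrite [leLHS](_ : _ = lam ^- 2 * d%:R^-1); last first.
  by field; rewrite !gt_eqF// ltr0n.
by rewrite ler_piMr ?invr_ge0 ?sqr_ge0// invf_le1// ler1n.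
Qed.

End srw.

(** * Random walks as walkers with independent increments *)

Section walks.
Context (disp : measure_display) (T : measurableType disp) (R : realType).
Variable P : probability T R.
Variables K d : nat.
Hypothesis d_gt0 : (0 < d)%N.

(** Chebyshev gives the tail lam^-2, which is at most lam^-1 for lam >= 1; hence lam = 2 (K + 1) d
    meets the level of [ws_tail]. Independence of the walks and of the steps of each walk are glued
    by [independent_ungroup]. *)
Lemma random_walk_system (S : 'I_K.+1 -> nat -> T -> 'rV[int]_d) :
  independent_random_walks P S ->
  exists xi G, walk_system P (Cwalk R d) (2 * (K.+1 * d)%:R) xi G /\
    forall n i c w, travel xi 0 n i c w = (S i n w ord0 c)%:~R.
Proof.
move=> [srwS indS].
have /choice[X hX] : forall i, exists X : nat -> T -> 'rV[int]_d,
    [/\ forall k (B : set 'rV[int]_d), measurable (X k @^-1` B),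
      mutually_independent P (fun k : nat => preimage_set_system setT (X k) setT),
      forall k (i : 'I_d),
        P (X k @^-1` [set delta_mx ord0 i]) = ((2 * d%:R)^-1)%:E /\
        P (X k @^-1` [set - delta_mx ord0 i]) = ((2 * d%:R)^-1)%:E
    & forall n w, S i n w = \sum_(k < n) X k w].
  by move=> i; have [X hX] := srwS i; exists X.
pose xi l i (c : 'I_d) w : R := (X i l w ord0 c)%:~R.
pose G (x : nat * 'I_K.+1) := preimage_set_system setT (X x.2 x.1) setT.
have tr k n i c w : travel xi k n i c w = ((\sum_(l < n) X i (k + l)%N w) ord0 c)%:~R.
  by rewrite summxE rmorph_sum.
exists xi, G; split; last first.
  move=> n i c w; have [_ _ _ ->] := hX i; rewrite tr.
  by under eq_bigr do rewrite add0n.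
have mG x : G x `<=` measurable.
  by have [mX _ _ _] := hX x.2; move=> _ [B _ <-]; rewrite setTI; exact: mX.
split => //.
- by move=> x; apply: sigma_algebra_preimage; split.
- pose H i := process_sigma [set: nat] [set: set 'rV[int]_d] (S i).
  apply: (@independent_ungroup _ _ _ P _ _ snd G H) => //.
  + move=> [l i] _ [B _ <-] /=; rewrite setTI.
    suff : measurable (X i l @^-1` B : set (g_sigma_algebraType
      (\bigcup_(t in [set: nat]) preimage_set_system setT (S i t) [set: set 'rV[int]_d]))) by [].
    (* The independence of the walks is stated for positions, so each step is recovered as a
       difference of two successive positions. *)
    have -> : X i l @^-1` B = [set w | exists p : 'rV[int]_d * 'rV[int]_d,
        B (p.2 - p.1) /\ (S i l w = p.1 /\ S i l.+1 w = p.2)].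
      have [_ _ _ SX] := hX i.
      apply/seteqP; split => w; rewrite /preimage /=.
        move=> h; exists (S i l w, S i l.+1 w); split => //=.
        by rewrite !SX big_ord_recr /= addrAC subrr add0r.
      move=> [[x y] /= [h [e1 e2]]]; move: h.
      by rewrite -e1 -e2 !SX big_ord_recr /= addrAC subrr add0r.
    apply: (@measurable_ex _ (g_sigma_algebraType _)) => p.
    apply: (@measurable_andl _ (g_sigma_algebraType _)).
    apply: (@measurableI _ (g_sigma_algebraType _)).
      by apply: sub_gen_smallest; exists l => //; exists [set p.1] => //; rewrite setTI.
    by apply: sub_gen_smallest; exists l.+1 => //; exists [set p.2] => //; rewrite setTI.
  + by move=> i; exact: (@measurableT _ (g_sigma_algebraType _)).
  + by move=> i A B; exact: (@measurableI _ (g_sigma_algebraType _)).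
  + move=> i J A uJ hJ.
    have [_ indX _ _] := hX i.
    have uJ1 : uniq (map fst J).
      rewrite map_inj_in_uniq// => [[l j] [l' j'] /hJ/= [-> _] /hJ/= [-> _] -> //].
    have := indX (map fst J) (fun l => A (l, i)) uJ1.
    have JE x : x \in J -> x = (x.1, i) by case: x => l j /hJ[/= ->].
    rewrite big_map => h; rewrite (eq_big_seq (fun x => P (A (x.1, i)))); last first.
      by move=> x /JE {1}->.
    rewrite -h.
      congr (P _); apply/seteqP; split => w hw.
        by move=> l /= /mapP[x xJ ->]; rewrite -JE//; exact: hw.
      by move=> x /= xJ; rewrite (JE x xJ); apply: hw => /=; exact: map_f.
    by move=> l /mapP[x xJ ->]; have [_] := hJ x xJ; rewrite {1 2}(JE x xJ).
- move=> l i c B mB; exists [set x : 'rV[int]_d | B (x ord0 c)%:~R] => //.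
  by rewrite setTI.
- move=> k n i x rho n0 rho1; have [mX indX sX _] := hX i.
  apply: le_trans (pr_walk_box d_gt0 mX indX sX k x n0 rho1).
  rewrite le_eqVlt; apply/orP; left; apply/eqP; congr (pr P _).
  by apply/seteqP; split => w h c; have := h c; rewrite tr.
- move=> k n i c n0; have [mX indX sX _] := hX i.
  pose lam : R := 2 * (K.+1 * d)%:R.
  have lam1 : 1 <= lam.
    by rewrite -[leLHS]mul1r /lam ler_pM// ?ler1n// muln_gt0.
  have lam0 : 0 < lam by exact: lt_le_trans lam1.
  rewrite (_ : mkset _ = [set w | lam * Num.sqrt n%:R <
    `|((\sum_(l < n) X i (k + l)%N w) ord0 c)%:~R| :> R]); last first.
    by apply/seteqP; split => w; rewrite /= tr.
  apply: le_trans (pr_walk_tail d_gt0 mX indX sX k c n0 lam0) _.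
  rewrite lef_pV2 ?posrE ?exprn_gt0//.
  by rewrite expr2 ler_peMl// ltW.
- move=> n i i' B mB.
  have [mX indX sX _] := hX i; have [mX' indX' sX' _] := hX i'.
  have e j : [set w | forall c, B c (travel xi 0 n j c w)] =
      (fun w => \sum_(l < n) X j (0 + l)%N w) @^-1`
      [set x : 'rV[int]_d | forall c, B c (x ord0 c)%:~R].
    by apply/seteqP; split => w h c; have := h c; rewrite tr.
  by rewrite !e (pr_walk d_gt0 mX indX sX 0) (pr_walk d_gt0 mX' indX' sX' 0).
Qed.

End walks.

(** * Wiener processes *)

Section normal.
Variable R : realType.
Notation mu := (@lebesgue_measure R).

(** The density never exceeds its peak 1 / (s sqrt (2 pi)), which is at most 1 / s. *)
Lemma normal_prob_itv_le (s a b : R) : 0 < s -> a <= b ->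
  fine (normal_prob 0 s `[a, b]) <= (b - a) / s.
Proof.
move=> s0 ab; have sn : s != 0 by rewrite gt_eqF.
have fn : normal_prob 0 s `[a, b] \is a fin_num.
  by apply: (fin_num_measure (normal_prob 0 s)).
rewrite -lee_fin fineK//.
apply: (@le_trans _ _ (\int[mu]_(x in `[a, b]) (normal_peak s)%:E)%E).
  apply: ge0_le_integral => //=.
  - by move=> x _; rewrite lee_fin normal_pdf_ge0.
  - by apply/measurable_funTS/measurable_EFinP; exact: measurable_normal_pdf.
  - by move=> x _; rewrite lee_fin normal_pdf_ub.
rewrite integral_cst//= lebesgue_measure_itv/= lte_fin.
case: ifPn => [_|_]; last by rewrite mule0 lee_fin divr_ge0// ?subr_ge0// ltW.
rewrite -EFinB -EFinM lee_fin mulrC ler_wpM2l ?subr_ge0//.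
rewrite /normal_peak lef_pV2 ?posrE//; last first.
  by rewrite sqrtr_gt0 mulrn_wgt0// mulr_gt0 ?pi_gt0// exprn_gt0.
rewrite -[leLHS](ger0_norm (ltW s0)) -sqrtr_sqr ler_wsqrtr//.
rewrite -mulrnAr ler_peMr ?sqr_ge0// -[leLHS]mulr1n.
have p2 : 2 <= pi :> R by exact: pi_ge2.
by rewrite mulr1n -mulr_natr; lra.
Qed.

Lemma normal_prob_scale (s lam : R) : 0 < s -> 0 <= lam ->
  normal_prob 0 s `[- (lam * s), lam * s] = normal_prob 0 1 `[- lam, lam].
Proof.
move=> s0 l0; have sn : s != 0 by rewrite gt_eqF.
rewrite /normal_prob.
pose F (x : R) := s * x.
have dF x : derivable F x 1 by [].
have F' : F^`()%classic = cst s.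
  apply/funext => x; rewrite derive1E /F deriveM// derive_cst derive_id.
  by rewrite scaler0 addr0 /GRing.scale/= mulr1.
rewrite -mulNr [- lam * s]mulrC [lam * s]mulrC -/(F (- lam)) -/(F lam).
rewrite integration_by_substitution_increasing.
- apply: eq_integral => x _; congr EFin; rewrite F' /= /F.
  rewrite !normal_pdfE ?oner_eq0//.
  change (normal_peak s * normal_fun 0 s (s * x) * s = normal_peak 1 * normal_fun 0 1 x).
  rewrite /normal_peak /normal_fun !subr0 expr1n mul1r.
  have -> : Num.sqrt (s ^+ 2 * pi *+ 2) = s * Num.sqrt (pi *+ 2).
    by rewrite -mulrnAr sqrtrM ?sqr_ge0// sqrtr_sqr ger0_norm// ltW.
  have -> : - (s * x) ^+ 2 / (s ^+ 2 *+ 2) = - x ^+ 2 / (1 *+ 2) :> R.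
    by field.
  have pp : Num.sqrt (pi *+ 2) != 0 :> R.
    by rewrite gt_eqF// sqrtr_gt0 mulrn_wgt0// pi_gt0.
  by move: (expR _) => e; field; apply/andP.
- by rewrite (@le_trans _ _ 0)// oppr_le0.
- by move=> x y _ _ xy; rewrite /F ltr_pM2l.
- by rewrite F' => x _; exact: cvg_cst.
- by rewrite F'; exact: is_cvg_cst.
- by rewrite F'; exact: is_cvg_cst.
- split.
  + by move=> x _; exact: dF.
  + by apply: cvg_at_right_filter; apply: cvgM; [exact: cvg_cst|exact: cvg_id].
  + by apply: cvg_at_left_filter; apply: cvgM; [exact: cvg_cst|exact: cvg_id].
- by apply: continuous_subspaceT; exact: continuous_normal_pdf.
Qed.

(** For s = 1, continuity from above along the complements of growing intervals; scaling makes the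
    same [lam] serve all s. *)
Lemma normal_prob_tail (eps : R) : 0 < eps -> exists2 lam, 1 <= lam &
  forall s : R, 0 < s -> fine (normal_prob 0 s [set x | lam * s < `|x|]) <= eps.
Proof.
move=> e0; pose A (n : nat) : set R := ~` `[- n.+1%:R, n.+1%:R].
have mA n : measurable (A n) by exact: measurableC.
have : normal_prob 0 1 (A n) @[n --> \oo] --> normal_prob 0 (1 : R) (\bigcap_n A n).
  apply: (nonincreasing_cvg_mu (mu := normal_prob 0 (1 : R))) => //.
  - exact: le_lt_trans (probability_le1 (normal_prob 0 (1 : R)) (mA 0%N)) (ltry 1).
  - by apply: bigcap_measurable => // k _; exact: mA.
  - move=> n m nm; apply/subsetPset; apply: subsetC => x /=; rewrite !in_itv /=.
    have nm' : (n.+1%:R : R) <= m.+1%:R by rewrite ler_nat ltnS.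
    by move=> /andP[h1 h2]; rewrite (le_trans _ h1) ?lerN2// (le_trans h2).
have -> : \bigcap_n A n = set0.
  apply/seteqP; split => // x /(_ (Num.truncn `|x|) I); apply.
  by rewrite /= in_itv /= -ler_norml ltW// truncnS_gt.
rewrite measure0 => /fine_cvgP[_] /cvgr0_norm_le /(_ _ e0) [N _ /(_ N (leqnn N))] h.
exists N.+1%:R; first by rewrite ler1n.
move=> s s0; set B := mkset _.
have -> : B = ~` `[- (N.+1%:R * s), N.+1%:R * s].
  apply/seteqP; split => x; rewrite /= in_itv /= -ler_norml.
    by rewrite /B /= ltNge => /negP.
  by move=> /negP; rewrite -ltNge.
have mI a b : measurable (`[a, b] : set R) by exact: measurable_itv.
pose I (x : R) := `[- x, x]%classic.
have E (t x : R) : normal_prob 0 t (~` I x) = (1 - normal_prob 0 t (I x))%E.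
  exact: (probability_setC (normal_prob 0 t) (mI _ _)).
rewrite -/(I _) E /I normal_prob_scale//; move: h; rewrite /= /A -/(I _) E.
by move=> /(le_trans (ler_norm _)).
Qed.

End normal.

(** * Sampled Wiener processes as walkers with independent increments *)

Section wieners.
Context (disp : measure_display) (T : measurableType disp) (R : realType).
Variable P : probability T R.
Local Notation pr := (pr P).

(** The two-level form of ungrouping; it is applied to coordinates over times, then to walkers over
    coordinates. *)
Lemma independent_pair (L I : eqType) (G : L * I -> set (set T))
    (H : L -> set (set T)) :
  (forall b x, G (b, x) `<=` H b) -> (forall b, sigma_algebra setT (H b)) ->
  mutually_independent P H ->
  (forall b, mutually_independent P (fun x => G (b, x))) ->
  mutually_independent P G.
Proof.
move=> GH sH indH indG.
have HT b : H b setT by have [H0 HC _] := sH b; rewrite -(setD0 setT); exact: HC.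
apply: (@independent_ungroup _ _ _ P _ _ fst G H) => //.
- by move=> [b x]; exact: GH.
- move=> b; have := sigma_algebra_id (sH b) => <-.
  by move=> A B; exact: (@measurableI _ (g_sigma_algebraType (H b))).
move=> b J A uJ hJ.
have JE x : x \in J -> x = (b, x.2) by case: x => b' x /hJ[/= ->].
have uJ2 : uniq (map snd J).
  by rewrite map_inj_in_uniq// => x y /JE -> /JE -> /= ->.
have := indG b (map snd J) (fun x => A (b, x)) uJ2.
rewrite big_map => h; rewrite (eq_big_seq (fun x => P (A (b, x.2)))); last first.
  by move=> x /JE {1}->.
rewrite -h.
  congr (P _); apply/seteqP; split => w hw.
    by move=> _ /= /mapP[x xJ ->]; rewrite -JE//; exact: hw.
  by move=> x /= xJ; rewrite (JE x xJ); apply: hw => /=; exact: map_f.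
by move=> _ /mapP[x xJ ->]; have [_] := hJ x xJ; rewrite {1 2}(JE x xJ).
Qed.

Variables K d : nat.
Variable W : 'I_K.+1 -> R -> T -> 'rV[R]_d.
Hypothesis WW : independent_wiener_vecs P W.

(** Division by sqrt delta gives the steps variance 1, so that no constant depends on the mesh. *)
Definition wiener_step (delta : R) l (i : 'I_K.+1) (c : 'I_d) w : R :=
  (W i (l.+1%:R * delta) w ord0 c - W i (l%:R * delta) w ord0 c) / Num.sqrt delta.

(** The coordinates are independent normal variables, and each falls in an interval of length 2 rho
    with probability at most 2 rho / sqrt n; hence the constant 2^d. *)
Lemma wiener_step_system (lam delta : R) : 0 < delta ->
  (forall s : R, 0 < s -> fine (normal_prob 0 s [set x | lam * s < `|x|]) <=
    (2 * (K.+1 * d)%:R)^-1) ->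
  exists G, walk_system P (2 ^+ d) lam (wiener_step delta) G.
Proof.
move=> de0 lamP; set xi := wiener_step delta.
have sd0 : 0 < Num.sqrt delta by rewrite sqrtr_gt0.
have [WV indW] := WW.
pose V i c t w := W i t w ord0 c.
have wV i c : wiener P (V i c) by have [h _] := WV i; exact: h.
have mV i c t : 0 <= t -> measurable_fun setT (V i c t) by have [h _ _ _ _] := wV i c; exact: h.
pose t l : R := l%:R * delta.
have t_ge0 l : 0 <= t l by rewrite mulr_ge0// ltW.
have t_homo : {homo t : i j / (i <= j)%N >-> i <= j}.
  by move=> i j ij; rewrite ler_pM2r// ler_nat.
pose inc i c l := preimage_set_system setT (V i c (t l.+1) \- V i c (t l)) measurable.
have tr k n i c w : travel xi k n i c w = (V i c (t (k + n)%N) w - V i c (t k) w) / Num.sqrt delta.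
  rewrite /travel; elim: n => [|n IH]; first by rewrite big_ord0 addn0 subrr mul0r.
  by rewrite big_ord_recr /= IH /xi /wiener_step -mulrDl addnS addrC subrKA.
have sub_sigma i c l (H : set (set T)) :
    (forall s B, 0 <= s -> measurable B -> <<s H >> (V i c s @^-1` B)) ->
    inc i c l `<=` <<s H >>.
  move=> hH _ [B mB <-].
  suff : measurable_fun setT ((V i c (t l.+1) \- V i c (t l)) : g_sigma_algebraType H -> R).
    by apply.
  by apply: measurable_funB => _ D mD; rewrite setTI; exact: hH.
have ind_inc i c : mutually_independent P (inc i c).
  move=> J A uJ hJ; have [_ _ ind _ _] := wV i c.
  (* The independence of increments is stated for finitely many consecutive times; n is chosen
     beyond every index in [J]. *)
  pose n := (\max_(l <- J) l).+1.
  have Jn l : l \in J -> (l < n)%N by move=> lJ; rewrite ltnS; exact: leq_bigmax_seq.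
  have ioE l : l \in J -> nat_of_ord (inord l : 'I_n) = l by move=> /Jn; exact: inordK.
  pose J' : seq 'I_n := map inord J.
  have uJ' : uniq J'.
    by rewrite map_inj_in_uniq// => x y /ioE xE /ioE yE xy; rewrite -xE -yE xy.
  have := ind n t (t_ge0 0%N) t_homo J' (fun l => A l) uJ'.
  rewrite big_map => h; rewrite (eq_big_seq (fun l => P (A (inord l : 'I_n)))); last first.
    by move=> l /ioE ->.
  rewrite -h; last by move=> _ /mapP[l lJ ->]; rewrite ioE//; exact: hJ.
  congr (P _); apply/seteqP; split => w hw.
    by move=> _ /= /mapP[l lJ ->]; rewrite ioE//; exact: hw.
  by move=> l lJ; have := hw (inord l) (map_f _ lJ); rewrite ioE.
have ind_i i : mutually_independent P (fun x : 'I_d * nat => inc i x.1 x.2).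
  have [_ ind] := WV i.
  apply: (independent_pair (G := fun x : 'I_d * nat => inc i x.1 x.2) _ _ ind).
  - move=> c l; apply: sub_sigma => s B s0 mB.
    by apply: sub_gen_smallest; exists s => //; exists B => //; rewrite setTI.
  - by move=> c; exact: smallest_sigma_algebra.
  - by move=> c; exact: ind_inc.
have ind_all : mutually_independent P
    (fun x : 'I_K.+1 * ('I_d * nat) => inc x.1 x.2.1 x.2.2).
  apply: (independent_pair (G := fun x : 'I_K.+1 * ('I_d * nat) => inc x.1 x.2.1 x.2.2) _ _ indW).
  - move=> i [c l]; apply: sub_sigma => s B s0 mB.
    by apply: sub_gen_smallest; exists (s, c) => //; exists B => //; rewrite setTI.
  - by move=> i; exact: smallest_sigma_algebra.
  - by move=> i; exact: ind_i.
have s_inc (x : 'I_K.+1 * ('I_d * nat)) : sigma_algebra setT (inc x.1 x.2.1 x.2.2).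
  apply: sigma_algebra_preimage; exact: sigma_algebra_measurable.
have m_inc (x : 'I_K.+1 * ('I_d * nat)) : inc x.1 x.2.1 x.2.2 `<=` measurable.
  move=> _ [B mB <-]; rewrite setTI -[X in measurable X]setTI.
  by apply: measurable_funB => //; exact: mV.
(* Independence is now known for the triples of walker, coordinate and time; merging the coordinates
   gives one sigma-algebra per time and walker, as [walk_system] requires. *)
pose lab (x : 'I_K.+1 * ('I_d * nat)) := (x.2.2, x.1).
pose G b := <<s \bigcup_(x in [set x | lab x = b]) inc x.1 x.2.1 x.2.2 >>.
have tr_pre k n i c (B : set R) : travel xi k n i c @^-1` B =
    (V i c (t (k + n)%N) \- V i c (t k)) @^-1` [set x | B (x / Num.sqrt delta)].
  by apply/seteqP; split => w; rewrite /preimage /= tr.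
have mscale (B : set R) : measurable B -> measurable [set x | B (x / Num.sqrt delta)].
  move=> mB; rewrite -[X in measurable X]setTI.
  apply: (_ : measurable_fun setT (fun x : R => x / Num.sqrt delta)) => //.
  exact: measurable_funM.
have pr_tr k n i c (B : set R) : (0 < n)%N -> measurable B ->
    pr (travel xi k n i c @^-1` B) =
    fine (normal_prob 0 (Num.sqrt n%:R * Num.sqrt delta) [set x | B (x / Num.sqrt delta)]).
  move=> n0 mB; have [_ _ _ h _] := wV i c.
  rewrite tr_pre /pr h//; last 2 first.
    by rewrite ltr_pM2r// ltr_nat -[X in (X < _)%N]addn0 ltn_add2l.
    exact: mscale.
  congr (fine (normal_prob _ _ _)); rewrite -mulrBl natrD addrAC subrr add0r.
  by rewrite sqrtrM.
have pr_all k n i (B : 'I_d -> set R) : (forall c, measurable (B c)) ->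
    pr [set w | forall c, B c (travel xi k n i c w)] =
    \prod_c pr (travel xi k n i c @^-1` B c).
  move=> mB; have [_ ind] := WV i.
  have := ind (index_enum 'I_d) (fun c => travel xi k n i c @^-1` B c) (index_enum_uniq _).
  have mtr c : measurable (travel xi k n i c @^-1` B c).
    rewrite tr_pre -[X in measurable X]setTI.
    by apply: measurable_funB => //; [exact: mV|exact: mV|exact: mscale].
  rewrite pr_prod// => h.
  rewrite -[RHS]/(fine (_%:E)) -h; last first.
    move=> c _; rewrite tr_pre -[X in process_sigma _ _ _ X]setTI.
    rewrite /process_sigma; set H := \bigcup_(_ in _) _.
    suff : measurable_fun setT ((V i c (t (k + n)%N) \- V i c (t k)) : g_sigma_algebraType H -> R).
      by apply => //; exact: mscale.
    apply: measurable_funB => _ D mD; rewrite setTI.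
      by apply: sub_gen_smallest; exists (t (k + n)%N); [exact: t_ge0|exists D] => //; rewrite setTI.
    by apply: sub_gen_smallest; exists (t k); [exact: t_ge0|exists D] => //; rewrite setTI.
  congr (fine (P _)); apply/seteqP; split => w h' c; first by move=> _; exact: h'.
  by apply: h'; rewrite /= mem_index_enum.
have mball (x rho : R) : measurable [set y : R | `|y - x| <= rho].
  apply: (@measurable_le_const _ (measurableTypeR R) R (fun y => `|y - x|)).
  by apply: measurableT_comp => //; exact: measurable_funB.
have mfar (z : R) : measurable [set y : R | z < `|y|].
  apply: (@measurable_gt_const _ (measurableTypeR R) R (fun y => `|y|)).
  exact: measurableT_comp.
exists G; split.
- by move=> b; exact: smallest_sigma_algebra.
- move=> b; apply: smallest_sub; first exact: sigma_algebra_measurable.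
  by move=> A [x _]; exact: m_inc.
- exact: (independent_group s_inc m_inc ind_all).
- move=> l i c B mB; apply: sub_gen_smallest; exists (i, (c, l)) => //.
  exists [set x | B (x / Num.sqrt delta)]; first exact: mscale.
  by rewrite setTI.
- move=> k n i x rho n0 rho1; rewrite (pr_all k n i (fun c => [set y | `|y - x c| <= rho])).
    rewrite -exprMn -[X in _ ^+ X]card_ord -prodr_const.
    apply: ler_prod => c _; rewrite pr_ge0 /= pr_tr//.
    have sn : 0 < Num.sqrt (n%:R : R) by rewrite sqrtr_gt0 ltr0n.
    have -> : [set y | [set z | `|z - x c| <= rho] (y / Num.sqrt delta)] =
        `[(x c - rho) * Num.sqrt delta, (x c + rho) * Num.sqrt delta]%classic.
      apply/seteqP; split => y; rewrite /= in_itv /= ler_distl.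
        by rewrite ler_pdivlMr// ler_pdivrMr.
      by rewrite ler_pdivlMr// ler_pdivrMr.
    apply: (le_trans (normal_prob_itv_le _ _)).
    - by rewrite mulr_gt0.
    - by rewrite ler_pM2r//; lra.
    - by rewrite le_eqVlt; apply/orP; left; apply/eqP; field; rewrite !gt_eqF.
  by move=> c; exact: mball.
- move=> k n i c n0.
  have sn : 0 < Num.sqrt (n%:R : R) by rewrite sqrtr_gt0 ltr0n.
  rewrite (_ : mkset _ = travel xi k n i c @^-1` [set y | lam * Num.sqrt n%:R < `|y|])//.
  rewrite pr_tr//; apply: le_trans (lamP _ (mulr_gt0 sn sd0)).
  rewrite le_eqVlt; apply/orP; left; apply/eqP; congr (fine (normal_prob _ _ _)).
  apply/seteqP; split => y; rewrite /= normrM normfV (ger0_norm (ltW sd0));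
    by rewrite ltr_pdivlMr// mulrA.
- move=> n i i' B mB; rewrite !pr_all//; apply: eq_bigr => c _.
  have [->|n0] := posnP n.
    by congr pr; apply/seteqP; split => w; rewrite /preimage /= !travel0.
  by rewrite !pr_tr.
Qed.

End wieners.

(** * The integral test *)

Section block_series.
Variable R : realType.

Lemma nneseries_bounded (u : nat -> R) m : (forall n, 0 <= u n) ->
  (\sum_(m <= n <oo) (u n)%:E < +oo)%E <->
  exists B, forall N, \sum_(m <= n < N) u n <= B.
Proof.
move=> u0; have s0 : (0 <= \sum_(m <= n <oo) (u n)%:E)%E.
  by apply: nneseries_ge0 => n _ _; rewrite lee_fin.
split=> [oo|[B hB]].
  exists (fine (\sum_(m <= n <oo) (u n)%:E)%E) => N.
  rewrite -lee_fin fineK ?ge0_fin_numE// -sumEFin.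
  by apply: nneseries_lim_ge => n _ _; rewrite lee_fin.
apply: (@le_lt_trans _ _ B%:E); last exact: ltry.
apply: lime_le; first by apply: is_cvg_nneseries => n _ _; rewrite lee_fin.
by apply: nearW => N; rewrite sumEFin lee_fin.
Qed.

Local Notation side n := (Num.sqrt (2 ^ n)%:R : R).

Lemma side_gt0 n : 0 < side n.
Proof. by rewrite sqrtr_gt0 ltr0n expn_gt0. Qed.

Lemma side_sqr n : side n ^+ 2 = (2 ^ n)%:R.
Proof. by rewrite sqr_sqrtr// ler0n. Qed.

(** The rational 3/4 exceeds 1 / sqrt 2, which gives a geometric series with rational ratio. *)
Lemma side_inv_le n : (side n)^-1 <= (3 / 4) ^+ n.
Proof.
elim: n => [|n IH]; first by rewrite expn0 sqrtr1 invr1 expr0.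
have h : 4 / 3 * side n <= side n.+1.
  rewrite -ler_sqr ?nnegrE ?mulr_ge0 ?(ltW (side_gt0 _))// exprMn !side_sqr.
  rewrite expnS natrM; have : 0 <= (2 ^ n)%:R :> R by rewrite ler0n.
  by move: (_%:R) => x x0; lra.
apply: (@le_trans _ _ (3 / 4 * (side n)^-1)).
  rewrite -[X in X * _]invrK -invfM lef_pV2 ?posrE ?side_gt0 ?mulr_gt0 ?side_gt0//.
  by apply: le_trans h; rewrite le_eqVlt; apply/orP; left; apply/eqP; field.
by rewrite exprS ler_pM2l.
Qed.

Lemma side_ge1 n : 1 <= side n.
Proof. by rewrite -[leLHS]sqrtr1 ler_wsqrtr// ler1n expn_gt0. Qed.

Lemma sum_side_inv_le N M : \sum_(N <= n < M) (side n)^-1 <= 4.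
Proof.
have geo k : \sum_(0 <= n < k) (3 / 4 : R) ^+ n = 4 - 4 * (3 / 4) ^+ k.
  elim: k => [|k IH]; first by rewrite big_nil expr0; ring.
  by rewrite big_nat_recr//= IH exprS; field.
have [NM|MN] := leqP N M; last by rewrite big_geq// ltnW.
apply: (@le_trans _ _ (\sum_(0 <= n < M) (3 / 4 : R) ^+ n)); last first.
  by rewrite geo lerBlDr lerDl mulr_ge0// exprn_ge0.
apply: (@le_trans _ _ (\sum_(N <= n < M) (3 / 4 : R) ^+ n)).
  by apply: ler_sum => n _; exact: side_inv_le.
by apply: ler_sum_nat_sub => // n; exact: exprn_ge0.
Qed.

Lemma side_inv_pow_le n p : (0 < p)%N -> (side n)^-1 ^+ p <= (side n)^-1.
Proof.
move=> p0; rewrite -[leRHS]expr1 ler_wiXn2l// ?invr_ge0 ?(ltW (side_gt0 n))//.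
by rewrite invf_le1 ?side_gt0 ?side_ge1.
Qed.

Lemma maxr_pow_le (x y : R) p : 0 <= x -> 0 <= y ->
  Num.max x y ^+ p <= x ^+ p + y ^+ p.
Proof.
move=> x0 y0; have [_|_] := leP x y; first by rewrite lerDr exprn_ge0.
by rewrite lerDl exprn_ge0.
Qed.

(* The blocks whose radius [side n * min (al n.+1) 1 / D] is less than 1
   contribute a convergent series. *)
Lemma series_large_radius (al : nat -> R) (D : R) p N (B : R) :
  (forall n, 0 <= al n) -> (forall n m, (n <= m)%N -> al m <= al n) ->
  (0 < p)%N -> 0 < D ->
  (forall M, \sum_(N <= n < M | 1 <= side n * (Num.min (al n.+1) 1 / D))
     (Num.min (al n.+1) 1 / D) ^+ p <= B) ->
  exists B', forall M, \sum_(1 <= n < M) al n ^+ p <= B'.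
Proof.
move=> al0 al_dec p0 D0 hB; pose y n := Num.min (al n.+1) 1 / D.
have y0 n : 0 <= y n by rewrite divr_ge0 ?(ltW D0)// le_min al0 ler01.
(* A block of radius below 1 has y n < 1 / side n, and these terms sum to at most 4. *)
have small M : \sum_(N <= n < M) y n ^+ p <= B + 4.
  rewrite (bigID (fun n => 1 <= side n * y n)) /= lerD// ?hB//.
  apply: le_trans (sum_side_inv_le N M).
  rewrite big_mkcond; apply: ler_sum => n _; case: ifPn => [|_]; last first.
    by rewrite invr_ge0 ltW// side_gt0.
  rewrite -ltNge => yn; apply: le_trans (side_inv_pow_le n p0).
  apply: lerXn2r; rewrite ?nnegrE ?invr_ge0 ?(ltW (side_gt0 n))//.
  by rewrite -[leRHS]mul1r ler_pdivlMr ?side_gt0// mulrC ltW.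
have minE M : \sum_(N <= n < M) Num.min (al n.+1) 1 ^+ p <= D ^+ p * (B + 4).
  apply: le_trans (ler_wpM2l (exprn_ge0 _ (ltW D0)) (small M)).
  rewrite mulr_sumr; apply: ler_sum => n _.
  by rewrite -exprMn mulrC divfK// gt_eqF.
(* The truncation at 1 must become inactive: otherwise every term beyond N would be 1 and the
   partial sums would be unbounded. *)
have [n1 aln1] : exists n1, (N <= n1)%N /\ al n1.+1 < 1.
  apply: contrapT => h.
  have big n : (N <= n)%N -> Num.min (al n.+1) 1 = 1.
    move=> Nn; apply/min_idPr; rewrite leNgt; apply/negP => ?; apply: h.
    by exists n.
  have := minE (N + (Num.truncn (D ^+ p * (B + 4))).+1)%N.
  rewrite (eq_big_nat _ _ (F2 := fun=> 1)); last first.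
    by move=> n /andP[Nn _]; rewrite big// expr1n.
  rewrite sumr_const_nat addKn; apply/negP; rewrite -ltNge; exact: truncnS_gt.
case: aln1 => Nn1 aln1.
exists (\sum_(1 <= n < n1.+1) al n ^+ p + D ^+ p * (B + 4)) => M.
have alp n : 0 <= al n ^+ p by exact: exprn_ge0.
have [Mn|nM] := leqP M n1.+1.
  rewrite (@le_trans _ _ (\sum_(1 <= n < n1.+1) al n ^+ p))//.
    have [M1|M1] := leqP 1 M; last by rewrite big_geq ?sumr_ge0// ltnW.
    exact: ler_sum_nat_sub.
  by rewrite lerDl (le_trans _ (minE N))// big_geq.
rewrite (big_cat_nat (ltn0Sn n1) (ltnW nM)) /= lerD2l.
apply: le_trans (minE M).
apply: (@le_trans _ _ (\sum_(n1 <= n < M.-1) Num.min (al n.+1) 1 ^+ p)).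
  rewrite -(prednK (leq_ltn_trans (leq0n _) nM)) big_add1 /=.
  apply: ler_sum_nat => n /andP[n1n _]; rewrite (min_idPl _)//.
  by apply: ltW; apply: le_lt_trans aln1; exact: al_dec.
apply: ler_sum_nat_sub => //; [|lia|lia].
by move=> n; rewrite exprn_ge0// le_min al0 ler01.
Qed.

End block_series.

(** * Euclidean diameter against coordinatewise distances *)

Section distances.
Variables (R : realType) (d K : nat).
Implicit Types x : 'I_K -> 'rV[R]_d.

Lemma coord_le_enorm (y : 'rV[R]_d) c : `|y ord0 c| <= enorm y.
Proof.
rewrite -sqrtr_sqr /enorm ler_wsqrtr// (bigD1 c)//= lerDl sumr_ge0// => j _.
exact: sqr_ge0.
Qed.

Lemma max_dist_ge0 x : 0 <= max_dist x.
Proof. by rewrite /max_dist; elim/big_rec: _ => // p z _ z0; rewrite le_max z0 orbT. Qed.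

Lemma coord_le_max_dist x i i' c : `|x i ord0 c - x i' ord0 c| <= max_dist x.
Proof.
have [->|ii'] := eqVneq i i'; first by rewrite subrr normr0 max_dist_ge0.
have := coord_le_enorm (x i - x i') c; rewrite !mxE => /le_trans; apply.
exact: (@le_bigmax_cond _ R _ _ (i, i') (fun p => p.1 != p.2)
  (fun p => enorm (x p.1 - x p.2)) ii').
Qed.

(** The sum of squares gives the factor sqrt d; the cruder d avoids a square root. *)
Lemma max_dist_le x (rho : R) : 0 <= rho ->
  (forall i i' c, `|x i ord0 c - x i' ord0 c| <= rho) ->
  max_dist x <= d%:R * rho.
Proof.
move=> rho0 h; rewrite /max_dist; apply: bigmax_le; first by rewrite mulr_ge0.
move=> [i i'] /= _; rewrite /enorm.
rewrite -[leRHS](ger0_norm (mulr_ge0 (ler0n _ d) rho0)) -sqrtr_sqr ler_wsqrtr//.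
apply: (@le_trans _ _ (\sum_(j < d) rho ^+ 2)).
  apply: ler_sum => j _; rewrite -[leLHS]real_normK ?num_real//.
  by apply: lerXn2r; rewrite ?nnegrE// !mxE.
rewrite sumr_const card_ord exprMn -[leLHS]mulr_natl ler_wpM2r ?sqr_ge0//.
by rewrite -natrX ler_nat; case: d => // n; rewrite leq_pmulr.
Qed.

End distances.

Section ae.
Context (disp : measure_display) (T : measurableType disp) (R : realType).
Variable P : probability T R.
Local Notation pr := (pr P).

Lemma ae_not_lim_sup_set (E : nat -> set T) (B : R) :
  (forall n, measurable (E n)) ->
  (forall N, \sum_(0 <= n < N) pr (E n) <= B) ->
  {ae P, forall w, ~ lim_sup_set E w}.
Proof.
move=> mE hB; have mL : measurable (lim_sup_set E).
  by apply: bigcap_measurable => // n _; exact: bigcup_measurable.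
have h : P (lim_sup_set E) = 0.
  apply: lim_sup_set_cvg0 => //.
  rewrite (eq_eseriesr (g := fun n => (pr (E n))%:E)); last by move=> n _; exact: prE.
  by apply/nneseries_bounded; [move=> n; exact: pr_ge0|exists B].
apply: (negligibleS _ (iffRL (negligibleP _ mL) h)).
by move=> w /= /contrapT.
Qed.

(** Continuity from above along the tail unions; it takes the place of a second Borel-Cantelli
    lemma. *)
Lemma pr_lim_sup_set_ge (E : nat -> set T) (c : R) :
  (forall n, measurable (E n)) ->
  (forall n, c <= pr (\bigcup_(k >= n) E k)) ->
  c <= pr (lim_sup_set E).
Proof.
move=> mE hc; have mL : measurable (lim_sup_set E).
  by apply: bigcap_measurable => // n _; exact: bigcup_measurable.
have mU n : measurable (\bigcup_(k >= n) E k) by exact: bigcup_measurable.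
have cv := @lim_sup_set_cvg _ _ _ P E mE
  (le_lt_trans (probability_le1 P (mU 0%N)) (ltry 1)).
rewrite -lee_fin -prE// -(cvg_lim _ cv)//; apply: lime_ge.
  by apply/cvg_ex; exists (P (lim_sup_set E)).
by apply: nearW => n; have := hc n; rewrite -lee_fin -prE.
Qed.

Lemma ae_absurd (A : set T) : measurable A -> 0 < pr A ->
  {ae P, forall w, ~ A w} -> False.
Proof.
move=> mA A0 h; have /(negligibleP _ mA) : P.-negligible A.
  by apply: negligibleS h => w wA /=; exact.
by move=> PA; move: A0; rewrite /pr PA ltxx.
Qed.

End ae.

(** * Dyadic radii for the two halves of the test *)

Section sharp.
Context (disp : measure_display) (T : measurableType disp) (R : realType).
Variable P : probability T R.
Variables (K d : nat) (C0 lam : R).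
Local Notation pr := (pr P).
Hypothesis C0_ge0 : 0 <= C0.
Hypothesis lam_ge1 : 1 <= lam.
Hypothesis d_gt0 : (0 < d)%N.
Local Notation m := (K * d)%N.
Hypothesis m_ge3 : (3 <= m)%N.
Variable a : R -> R.
Hypothesis a_ge0 : forall t, 0 < t -> 0 <= a t.
Hypothesis a_dec : forall s t, 0 < s -> s <= t -> a t <= a s.
Local Notation side n := (Num.sqrt (2 ^ n)%:R : R).
Local Notation al n := (a (2 ^+ n)).

Let two_gt0 n : 0 < 2 ^+ n :> R. Proof. by rewrite exprn_gt0. Qed.

Let al_ge0 n : 0 <= al n. Proof. by rewrite a_ge0. Qed.

Let al_dec n l : (n <= l)%N -> al l <= al n.
Proof. by move=> nl; rewrite a_dec// ler_weXn2l// ler1n. Qed.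

(* Along integer times the walkers already meet too often. *)
Lemma lower_class_series (xi : nat -> 'I_K.+1 -> 'I_d -> T -> R)
    (G : nat * 'I_K.+1 -> set (set T)) (Y : nat -> T -> R) :
  walk_system P C0 lam xi G ->
  {ae P, forall w, forall k (rho : R), 0 <= rho -> clustered xi k rho w -> Y k w <= d%:R * rho} ->
  {ae P, forall w, exists N, forall k, (N < k)%N -> Num.sqrt k%:R * a k%:R < Y k w} ->
  exists B, forall M, \sum_(1 <= n < M) al n ^+ (m - 2) <= B.
Proof.
move=> WS HY HL; apply: contrapT => nB.
have d0 : 0 < d%:R :> R by rewrite ltr0n.
have p0 : (0 < m - 2)%N by rewrite subn_gt0.
(* The index n + 1 makes the radius at most sqrt t a(t) on the whole block, [a] being nonincreasing;
   the minimum with 1 keeps it below [side n], as the second moment bound requires; d converts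
   coordinates to the Euclidean norm. *)
pose y n := Num.min (al n.+1) 1 / d%:R.
have y0 n : 0 <= y n by rewrite divr_ge0// le_min al_ge0 ler01.
have y1 n : y n <= 1.
  by rewrite ler_pdivrMr// mul1r ge_min (ler1n _ d) d_gt0 orbT.
have big N : exists M, 1 <= \sum_(N <= n < M | 1 <= side n * y n) y n ^+ (m - 2).
  apply: contrapT => h; apply: nB.
  apply: (@series_large_radius _ (fun n => al n) d%:R (m - 2) N 1) => // M.
  by rewrite leNgt; apply/negP => /ltW hM; apply: h; exists M.
pose r q := side q * y q.
have mclustered k rho : measurable (clustered xi k rho) by apply: (clustered_measurable WS).
(* Events indexed by time, with the radius of the dyadic block containing k, so that their upper
   limit means encounters at arbitrarily late times. *)
pose A k := clustered xi k (r (trunc_log 2 k)).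
have A_ge n : Cdown K d C0 lam <= pr (\bigcup_(k >= n) A k).
  have [M hM] := big n.
  pose Q := [seq q <- index_iota n M | 1 <= side q * y q].
  have := @pr_hit_blocks_ge _ _ _ P _ _ _ _ C0_ge0 lam_ge1 d_gt0 xi G WS m_ge3 Q r.
  move=> /(_ (filter_uniq _ (iota_uniq _ _))) h.
  apply: (le_trans (h _ _)).
  - move=> q; rewrite mem_filter => /andP[r1 _]; rewrite r1 /=.
    by rewrite ler_piMr ?(ltW (side_gt0 _ _)).
  - rewrite big_filter (eq_bigr (fun q => y q ^+ (m - 2)))// => q _.
    by rewrite /r mulrC mulKf// gt_eqF// side_gt0.
  apply: pr_mono.
  - apply: measurable_ex => q; apply: measurable_ex => k.
    rewrite (_ : mkset _ = [set w |
        (q \in Q /\ (2 ^ q <= k < 2 ^ q.+1)%N) /\ clustered xi k (r q) w]).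
      exact/measurable_andl/mclustered.
    by apply/seteqP; split => w; [case|case=> -[]].
  - by apply: bigcup_measurable => k _; exact: mclustered.
  move=> w [q [k [qQ kq cl]]]; exists k => /=.
    move: qQ; rewrite mem_filter mem_index_iota => /andP[_ /andP[nq _]].
    apply: (leq_trans nq); case/andP: kq => qk _; apply: leq_trans qk.
    by rewrite ltnW// ltn_expl.
  rewrite /A (_ : trunc_log 2 k = q)//.
  exact: trunc_log_eq.
have mA k : measurable (A k) by exact: mclustered.
have mL : measurable (lim_sup_set A).
  by apply: bigcap_measurable => // n _; exact: bigcup_measurable.
apply: (@ae_absurd _ _ _ P _ mL).
  apply: lt_le_trans (Cdown_gt0 K d C0_ge0 lam_ge1) _.
  exact: pr_lim_sup_set_ge.
apply: filterS2 HY HL => w hY [N hN] hA.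
have [k /= Nk Ak] := hA N.+1 I.
have k0 : (0 < k)%N by exact: leq_trans Nk.
have := hN k Nk; apply/negP; rewrite -leNgt.
set q := trunc_log 2 k in Ak.
have /andP[qk kq] := trunc_log_bounds (ltnSn 1) k0.
have r0 : 0 <= r q by rewrite mulr_ge0// ltW// side_gt0.
apply: (le_trans (hY _ _ r0 Ak)).
rewrite /r /y mulrCA [d%:R * _]mulrC divfK ?gt_eqF// ler_pM ?le_min ?al_ge0 ?ler01//.
  by rewrite ler_wsqrtr// ler_nat.
rewrite ge_min a_dec ?ltr0n// -natrX ler_nat; exact: ltnW.
Qed.

Local Notation gauge n := (Num.max (al n) (side n)^-1).

(** This is the purpose of the second term of [gauge]: the radius never falls below one step. *)
Lemma side_gauge_ge1 n : 1 <= side n * gauge n.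
Proof.
rewrite -[leLHS](divff (lt0r_neq0 (side_gt0 R n))) ler_pM2l ?side_gt0//.
by rewrite le_max lexx orbT.
Qed.

Lemma gauge_series (c c' : R) :
  0 <= c -> 0 <= c' ->
  (exists B, forall M, \sum_(1 <= n < M) al n ^+ (m - 2) <= B) ->
  exists B, forall N, \sum_(0 <= n < N) c * (c' * gauge n) ^+ (m - 2) <= B.
Proof.
move=> c0 c'0 [B hB].
exists (c * c' ^+ (m - 2) * (al 0 ^+ (m - 2) + B + 4)) => N.
have p0 : (0 < m - 2)%N by rewrite subn_gt0.
apply: (@le_trans _ _ (\sum_(0 <= n < N) c * c' ^+ (m - 2) * (al n ^+ (m - 2) + (side n)^-1))).
  apply: ler_sum => n _; rewrite exprMn mulrA ler_wpM2l ?mulr_ge0 ?exprn_ge0//.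
  apply: le_trans (maxr_pow_le _ (al_ge0 n) _) _.
    by rewrite invr_ge0 ltW// side_gt0.
  by rewrite lerD2l side_inv_pow_le.
rewrite -mulr_sumr ler_wpM2l ?mulr_ge0 ?exprn_ge0// big_split /= lerD ?sum_side_inv_le//.
case: N => [|N]; last by rewrite big_ltn// lerD2l.
have := hB 1%N; rewrite !big_geq// => B0.
by rewrite addr_ge0// exprn_ge0.
Qed.

Lemma sqrt_le_gauge q t : (2 ^ q)%:R <= t <= (2 ^ q.+1)%:R ->
  Num.sqrt t * a t <= 2 * side q * gauge q.
Proof.
move=> /andP[qt tq]; have t0 : 0 < t by apply: lt_le_trans qt; rewrite ltr0n expn_gt0.
rewrite ler_pM ?sqrtr_ge0 ?a_ge0//.
  apply: (@le_trans _ _ (side q.+1)); first by rewrite ler_wsqrtr.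
  rewrite -ler_sqr ?nnegrE ?mulr_ge0 ?(ltW (side_gt0 _ _))// exprMn !side_sqr.
  rewrite expnS natrM; have : 0 <= (2 ^ q)%:R :> R by rewrite ler0n.
  by move: (_%:R) => x x0; lra.
rewrite le_max a_dec ?two_gt0// -natrX//.
Qed.

End sharp.

(** * Convergence of the series implies the lower-class property *)

Section upper.
Context (disp : measure_display) (T : measurableType disp) (R : realType).
Variable P : probability T R.
Variables (K d : nat).
Local Notation pr := (pr P).
Hypothesis d_gt0 : (0 < d)%N.
Local Notation m := (K * d)%N.
Hypothesis m_ge3 : (3 <= m)%N.
Variable a : R -> R.
Hypothesis a_ge0 : forall t, 0 < t -> 0 <= a t.
Hypothesis a_dec : forall s t, 0 < s -> s <= t -> a t <= a s.
Local Notation side n := (Num.sqrt (2 ^ n)%:R : R).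
Local Notation al n := (a (2 ^+ n)).
Local Notation gauge n := (Num.max (al n) (side n)^-1).
Hypothesis al_series : exists B, forall M, \sum_(1 <= n < M) al n ^+ (m - 2) <= B.

Let m_ge2 : (2 <= m)%N. Proof. exact: ltnW. Qed.

(** On block q the threshold sqrt k a(k) is at most the constant radius [r q]. If Y k does not
    exceed it, the walkers are clustered at time k, which Borel-Cantelli rules out for all large
    q. *)
Lemma walk_upper (C0 lam : R) (xi : nat -> 'I_K.+1 -> 'I_d -> T -> R)
    (G : nat * 'I_K.+1 -> set (set T)) (Y : nat -> T -> R) :
  0 <= C0 -> 1 <= lam -> walk_system P C0 lam xi G ->
  (forall k i i' c w, `|travel xi 0 k i c w - travel xi 0 k i' c w| <= Y k w) ->
  {ae P, forall w, exists N, forall k, (N < k)%N -> Num.sqrt k%:R * a k%:R < Y k w}.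
Proof.
move=> C00 lam1 WS hY.
pose r q := 2 * side q * gauge q.
have r1 q : 1 <= r q.
  by rewrite /r -mulrA; have := side_gauge_ge1 a q; lra.
pose E q := [set w | exists k, (2 ^ q <= k <= 2 * 2 ^ q)%N /\ clustered xi k (r q) w].
have mE q : measurable (E q).
  by apply: measurable_ex => k; apply/measurable_andl/(clustered_measurable WS).
have [B hB] := gauge_series m_ge3 a_ge0 (ltW (Chit_gt0 K d C00 lam1)) (ler0n R 2) al_series.
have hE N : \sum_(0 <= q < N) pr (E q) <= B.
  apply: le_trans (hB N); apply: ler_sum => q _.
  have q0 : (0 < 2 ^ q)%N by rewrite expn_gt0.
  apply: le_trans (pr_hit_le C00 lam1 d_gt0 WS m_ge2 q0 (r1 q)) _.
  rewrite (_ : r q / side q = 2 * gauge q)//.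
  by rewrite /r; field; rewrite gt_eqF// side_gt0.
apply: filterS (ae_not_lim_sup_set mE hE) => w /= hw.
have [N hN] : exists N, forall q, (N <= q)%N -> ~ E q w.
  apply: contrapT => h; apply: hw => N _; apply: contrapT => h'; apply: h.
  by exists N => q Nq Eq; apply: h'; exists q.
exists (2 ^ N)%N => k Nk.
have k0 : (0 < k)%N by exact: leq_trans Nk.
have := trunc_log_bounds (ltnSn 1) k0; set q := trunc_log 2 k => /andP[qk kq].
have Nq : (N <= q)%N.
  by rewrite -ltnS -(ltn_exp2l _ _ (ltnSn 1)); apply: leq_trans kq; exact: ltnW.
have sg : Num.sqrt k%:R * a k%:R <= r q.
  by apply: sqrt_le_gauge => //; rewrite !ler_nat qk ltnW.
apply: (le_lt_trans sg); rewrite ltNge; apply/negP => Yr.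
apply: (hN q Nq); exists k; split; first by rewrite qk -expnS ltnW.
by move=> i i' c; exact: le_trans (hY k i i' c w) Yr.
Qed.

Variable W : 'I_K.+1 -> R -> T -> 'rV[R]_d.
Hypothesis WW : independent_wiener_vecs P W.

Lemma travel_wiener_step (delta : R) k i c w :
  travel (wiener_step W delta) 0 k i c w =
  (W i (k%:R * delta) w ord0 c - W i 0 w ord0 c) / Num.sqrt delta.
Proof.
rewrite /travel; elim: k => [|k IH]; first by rewrite big_ord0 mul0r subrr mul0r.
by rewrite big_ord_recr /= IH /wiener_step -mulrDl add0n addrC subrKA.
Qed.

Let mesh L : R := (2 ^ L)%:R^-1.

Let mesh_gt0 L : 0 < mesh L.
Proof. by rewrite invr_gt0 ltr0n expn_gt0. Qed.

Let clustered_mesh L k (rho : R) w : clustered (wiener_step W (mesh L)) k (rho * side L) w <->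
  forall i i' c, `|(W i (k%:R * mesh L) w ord0 c - W i 0 w ord0 c) -
    (W i' (k%:R * mesh L) w ord0 c - W i' 0 w ord0 c)| <= rho.
Proof.
have sL : 0 < side L by exact: side_gt0.
have e : Num.sqrt (mesh L) = (side L)^-1 by rewrite sqrtrV ?ler0n.
by split=> h i i' c; have := h i i' c; rewrite !travel_wiener_step e invrK -mulrBl
  normrM (ger0_norm (ltW sL)) ler_pM2r.
Qed.

Lemma ae_wiener_start : {ae P, forall w, forall i c, W i 0 w ord0 c = 0}.
Proof.
apply: filter_forall => i; apply: filter_forall => c.
by have [WV _] := WW; have [h _] := WV i; have [_ h0 _ _ _] := h c.
Qed.

Lemma ae_wiener_continuous : {ae P, forall w, forall i c,
  {within `[0, +oo[, continuous (fun t => W i t w ord0 c)}}.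
Proof.
apply: filter_forall => i; apply: filter_forall => c.
by have [WV _] := WW; have [h _] := WV i; have [_ _ _ _ hc] := h c.
Qed.

(* The blocks are sampled with mesh 2^-L; the sampled events increase with L,
   and the bound on their probabilities does not depend on L. *)
Lemma wiener_upper :
  {ae P, forall w, exists t0 : R, forall t, t0 < t -> Num.sqrt t * a t < D_wiener W t w}.
Proof.
have dK0 : 0 < (2 * (K.+1 * d)%:R : R)^-1.
  by rewrite invr_gt0 mulr_gt0// ltr0n muln_gt0.
have [lam lam1 lamP] := normal_prob_tail dK0.
have C00 : 0 <= 2 ^+ d :> R by rewrite exprn_ge0.
have WS L := wiener_step_system WW (mesh_gt0 L) lamP.
pose r q := 2 * side q * gauge q.
(* The radius is doubled to leave room for moving each of two walkers by r q / 2 to a mesh point;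
   the factor [side L] converts it to the unit of the rescaled steps. *)
pose U q L := [set w | exists k, (2 ^ (q + L) <= k <= 2 * 2 ^ (q + L))%N /\
  clustered (wiener_step W (mesh L)) k (2 * r q * side L) w].
have mU q L : measurable (U q L).
  have [G WSL] := WS L.
  by apply: measurable_ex => k; apply/measurable_andl/(clustered_measurable WSL).
have [B hB] := gauge_series m_ge3 a_ge0 (ltW (Chit_gt0 K d C00 lam1)) (ler0n R 4) al_series.
have prU q L : pr (U q L) <= Chit K d (2 ^+ d) lam * (4 * gauge q) ^+ (m - 2).
  have [G WSL] := WS L.
  have q0 : (0 < 2 ^ (q + L))%N by rewrite expn_gt0.
  have r1 : 1 <= 2 * r q * side L.
    have h : 1 <= side q * gauge q * side L.
      by rewrite -[leLHS]mulr1 ler_pM// ?side_ge1// side_gauge_ge1.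
    rewrite [leRHS](_ : _ = 4 * (side q * gauge q * side L)); last by rewrite /r; ring.
    by apply: (le_trans h); rewrite ler_peMl ?(le_trans _ h)// ler1n.
  apply: le_trans (pr_hit_le C00 lam1 d_gt0 WSL m_ge2 q0 r1) _.
  rewrite (_ : _ / side (q + L) = 4 * gauge q)//.
  rewrite expnD natrM sqrtrM ?ler0n// /r.
  by field; rewrite !gt_eqF// side_gt0.
(* The mesh point k 2^-L is also the point 2 k 2^-(L+1) of the next mesh. *)
have U_mono q : {homo U q : n l / (n <= l)%N >-> (n <= l)%O}.
  apply: homo_leq; [exact: lexx|exact: le_trans|move=> L].
  apply/subsetPset => w [k [/andP[qk kq] cl]]; exists (2 * k)%N; split.
    by rewrite addnS expnS !leq_mul2l /=; apply/andP.
  apply/clustered_mesh; move/clustered_mesh: cl.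
  rewrite (_ : (2 * k)%:R * mesh L.+1 = k%:R * mesh L)//.
  rewrite /mesh expnS !natrM; field.
  by rewrite pnatr_eq0 -lt0n expn_gt0.
pose E q := \bigcup_L U q L.
have mE q : measurable (E q) by exact: bigcup_measurable.
have prE_le q : pr (E q) <= Chit K d (2 ^+ d) lam * (4 * gauge q) ^+ (m - 2).
  have cv := @nondecreasing_cvg_mu _ _ _ P (U q) (mU q) (mE q) (U_mono q).
  rewrite -lee_fin -prE// -(cvg_lim _ cv)//; apply: lime_le.
    by apply/cvg_ex; exists (P (E q)).
  by apply: nearW => L; have := prU q L; rewrite -lee_fin -prE.
have hE N : \sum_(0 <= q < N) pr (E q) <= B.
  by apply: le_trans (hB N); apply: ler_sum => q _; exact: prE_le.
apply: filterS3 (ae_not_lim_sup_set mE hE) ae_wiener_start ae_wiener_continuous => w /= hw w0 wc.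
have [N hN] : exists N, forall q, (N <= q)%N -> ~ E q w.
  apply: contrapT => h; apply: hw => N _; apply: contrapT => h'; apply: h.
  by exists N => q Nq Eq; apply: h'; exists q.
exists (2 ^ N)%:R => t Nt.
have t1 : 1 <= t by apply: le_trans (ltW Nt); rewrite ler1n expn_gt0.
have t0 : 0 < t by exact: lt_le_trans t1.
pose q := trunc_log 2 (Num.truncn t).
have n0 : (0 < Num.truncn t)%N by rewrite Num.Theory.truncn_gt0.
have /andP[qt tq] : (2 ^ q)%:R <= t <= (2 ^ q.+1)%:R.
  have /andP[h1 h2] := trunc_log_bounds (ltnSn 1) n0.
  have /andP[t2 t3] := Num.Theory.truncn_itv (ltW t0).
  apply/andP; split; first by apply: le_trans t2; rewrite ler_nat.
  by apply: (le_trans (ltW t3)); rewrite ler_nat.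
have Nq : (N <= q)%N.
  rewrite -ltnS -(ltn_exp2l _ _ (ltnSn 1)) -(ltr_nat R).
  exact: lt_le_trans tq.
have sg : Num.sqrt t * a t <= r q by apply: sqrt_le_gauge => //; rewrite qt.
apply: (le_lt_trans sg); rewrite ltNge; apply/negP => Dr.
have rq0 : 0 < r q by rewrite /r !mulr_gt0 ?lt_max ?invr_gt0 ?side_gt0 ?orbT.
have near_t : \forall s \near t, forall i c,
    `|W i t w ord0 c - W i s w ord0 c| <= r q / 2.
  suff near_ic i c : \forall s \near t, `|W i t w ord0 c - W i s w ord0 c| <= r q / 2.
    have near_all := @filter_forall R ('I_K.+1 * 'I_d)%type
      (fun p s => `|W p.1 t w ord0 p.2 - W p.1 s w ord0 p.2| <= r q / 2)
      (nbhs t) (nbhs_filter t) (fun p => near_ic p.1 p.2).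
    by apply: filterS near_all => s hs i c; exact: hs (i, c).
  have /continuous_within_itvcyP[ct _] := wc i c.
  have tin : t \in `]0, +oo[ by rewrite in_itv /= t0.
  have := ct t tin => /cvgrPdist_le; apply.
  by rewrite divr_gt0.
have [e /= e0 he] := near_t.
have [L Le] : exists L, mesh L < e.
  exists (Num.truncn e^-1).+1; rewrite /mesh invf_plt ?posrE ?ltr0n ?expn_gt0//.
  apply: (lt_trans (truncnS_gt _)); rewrite ltr_nat.
  exact: ltn_expl.
have mL : 0 < (2 ^ L)%:R :> R by rewrite ltr0n expn_gt0.
have tL0 : 0 <= t * (2 ^ L)%:R by rewrite mulr_ge0// ltW.
(* The last mesh point not after t; it stays in block q because 2^q is itself a mesh point. *)
pose k := Num.truncn (t * (2 ^ L)%:R).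
have /andP[k1 k2] := Num.Theory.truncn_itv tL0.
apply: (hN q Nq); exists L => //; exists k; split.
  apply/andP; split.
    by rewrite /k Num.Theory.truncn_ge_nat// expnD natrM ler_pM2r.
  rewrite -(ler_nat R); apply: (le_trans k1).
  by rewrite expnD mulnA -expnS natrM ler_pM2r.
have dist_e : ball t e (k%:R * mesh L).
  have e1 : k%:R * mesh L <= t by rewrite ler_pdivrMr.
  have e2 : t < k%:R * mesh L + mesh L.
    by rewrite -{2}[mesh L]mul1r -mulrDl natr1 ltr_pdivlMr.
  by rewrite /ball /= ltr_distl; apply/andP; split; lra.
apply/clustered_mesh => i i' c; rewrite !w0 !subr0.
have := he _ dist_e i c; have := he _ dist_e i' c.
have := le_trans (coord_le_max_dist (fun i => W i t w) i i' c) Dr.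
rewrite !ler_norml => /andP[? ?] /andP[? ?] /andP[? ?].
by apply/andP; split; lra.
Qed.

End upper.

Theorem theorem3p2 (R : realType) (d K : nat) (a : R -> R)
    (disp1 : measure_display) (T1 : measurableType disp1)
    (P1 : probability T1 R) (W : 'I_K -> R -> T1 -> 'rV[R]_d)
    (disp2 : measure_display) (T2 : measurableType disp2)
    (P2 : probability T2 R) (S : 'I_K -> nat -> T2 -> 'rV[int]_d) :
  (1 <= d)%N ->
  1 + 3 / d%:R <= K%:R :> R ->
  (forall t, 0 < t -> 0 <= a t) ->
  (forall s t, 0 < s -> s <= t -> a t <= a s) ->
  independent_wiener_vecs P1 W ->
  independent_random_walks P2 S ->
  (LLC P1 (D_wiener W) (fun t : R => Num.sqrt t * a t) <->
    (\sum_(1 <= n <oo) (a (2 ^+ n) ^+ (K * d - d - 2))%:E < +oo)%E) /\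
  (LLC P2 (D_walk R S) (fun n : nat => Num.sqrt n%:R * a n%:R) <->
    (\sum_(1 <= n <oo) (a (2 ^+ n) ^+ (K * d - d - 2))%:E < +oo)%E).
Proof.
move=> d0 Kd a_ge0 a_dec WW SS.
have dR0 : 0 < d%:R :> R by rewrite ltr0n.
case: K Kd W WW S SS => [Kd|K Kd W WW S SS].
  by exfalso; move: Kd; rewrite leNgt ltr_pwDl// divr_ge0.
(* Here [K] already denotes the number of walkers minus one, so the hypothesis on their number reads
   K d >= 3. *)
have m3 : (3 <= K * d)%N.
  by move: Kd; rewrite -(natr1 K) [1 + _]addrC lerD2r ler_pdivrMr// -natrM ler_nat.
have -> : (K.+1 * d - d - 2 = K * d - 2)%N by rewrite mulSn addKn.
have al0 n : 0 <= a (2 ^+ n) ^+ (K * d - 2).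
  by rewrite exprn_ge0// a_ge0// exprn_gt0.
have C20 : 0 <= 2 ^+ d :> R by rewrite exprn_ge0.
have series := nneseries_bounded 1 al0.
split; split.
- move=> L; apply/series.
  have dK0 : 0 < (2 * (K.+1 * d)%:R : R)^-1.
    by rewrite invr_gt0 mulr_gt0// ltr0n muln_gt0.
  have [lam lam1 lamP] := normal_prob_tail dK0.
  (* Mesh 1: the Wiener processes are observed at integer times. *)
  have [G WS] := wiener_step_system WW (ltr01 : 0 < 1 :> R) lamP.
  apply: (lower_class_series C20 lam1 d0 m3 a_ge0 a_dec
    (Y := fun k w => D_wiener W k%:R w) WS).
    apply: filterS (ae_wiener_start WW) => w w0 k rho rho0 cl.
    apply: max_dist_le => // i i' c; have := cl i i' c.
    by rewrite !travel_wiener_step sqrtr1 !divr1 mulr1 !w0 !subr0.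
  apply: filterS L => w [t0 ht0]; exists (Num.truncn t0).+1 => k tk.
  apply: ht0; apply: (lt_trans (truncnS_gt t0)).
  by rewrite ltr_nat.
- move=> /series al_series.
  exact: (wiener_upper d0 m3 a_ge0 a_dec al_series WW).
- move=> L; apply/series.
  have [xi [G [WS tr]]] := random_walk_system d0 SS.
  have lam1 : 1 <= 2 * (K.+1 * d)%:R :> R.
    by rewrite -[leLHS]mul1r ler_pM// ?ler1n// muln_gt0.
  have Cw0 : 0 <= Cwalk R d by rewrite !mulr_ge0 ?addr_ge0 ?mulr_ge0 ?exprn_ge0.
  apply: (lower_class_series Cw0 lam1 d0 m3 a_ge0 a_dec
    (Y := fun k w => D_walk R S k w) WS) => //.
  apply: nearW => w k rho rho0 cl.
  by apply: max_dist_le => // i i' c; have := cl i i' c; rewrite !tr !mxE.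
- move=> /series al_series.
  have [xi [G [WS tr]]] := random_walk_system d0 SS.
  have lam1 : 1 <= 2 * (K.+1 * d)%:R :> R.
    by rewrite -[leLHS]mul1r ler_pM// ?ler1n// muln_gt0.
  have Cw0 : 0 <= Cwalk R d by rewrite !mulr_ge0 ?addr_ge0 ?mulr_ge0 ?exprn_ge0.
  apply: (walk_upper d0 m3 a_ge0 a_dec al_series Cw0 lam1 WS) => k i i' c w.
  have := coord_le_max_dist (fun i => map_mx (intr : int -> R) (S i k w)) i i' c.
  by rewrite !mxE !tr.
Qed.
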